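(* Let $\Omega\subseteq\mathbb N$ and let $T$ be a random piecewise linear system on $[0,1]$, given by $\{T_j\}_{j\in\Omega}$ and a positive probability vector $\mathbf p=(p_j)_{j\in\Omega}$, satisfying the assumptions (A1), (A3), (A4) and (A5) listed in the context. Assume furthermore that $|k_{i,j}|>1$ for each $j\in\Omega$ and $1\le i\le N$. Let $M$ be the fundamental matrix of $T$. Then a function $h\in L^1(\lambda)$ is $T$-invariant if and only if $h=h_\gamma$ (as elements of $L^1(\lambda)$) for some solution $\gamma\in\mathbb R^{N-1}$ of the system $M\gamma=0$.
   Context: Setting. $\Omega\subseteq\mathbb N$ (finite or countably infinite), $\{T_j:[0,1]\to[0,1]\}_{j\in\Omega}$ is a family of piecewise linear maps, $\mathbf p=(p_j)_{j\in\Omega}$ satisfies $p_j>0$ and $\sum_j p_j=1$. The random system $T$ applies $T_j$ with probability $p_j$. $\lambda$ is Lebesgue measure on $[0,1]$. Assumptions. (A1) The set of all critical points of the maps $T_j$, $j \in \Omega$, is finite; write $0=z_0<z_1<\cdots<z_N=1$. These points specify a common partition $\{I_i\}_{1\le i\le N}$ of $[0,1]$ into intervals, $I_i$ having endpoints $z_{i-1},z_i$ (each $z_i$, $1\le i\le N-1$, belongs to exactly one of $I_i,I_{i+1}$), such that for all $i,j$ there are real $k_{i,j}\neq0$, $d_{i,j}$ with $T_j(x)=k_{i,j}x+d_{i,j}$ for $x\in I_i$. (A3) For each $1\le i\le N$ there is $1\le n\le N$ with $\frac{\sum_{j}\frac{p_j}{k_{i,j}}d_{i,j}}{1-\sum_j\frac{p_j}{k_{i,j}}}\neq\frac{\sum_{j}\frac{p_j}{k_{n,j}}d_{n,j}}{1-\sum_j\frac{p_j}{k_{n,j}}}$.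 (A4) For each $j$: $d_{1,j}=0$ if $k_{1,j}>0$ and $d_{1,j}=1$ if $k_{1,j}<0$; $d_{N,j}=1-k_{N,j}$ if $k_{N,j}>0$ and $d_{N,j}=-k_{N,j}$ if $k_{N,j}<0$. (A5) $\sum_{j\in\Omega}\frac{p_j}{k_{i,j}}\neq0$ for each $1\le i\le N$. Notation. $\Omega^t$ is the set of words of length $t$ over $\Omega$, $\Omega^0=\{\varepsilon\}$; $\omega_1^t$ is the initial block of length $t$ of $\omega$. For $\omega=\omega_1\cdots\omega_t$, $T_\omega=T_{\omega_t}\circ\cdots\circ T_{\omega_1}$, $T_\varepsilon=\mathrm{id}$. For $y\in[0,1]$ and a word $\omega$: $\tau_\omega(y,0)=1$; for $1\le t\le|\omega|$, $\tau_\omega(y,t)=\frac{p_{\omega_t}}{k_{i,\omega_t}}$ if $T_{\omega_1^{t-1}}(y)\in I_i$; $\delta_\omega(y,t)=\prod_{n=0}^t\tau_\omega(y,n)$. $\mathbf 1_A$ is the indicator function of $A$. For $1\le n\le N$, $\mathrm{KI}_n(y)=\sum_{t\ge1}\sum_{\omega\in\Omega^t}\delta_\omega(y,t)\mathbf 1_{I_n}(T_{\omega_1^{t-1}}(y))$. (All such series converge absolutely, since $\max_i\sum_j p_j/|k_{i,j}|<1$.) For $1\le i\le N-1$, $j\in\Omega$: $a_{i,j}=k_{i,j}z_i+d_{i,j}$, $b_{i,j}=k_{i+1,j}z_i+d_{i+1,j}$. The fundamental matrix $M=(\mu_{n,i})$ is the $N\times(N-1)$ matrix with $\mu_{n,i}=\sum_{j\in\Omega}\big[\frac{p_j}{k_{i,j}}\mathrm{KI}_n(a_{i,j})-\frac{p_j}{k_{i+1,j}}\mathrm{KI}_n(b_{i,j})\big]+\epsilon_{n,i}$,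 where $\epsilon_{i,i}=\sum_j\frac{p_j}{k_{i,j}}$, $\epsilon_{i+1,i}=-\sum_j\frac{p_j}{k_{i+1,j}}$, and $\epsilon_{n,i}=0$ otherwise. For $x,y\in[0,1]$, $L_y(x)=\sum_{t\ge0}\sum_{\omega\in\Omega^t}\delta_\omega(y,t)\mathbf 1_{[0,T_\omega(y))}(x)$. For $\gamma=(\gamma_1,\dots,\gamma_{N-1})^{\intercal}$, $h_\gamma=\sum_{m=1}^{N-1}\gamma_mh_m$ with $h_m=\sum_{\ell\in\Omega}\big[\frac{p_\ell}{k_{m,\ell}}L_{a_{m,\ell}}-\frac{p_\ell}{k_{m+1,\ell}}L_{b_{m,\ell}}\big]$. Perron–Frobenius operator: on $L^1(\lambda)$, $P_{T_j}f(x)=\sum_{y\in T_j^{-1}\{x\}}\frac{f(y)}{|T_j'(y)|}$ and $P_Tf=\sum_{j\in\Omega}p_jP_{T_j}f$. A function $h\in L^1(\lambda)$ is $T$-invariant if $P_Th=h$ $\lambda$-a.e. *)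

(* Defs.v *)
From mathcomp Require Import all_boot all_order all_algebra.
From mathcomp Require Import all_classical all_reals all_analysis.

Set Implicit Arguments.
Unset Strict Implicit.
Unset Printing Implicit Defensive.

Import Order.TTheory GRing.Theory Num.Theory.
Import numFieldNormedType.Exports.

Local Open Scope classical_set_scope.
Local Open Scope ring_scope.

(* Sum of an absolutely summable real family: sum of the positive parts minus
   sum of the negative parts. *)
Definition asum (R : realType) (X : choiceType) (D : set X) (f : X -> R) : R :=
  fine (\esum_(x in D) (f^\+ x)%R%:E - \esum_(x in D) (f^\- x)%R%:E)%E.

(* Raw data; all conditions are the separate predicates below. With
   N = nint, the functions piece, slope and icpt are meaningful at the interval
   indices 1, ..., N and zpt at 0, ..., N: the map of letter j is
   x |-> slope i j * x + icpt i j on piece i, whose end points are zpt (i - 1)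
   and zpt i. Values at other indices, at letters outside Omega, and values of
   Tmap j outside [0, 1] are irrelevant. *)
Record random_pl (R : realType) := RandomPL {
  Omega : set nat;
  Tmap : nat -> R -> R;
  prob : nat -> R;
  nint : nat;
  zpt : nat -> R;
  piece : nat -> set R;
  slope : nat -> nat -> R;
  icpt : nat -> nat -> R
}.

Section Assumptions.
Context {R : realType}.
Implicit Type S : random_pl R.

Definition random_system S : Prop :=
  [/\ forall j, Omega S j -> forall x, 0 <= x <= 1 -> 0 <= Tmap S j x <= 1,
      forall j, Omega S j -> 0 < prob S j &
      (\esum_(j in Omega S) (prob S j)%:E = 1)%E].

(* For a piecewise linear map of [0, 1], the critical points are the end points
   of [0, 1] and the points where two linear branches meet, that is, the jumps
   and the changes of slope. *)
Definition critical_points (f : R -> R) : set R :=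
  [set c | c = 0 \/ c = 1 \/ (0 < c < 1 /\ ~ derivable f c 1)].

Definition common_linear_partition S : Prop :=
  [/\ zpt S 0%N = 0 /\ zpt S (nint S) = 1,
      (forall i, (i < nint S)%N -> zpt S i < zpt S i.+1) /\
      [set zpt S i | i in [set i | (i <= nint S)%N]] =
        \bigcup_(j in Omega S) critical_points (Tmap S j),
      forall i, (1 <= i <= nint S)%N ->
        `]zpt S i.-1, zpt S i[ `<=` piece S i /\
        piece S i `<=` `[zpt S i.-1, zpt S i],
      partition [set i | (1 <= i <= nint S)%N] (piece S) `[0, 1] &
      forall i j, (1 <= i <= nint S)%N -> Omega S j ->
        slope S i j != 0 /\
        forall x, piece S i x -> Tmap S j x = slope S i j * x + icpt S i j].

Definition mean_inv_slope S (i : nat) : R :=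
  asum (Omega S) (fun j => prob S j / slope S i j).

Definition mean_fixed_point S (i : nat) : R :=
  asum (Omega S) (fun j => prob S j / slope S i j * icpt S i j) /
    (1 - mean_inv_slope S i).

Definition no_common_mean_fixed_point S : Prop :=
  forall i, (1 <= i <= nint S)%N ->
  exists2 n, (1 <= n <= nint S)%N & mean_fixed_point S i <> mean_fixed_point S n.

Definition boundary_preserving S : Prop :=
  forall j, Omega S j ->
  [/\ 0 < slope S 1 j -> icpt S 1 j = 0,
      slope S 1 j < 0 -> icpt S 1 j = 1,
      0 < slope S (nint S) j -> icpt S (nint S) j = 1 - slope S (nint S) j &
      slope S (nint S) j < 0 -> icpt S (nint S) j = - slope S (nint S) j].

Definition nonzero_mean_inv_slope S : Prop :=
  forall i, (1 <= i <= nint S)%N -> mean_inv_slope S i <> 0.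

Definition expanding S : Prop :=
  forall i j, (1 <= i <= nint S)%N -> Omega S j -> 1 < `|slope S i j|.

End Assumptions.

Section FundamentalMatrix.
Context {R : realType}.
Variable S : random_pl R.

Definition words (t : nat) : set (seq nat) :=
  [set w | size w = t /\ forall j, j \in w -> Omega S j].

(* The first letter of w is applied first. *)
Definition Tword (w : seq nat) (y : R) : R := foldl (fun x j => Tmap S j x) y w.

(* For y in [0, 1], exactly one term of the sum is nonzero, namely the one for
   the interval containing the image of y under the first t - 1 letters; the
   t-th letter of w is nth 0 w t.-1. *)
Definition tau (w : seq nat) (y : R) (t : nat) : R :=
  if t is s.+1 then
    \sum_(1 <= i < (nint S).+1)
      \1_(piece S i) (Tword (take s w) y) *
      (prob S (nth 0%N w s) / slope S i (nth 0%N w s))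
  else 1.

Definition delta (w : seq nat) (y : R) (t : nat) : R :=
  \prod_(0 <= n < t.+1) tau w y n.

Definition KI (n : nat) (y : R) : R :=
  asum [set t | (1 <= t)%N] (fun t =>
    asum (words t) (fun w =>
      delta w y t * \1_(piece S n) (Tword (take t.-1 w) y))).

Definition a_ (i j : nat) : R := slope S i j * zpt S i + icpt S i j.
Definition b_ (i j : nat) : R := slope S i.+1 j * zpt S i + icpt S i.+1 j.

Definition epsilon (n i : nat) : R :=
  if n == i then mean_inv_slope S i
  else if n == i.+1 then - mean_inv_slope S i.+1
  else 0.

Definition mu (n i : nat) : R :=
  asum (Omega S) (fun j =>
    prob S j / slope S i j * KI n (a_ i j) -
    prob S j / slope S i.+1 j * KI n (b_ i j))
  + epsilon n i.

(* Ordinals are 0-based, whereas mu is indexed from 1. *)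
Definition fundamental_matrix : 'M[R]_(nint S, (nint S).-1) :=
  \matrix_(n < nint S, i < (nint S).-1) mu n.+1 i.+1.

Definition L_fun (y x : R) : R :=
  asum [set: nat] (fun t =>
    asum (words t) (fun w => delta w y t * \1_(`[0, Tword w y[) x)).

Definition h_basis (m : nat) (x : R) : R :=
  asum (Omega S) (fun l =>
    prob S l / slope S m l * L_fun (a_ m l) x -
    prob S l / slope S m.+1 l * L_fun (b_ m l) x).

Definition h_gamma (gamma : 'cV[R]_((nint S).-1)) (x : R) : R :=
  \sum_(m < (nint S).-1) gamma m 0 * h_basis m.+1 x.

End FundamentalMatrix.

Arguments h_gamma {R} S gamma x.

Section PerronFrobenius.
Context {R : realType}.

(* The derivative can fail to exist only at the partition points, whose images under
   the countably many maps form a null set. *)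
Definition PF1 (f : R -> R) (g : R -> R) (x : R) : R :=
  \sum_(y \in [set y | 0 <= y <= 1 /\ f y = x]) g y / `|derive1 f y|.

Definition PF (S : random_pl R) (g : R -> R) (x : R) : R :=
  asum (Omega S) (fun j => prob S j * PF1 (Tmap S j) g x).

Definition ae_eq01 (f g : R -> R) : Prop :=
  {ae lebesgue_measure, forall x : R, 0 <= x <= 1 -> f x = g x}.

Definition T_invariant (S : random_pl R) (h : R -> R) : Prop := ae_eq01 (PF S h) h.

End PerronFrobenius.

(* Main.v *)
Require Import Defs.
From mathcomp Require Import all_boot all_order all_algebra.
From mathcomp Require Import all_classical all_reals all_analysis.
From mathcomp Require Import measurable_realfun ring lra.

(** For letters [j] let [p j] be the probabilities and [k i j] the slopes. On
    bounded functions of [0, 1] consider the averaging operator that sends [f] to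
    the function whose value at [y], in piece [i], is the sum over [j] of
    [p j / k i j * f (T_j y)]. As all slopes exceed 1 in absolute value and there
    are finitely many pieces, [avg] is a contraction for the sup norm
    ([ratio01]), and [resolvent], the Neumann series of [(1 - avg)^-1], converges.
    Both series of the problem are resolvents: [L_fun y x] is the resolvent at
    [y] of the function [u |-> 1_([0, u[)(x)], and [KI n] is the resolvent of the
    indicator of piece [n] times the mean inverse slope ([L_funE], [KIE]).

    Dually, [h] is invariant if and only if the functional sending [f] to the
    integral of [h f] takes the same value on [f] and on [koopman f], the mean of
    the functions [f \o T_j], for every bounded measurable [f] ([invariantP]). The
    two operators are related by an integration on each piece
    ([primitive_koopman]):
<<
      primitive (koopman f) =
        avg (primitive f) + sum over 0 <= m < N of jump m (primitive f) * step m
>>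
    where [step m] is 1 after the partition point [z m] and 0 before it, and
    [jump m] compares the one-sided values of [avg] at [z m]. Let
    [step_resolvent m] be the resolvent of [step m] and [G] the matrix of the
    numbers [jump m' (step_resolvent m)].

    From coefficients to densities. Integrating [h_gamma] against [f] gives the
    functional [kernel_functional g], the sum of
    [g m * jump m (resolvent (primitive f))], where [g] is [gamma] extended by 0
    to both end points ([integral_h_gamma]). The displayed identity shows that
    this functional is invariant as soon as [g] belongs to the left kernel of
    [1 - G] ([kernel_functional_invariant]). Since [step m] is the sum of the
    indicators of the pieces after [z m], a summation by parts turns membership in
    that kernel into the system [M gamma = 0]; the mean inverse slopes appear as
    factors of the equations and are divided out ([left_kernelP]).

    From densities to coefficients. Let [L] be the functional of an invariant [h].
    It takes the same value on [f] and on its Cesaro means along [koopman]. The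
    resolvent of the displayed identity shows that the primitive of the [n]-th
    mean is, up to an error of order [1/n], a combination of the functions
    [step_resolvent m] whose coefficients are its own jumps ([primitive_cesaro]).
    Limits of these jumps along an ultrafilter form a vector [limvec f] in the
    right kernel of [1 - G]. If a combination of functions has a vanishing limit
    vector, then the primitives of its means come uniformly close to 0, so [L]
    vanishes on it, because a functional with an integrable density is continuous
    for uniform convergence of primitives on bounded sets of functions
    ([integrable_small_primitive]). Hence [L] factors through [limvec], that is,
    through the right kernel of [1 - G], and so do the functionals
    [kernel_functional g] with [g] in the left kernel. Narrow bumps, whose
    primitives approximate the steps, show that the latter depend injectively on
    [g] ([kernel_functional_inj]). As the left and right kernels of a square
    matrix have the same dimension, [L] is one of them ([compatible_left_kernel],
    [representation]). Finally [g 0 = 0], because the constant 1 is a combination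
    of the functions [step_resolvent m] ([left_kernel_head]); therefore [g] comes
    from a vector [gamma], and [h] is [h_gamma] almost everywhere. *)

Set Implicit Arguments.
Unset Strict Implicit.
Unset Printing Implicit Defensive.
Import Order.TTheory GRing.Theory Num.Theory.
Import numFieldNormedType.Exports.
Local Open Scope classical_set_scope.
Local Open Scope ring_scope.

(** * Sums of absolutely summable families *)

Section AbsoluteSums.
Context {R : realType} {X : choiceType}.
Implicit Types (D : set X) (f g : X -> R).

Let funrposneg f x : f x = f^\+ x - f^\- x.
Proof. by rewrite -[in LHS](funrposBneg f). Qed.

Definition abs_summable D f : Prop := summable D (EFin \o f).

Lemma esumZ D (c : R) (a : X -> \bar R) : 0 <= c -> (forall x, 0 <= a x)%E ->
  (\esum_(x in D) (c%:E * a x) = c%:E * \esum_(x in D) a x)%E.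
Proof.
have le (d : R) (b : X -> \bar R) : 0 <= d -> (forall x, 0 <= b x)%E ->
    (\esum_(x in D) (d%:E * b x) <= d%:E * \esum_(x in D) b x)%E.
  move=> d0 b0; apply: ub_ereal_sup => _ [A [fA AD] <-].
  rewrite -ge0_mule_fsumr//.
  apply: lee_wpmul2l; first by rewrite lee_fin.
  by apply: ereal_sup_ubound; exists A.
rewrite le_eqVlt => /predU1P[<- a0|c0 a0].
  by rewrite mul0e esum1// => x _; rewrite mul0e.
apply/eqP; rewrite eq_le (le _ _ (ltW c0) a0)/=.
have := le c^-1 (fun x => c%:E * a x)%E.
rewrite invr_ge0 ltW// => /(_ isT) h.
rewrite -[leRHS]mul1e -(@mulfV _ c) ?gt_eqF// EFinM -muleA lee_pmul2l//.
apply: le_trans (h _); last by move=> x; rewrite mule_ge0// lee_fin ltW.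
by apply: le_esum => x _; rewrite muleA -EFinM mulVf ?gt_eqF// mul1e.
Qed.

Lemma eq_asum D f g : (forall x, D x -> f x = g x) -> asum D f = asum D g.
Proof.
move=> fg; rewrite /asum; congr (fine (_ - _)%E); apply: eq_esum => x Dx;
by rewrite /funrpos /funrneg fg.
Qed.

Lemma le_abs_summable D f g : (forall x, D x -> `|f x| <= g x) ->
  abs_summable D g -> abs_summable D f.
Proof.
move=> fg; apply: le_lt_trans; apply: le_esum => x Dx /=.
by rewrite lee_fin (le_trans (fg x Dx))// ler_norm.
Qed.

Lemma abs_summableD D f g : abs_summable D f -> abs_summable D g ->
  abs_summable D (f \+ g).
Proof. by move=> sf sg; rewrite /abs_summable; exact: summableD sf sg. Qed.

Lemma abs_summableZ D (c : R) f : abs_summable D f ->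
  abs_summable D (fun x => c * f x).
Proof.
move=> sf; rewrite /abs_summable /summable.
rewrite (@eq_esum _ _ _ _ (fun x => `|c|%:E * `|(f x)%:E|))%E; last first.
  by move=> x _; rewrite /= normrM EFinM.
rewrite esumZ//.
by rewrite lte_mul_pinfty// lee_fin.
Qed.

Lemma asum_ge0E D f : (forall x, D x -> 0 <= f x) ->
  asum D f = fine (\esum_(x in D) (f x)%:E).
Proof.
move=> f0; rewrite /asum [X in (_ - X)%E]esum1 ?sube0; last first.
  by move=> x Dx; rewrite /funrneg (max_idPr _)// oppr_le0 f0.
by congr fine; apply: eq_esum => x Dx; rewrite /funrpos (max_idPl _)// f0.
Qed.

Lemma esum_fin D f : (forall x, D x -> 0 <= f x) -> abs_summable D f ->
  (\esum_(x in D) (f x)%:E)%E \is a fin_num.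
Proof.
move=> f0; rewrite /abs_summable summableE => h.
rewrite (@eq_esum _ _ _ _ (fun x => `|(EFin \o f) x|)%E)// => x Dx /=.
by rewrite ger0_norm ?f0.
Qed.

(** Additivity produces decompositions into nonnegative families other than the
    positive and negative parts by which [asum] is defined; this compares them. *)
Lemma asum_diff D f g : abs_summable D f -> abs_summable D g ->
  (forall x, D x -> 0 <= f x) -> (forall x, D x -> 0 <= g x) ->
  asum D (fun x => f x - g x) = asum D f - asum D g.
Proof.
move=> sf sg f0 g0; rewrite (asum_ge0E f0) (asum_ge0E g0) -fineB ?esum_fin//.
rewrite -(esumB sf sg)//=.
rewrite /asum; congr (fine (_ - _)%E); apply: eq_esum => x Dx.
  by rewrite funeposE /= /funrpos EFin_max.
by rewrite funenegE /= /funrneg EFin_max EFinN.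
Qed.

Lemma abs_summable_pos D f : abs_summable D f -> abs_summable D f^\+.
Proof.
move=> sf; apply: le_lt_trans sf; apply: le_esum => x Dx /=.
by rewrite lee_fin /funrpos ger0_norm ?le_max ?lexx ?orbT// ge_max ler_norm normr_ge0.
Qed.

Lemma abs_summable_neg D f : abs_summable D f -> abs_summable D f^\-.
Proof.
move=> sf; apply: le_lt_trans sf; apply: le_esum => x Dx /=.
rewrite lee_fin /funrneg ger0_norm ?le_max ?lexx ?orbT// ge_max normr_ge0 andbT.
by rewrite -normrN ler_norm.
Qed.

Lemma asum_posneg D f : abs_summable D f -> asum D f = asum D f^\+ - asum D f^\-.
Proof.
move=> sf; rewrite -asum_diff.
- by apply: eq_asum => x _; rewrite [in LHS](funrposneg f).
- exact: abs_summable_pos.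
- exact: abs_summable_neg.
- by move=> x _; rewrite /funrpos le_max lexx orbT.
- by move=> x _; rewrite /funrneg le_max lexx orbT.
Qed.

Lemma asum_ge0D D f g : abs_summable D f -> abs_summable D g ->
  (forall x, D x -> 0 <= f x) -> (forall x, D x -> 0 <= g x) ->
  asum D (fun x => f x + g x) = asum D f + asum D g.
Proof.
move=> sf sg f0 g0.
have fg0 x : D x -> 0 <= f x + g x by move=> Dx; rewrite addr_ge0 ?f0 ?g0.
rewrite (asum_ge0E f0) (asum_ge0E g0) (asum_ge0E fg0) -fineD ?esum_fin// -esumD//.
Qed.

Lemma asumD D f g : abs_summable D f -> abs_summable D g ->
  asum D (fun x => f x + g x) = asum D f + asum D g.
Proof.
move=> sf sg; have [sfp sfn] := (abs_summable_pos sf, abs_summable_neg sf).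
have [sgp sgn] := (abs_summable_pos sg, abs_summable_neg sg).
have p0 (h : X -> R) x : D x -> 0 <= h^\+ x by rewrite /funrpos le_max lexx orbT.
have n0 (h : X -> R) x : D x -> 0 <= h^\- x by rewrite /funrneg le_max lexx orbT.
rewrite (@eq_asum _ _ (fun x => (f^\+ x + g^\+ x) - (f^\- x + g^\- x))); last first.
  by move=> x _; rewrite [in LHS](funrposneg f) [in LHS](funrposneg g) opprD addrACA.
rewrite asum_diff.
- rewrite (asum_ge0D sfp sgp (p0 f) (p0 g)) (asum_ge0D sfn sgn (n0 f) (n0 g)).
  by rewrite opprD addrACA -(asum_posneg sf) -(asum_posneg sg).
- exact: abs_summableD.
- exact: abs_summableD.
- by move=> x Dx; rewrite addr_ge0// p0.
- by move=> x Dx; rewrite addr_ge0// n0.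
Qed.

(** At a family that is not summable both sides vanish, because [fine] sends the
    infinite values to 0; the same happens in [asumZ]. *)
Lemma asumN D f : asum D (fun x => - f x) = - asum D f.
Proof.
have fineN (u v : \bar R) : (0 <= u)%E -> (0 <= v)%E ->
    fine (v - u)%E = - fine (u - v)%E.
  by case: u v => [u| |] [v| |]//= _ _; rewrite ?oppr0// opprB.
rewrite /asum -fineN; last 2 first.
- by apply: esum_ge0 => x _; rewrite lee_fin funrpos_ge0.
- by apply: esum_ge0 => x _; rewrite lee_fin funrneg_ge0.
congr (fine (_ - _)%E); apply: eq_esum => x _.
by rewrite /funrneg /funrpos opprK.
Qed.

Lemma abs_summableN D f : abs_summable D f -> abs_summable D (fun x => - f x).
Proof. by move=> sf; apply: le_lt_trans sf; apply: le_esum => x _ /=; rewrite normrN. Qed.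

Lemma asumZ D (c : R) f : asum D (fun x => c * f x) = c * asum D f.
Proof.
wlog c0 : c / 0 <= c => [hw|].
  have [c0|c0] := leP 0 c; first exact: hw.
  rewrite -[c in RHS]opprK mulNr -hw ?oppr_ge0 ?ltW// -asumN.
  by apply: eq_asum => x _; rewrite mulNr opprK.
have fineM' (u v : \bar R) : (0 <= u)%E -> (0 <= v)%E ->
    fine (c%:E * u - c%:E * v)%E = c * fine (u - v)%E.
  move: c0; rewrite le_eqVlt => /predU1P[<-|c0].
    by rewrite !mul0e subee// mul0r.
  case: u v => [u| |] [v| |]//= _ _; rewrite -?EFinM ?gt0_muley ?lte_fin//= ?mulr0//.
  by rewrite mulrBr.
rewrite /asum -fineM'; last 2 first.
- by apply: esum_ge0 => x _; rewrite lee_fin funrpos_ge0.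
- by apply: esum_ge0 => x _; rewrite lee_fin funrneg_ge0.
rewrite -!esumZ//; last 2 first.
- by move=> x; rewrite lee_fin funrneg_ge0.
- by move=> x; rewrite lee_fin funrpos_ge0.
congr (fine (_ - _)%E); apply: eq_esum => x _; rewrite -EFinM; congr EFin.
  by rewrite /funrpos maxr_pMr// mulr0.
by rewrite /funrneg -mulrN maxr_pMr// mulr0.
Qed.

Lemma asumB D f g : abs_summable D f -> abs_summable D g ->
  asum D (fun x => f x - g x) = asum D f - asum D g.
Proof. by move=> sf sg; rewrite asumD ?asumN//; exact: abs_summableN. Qed.

Lemma asum_ge0 D f : (forall x, D x -> 0 <= f x) -> 0 <= asum D f.
Proof. by move=> f0; rewrite asum_ge0E// fine_ge0//; apply: esum_ge0 => x /f0. Qed.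

Lemma le_asum D f g : abs_summable D f -> abs_summable D g ->
  (forall x, D x -> f x <= g x) -> asum D f <= asum D g.
Proof.
by move=> sf sg fg; rewrite -subr_ge0 -asumB// asum_ge0// => x /fg; rewrite subr_ge0.
Qed.

Lemma ler_norm_asum D f g : abs_summable D g ->
  (forall x, D x -> `|f x| <= g x) -> `|asum D f| <= asum D g.
Proof.
move=> sg fg; have sf := le_abs_summable fg sg.
rewrite ler_norml -asumN//; apply/andP; split; apply: le_asum => //.
- exact: abs_summableN.
- by move=> x /fg; rewrite ler_norml => /andP[].
- by move=> x /fg; rewrite ler_norml => /andP[].
Qed.

Lemma asum_ge_term D f x : D x -> (forall y, D y -> 0 <= f y) -> abs_summable D f ->
  f x <= asum D f.
Proof.
move=> Dx f0 sf; rewrite asum_ge0E// -lee_fin fineK; last exact: esum_fin.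
apply: esum_ge; exists [set x]; last by rewrite fsbig_set1.
by split; [exact: finite_set1|move=> _ ->].
Qed.

Lemma asum0 D : asum D (fun=> 0 : R) = 0.
Proof. by rewrite asum_ge0E// esum1. Qed.

Lemma abs_summable0 D : abs_summable D (fun=> 0).
Proof. by rewrite /abs_summable /summable esum1//= => x _; rewrite normr0. Qed.

Lemma abs_summable_sum (I : eqType) (r : seq I) D (F : I -> X -> R) :
  (forall i, i \in r -> abs_summable D (F i)) ->
  abs_summable D (fun x => \sum_(i <- r) F i x).
Proof.
elim: r => [|i r ih] sF; first by under eq_fun do rewrite big_nil; exact: abs_summable0.
under eq_fun do rewrite big_cons; apply: abs_summableD; first by apply: sF; rewrite mem_head.
by apply: ih => j jr; apply: sF; rewrite in_cons jr orbT.
Qed.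

Lemma asum_sum (I : eqType) (r : seq I) D (F : I -> X -> R) :
  (forall i, i \in r -> abs_summable D (F i)) ->
  asum D (fun x => \sum_(i <- r) F i x) = \sum_(i <- r) asum D (F i).
Proof.
elim: r => [|i r ih] sF; first by under eq_asum do rewrite big_nil; rewrite big_nil asum0.
have sFr j : j \in r -> abs_summable D (F j) by move=> jr; apply: sF; rewrite in_cons jr orbT.
under eq_asum do rewrite big_cons; rewrite big_cons asumD ?ih//.
  by apply: sF; rewrite mem_head.
exact: abs_summable_sum.
Qed.

End AbsoluteSums.

Section SumsOverNat.
Context {R : realType}.
Implicit Types (D : set nat) (f g : nat -> R).

Lemma asum_setT D f : asum D f = asum setT (fun j => f j * (j \in D)%:R).
Proof.
rewrite /asum; congr (fine (_ - _)%E); rewrite [LHS]esum_mkcond; apply: eq_esum => j _.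
  by rewrite /funrpos; case: ifP => _; rewrite ?mulr1// mulr0 maxxx.
by rewrite /funrneg; case: ifP => _; rewrite ?mulr1// mulr0 oppr0 maxxx.
Qed.

Lemma abs_summable_setT D f : abs_summable D f ->
  abs_summable setT (fun j => f j * (j \in D)%:R).
Proof.
rewrite /abs_summable /summable esum_mkcond => sf; apply: le_lt_trans sf.
apply: le_esum => j _ /=.
by case: ifP => _; rewrite ?mulr1// mulr0 normr0.
Qed.

Lemma asum_integral_counting f : abs_summable setT f ->
  (asum setT f)%:E = (\int[counting]_j (f j)%:E)%E.
Proof.
move=> sf; rewrite (integral_count sf).
have pT : (fun j : nat => is_true (predT j)) = [set: nat] by apply/seteqP.
have sfT : summable (fun j => predT j) (EFin \o f) by rewrite pT.
rewrite (summable_eseries_esum sfT) pT.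
rewrite funerpos funerneg /asum fineK// fin_numB; apply/andP; split; apply: esum_fin.
- by move=> x _; exact: funrpos_ge0.
- exact: abs_summable_pos.
- by move=> x _; exact: funrneg_ge0.
- exact: abs_summable_neg.
Qed.

Lemma summable_integrable_counting f : abs_summable setT f ->
  counting.-integrable setT (EFin \o f).
Proof.
move=> sf; apply/integrableP; split => //.
by rewrite ge0_integral_count// nneseries_esumT.
Qed.

(** Dominated convergence for the counting measure on [nat]; the factor
    [(j \in D)%:R] replaces the restriction to [D]. *)
Lemma asum_dominated_cvg D (f : nat -> nat -> R) (h g : nat -> R) :
  (forall j, D j -> f n j @[n --> \oo] --> h j) ->
  (forall n j, D j -> `|f n j| <= g j) -> abs_summable D g ->
  asum D (f n) @[n --> \oo] --> asum D h.
Proof.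
move=> fh fg sg.
have hg j : D j -> `|h j| <= g j.
  move=> Dj; apply: (ler_cvg_to (cvg_norm (fh j Dj)) (cvg_cst (g j))).
  by apply: nearW => n; exact: fg.
have sD (k : nat -> R) : (forall j, D j -> `|k j| <= g j) ->
    abs_summable setT (fun j => k j * (j \in D)%:R).
  by move=> kg; apply: abs_summable_setT; exact: le_abs_summable sg.
have asumE (k : nat -> R) : (forall j, D j -> `|k j| <= g j) ->
    (asum D k)%:E = (\int[counting]_j (k j * (j \in D)%:R)%:E)%E.
  by move=> kg; rewrite asum_setT asum_integral_counting//; exact: sD.
rewrite (_ : (fun n => asum D (f n)) =
    fine \o (fun n => \int[counting]_j (f n j * (j \in D)%:R)%:E)%E); last first.
  by apply/funext => n /=; rewrite -asumE//; exact: fg.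
apply: fine_cvg; rewrite asumE//.
have sgT := summable_integrable_counting (abs_summable_setT sg).
apply: (dominated_cvg _ _ _ _ sgT) => //= [j _|n j _].
  apply: cvg_EFin; first exact: nearW.
  have [jD|jD] := boolP (j \in D).
    by rewrite mulr1; under eq_fun do rewrite mulr1; apply: fh; rewrite -in_setE.
  by rewrite mulr0; under eq_fun do rewrite mulr0; exact: cvg_cst.
rewrite lee_fin; have [jD|jD] := boolP (j \in D); last by rewrite !mulr0 normr0.
by rewrite !mulr1 fg// -in_setE.
Qed.

End SumsOverNat.

Section IntegralOfSums.
Context d (T : measurableType d) (R : realType) (mu : {measure set T -> \bar R}).
Variables (E : set T) (D : set nat) (f : nat -> T -> R).
Hypotheses (mE : measurable E) (mf : forall j, D j -> measurable_fun E (f j)).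

Lemma measurable_esum (u : nat -> T -> R) :
  (forall j, D j -> measurable_fun E (u j)) -> (forall j x, 0 <= u j x) ->
  measurable_fun E (fun x => \esum_(j in D) (u j x)%:E : \bar R)%E.
Proof.
move=> mu0 u0.
under eq_fun => x.
  rewrite esum_mkcond -nneseries_esumT; last first.
    by move=> j; case: ifP => // _; rewrite lee_fin.
  over.
apply: (@ge0_emeasurable_sum _ _ _ _ _ predT) => [j x _ _|j _].
  by case: ifP => // _; rewrite lee_fin.
case: (boolP (j \in D)) => [|_]; last exact: measurable_cst.
by rewrite in_setE => Dj; apply/measurable_EFinP; exact: mu0.
Qed.

Lemma integral_esum (u : nat -> T -> R) :
  (forall j, D j -> measurable_fun E (u j)) -> (forall j x, 0 <= u j x) ->
  ((\int[mu]_(x in E) \esum_(j in D) (u j x)%:E)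
    = \esum_(j in D) \int[mu]_(x in E) (u j x)%:E)%E.
Proof.
move=> mu0 u0.
transitivity (\int[mu]_(x in E)
    \sum_(0 <= j <oo) (if j \in D then (u j x)%:E else 0))%E.
  apply: eq_integral => x _; rewrite esum_mkcond nneseries_esumT// => j.
  by case: ifP => // _; rewrite lee_fin.
rewrite integral_nneseries//; last 2 first.
- move=> j; case: (boolP (j \in D)) => [|_]; last exact: measurable_cst.
  by rewrite in_setE => Dj; apply/measurable_EFinP; exact: mu0.
- by move=> j x _; case: ifP => // _; rewrite lee_fin.
rewrite [RHS]esum_mkcond nneseries_esumT; last first.
  by move=> j; apply: integral_ge0 => x _; case: ifP => // _; rewrite lee_fin.
by apply: eq_esum => j _; case: (boolP (j \in D)) => // _; rewrite integral0.
Qed.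

Lemma measurable_asum : measurable_fun E (fun x => asum D (f^~ x)).
Proof.
apply: measurableT_comp => //; apply: emeasurable_funB.
  apply: measurable_esum => [j Dj|j x]; last exact: funrpos_ge0.
  exact: measurable_funrpos (mf Dj).
apply: measurable_esum => [j Dj|j x]; last exact: funrneg_ge0.
exact: measurable_funrneg (mf Dj).
Qed.

Hypothesis sf : (\esum_(j in D) \int[mu]_(x in E) `|(f j x)%:E| < +oo)%E.

Let P x : \bar R := (\esum_(j in D) ((f j)^\+ x)%:E)%E.
Let N x : \bar R := (\esum_(j in D) ((f j)^\- x)%:E)%E.

Let mP : measurable_fun E P.
Proof.
apply: measurable_esum => [j Dj|j x]; last exact: funrpos_ge0.
exact: measurable_funrpos (mf Dj).
Qed.

Let mN : measurable_fun E N.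
Proof.
apply: measurable_esum => [j Dj|j x]; last exact: funrneg_ge0.
exact: measurable_funrneg (mf Dj).
Qed.

Let intP : ((\int[mu]_(x in E) P x)
  = \esum_(j in D) \int[mu]_(x in E) ((f j)^\+ x)%:E)%E.
Proof.
apply: (@integral_esum (fun j => (f j)^\+)) => [j Dj|j x]; last exact: funrpos_ge0.
exact: measurable_funrpos (mf Dj).
Qed.

Let intN : ((\int[mu]_(x in E) N x)
  = \esum_(j in D) \int[mu]_(x in E) ((f j)^\- x)%:E)%E.
Proof.
apply: (@integral_esum (fun j => (f j)^\-)) => [j Dj|j x]; last exact: funrneg_ge0.
exact: measurable_funrneg (mf Dj).
Qed.

Let iP : mu.-integrable E P.
Proof.
apply/integrableP; split => //.
rewrite (eq_integral P); last first.
  by move=> x _; rewrite gee0_abs//; apply: esum_ge0 => j _; rewrite lee_fin funrpos_ge0.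
rewrite intP; apply: le_lt_trans sf; apply: le_esum => j Dj.
apply: ge0_le_integral => //.
- by move=> x _; rewrite lee_fin funrpos_ge0.
- by apply/measurable_EFinP; exact: measurable_funrpos (mf Dj).
- by apply: measurableT_comp => //; apply/measurable_EFinP; exact: mf.
- move=> x _ /=; rewrite lee_fin /funrpos ge_max normr_ge0 ler_norm//.
Qed.

Let iN : mu.-integrable E N.
Proof.
apply/integrableP; split => //.
rewrite (eq_integral N); last first.
  by move=> x _; rewrite gee0_abs//; apply: esum_ge0 => j _; rewrite lee_fin funrneg_ge0.
rewrite intN; apply: le_lt_trans sf; apply: le_esum => j Dj.
apply: ge0_le_integral => //.
- by move=> x _; rewrite lee_fin funrneg_ge0.
- by apply/measurable_EFinP; exact: measurable_funrneg (mf Dj).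
- by apply: measurableT_comp => //; apply/measurable_EFinP; exact: mf.
- by move=> x _ /=; rewrite lee_fin /funrneg ge_max normr_ge0 andbT -normrN ler_norm.
Qed.

Let asum_ae : ae_eq mu E (EFin \o (fun x => asum D (f^~ x))) (P \- N)%E.
Proof.
have [hP hN] := (integrable_ae mE iP, integrable_ae mE iN).
apply: filterS2 hP hN => x hP hN Ex.
by rewrite /= /asum fineK// fin_numB hP// hN.
Qed.

(** The sums of the positive and of the negative parts are integrable by
    Tonelli, hence finite almost everywhere, and where both are finite [asum] is
    their difference. *)
Lemma integrable_asum : mu.-integrable E (EFin \o (fun x => asum D (f^~ x))).
Proof.
have iPN := integrableB mE iP iN.
apply/integrableP; split; first by apply/measurable_EFinP; exact: measurable_asum.
rewrite (@ae_eq_integral _ _ _ mu E (abse \o (P \- N)%E))//.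
- by move/integrableP : iPN => [].
- by apply: measurableT_comp => //; apply/measurable_EFinP; exact: measurable_asum.
- by apply: measurableT_comp => //; exact: emeasurable_funB.
- by apply: filterS asum_ae => x h Ex; congr (abse _); exact: h.
Qed.

Lemma Rintegral_asum : \int[mu]_(x in E) asum D (f^~ x) =
  asum D (fun j => \int[mu]_(x in E) f j x).
Proof.
have fj j : D j -> mu.-integrable E (EFin \o f j).
  move=> Dj; apply/integrableP; split; first by apply/measurable_EFinP; exact: mf.
  have i0 i : (0 <= \int[mu]_(x in E) `|(f i x)%:E|)%E by exact: integral_ge0.
  apply: le_lt_trans sf; rewrite (esumID [set j])//.
  by rewrite setI1 mem_set// esum_set1//; apply: leeDl; exact: esum_ge0.
have fjp j : D j -> mu.-integrable E (EFin \o (f j)^\+).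
  by move=> Dj; apply: integrable_funrpos => //; exact: fj.
have fjn j : D j -> mu.-integrable E (EFin \o (f j)^\-).
  by move=> Dj; apply: integrable_funrneg => //; exact: fj.
have p0 j : 0 <= \int[mu]_(x in E) (f j)^\+ x.
  by apply: Rintegral_ge0 => x _; exact: funrpos_ge0.
have n0 j : 0 <= \int[mu]_(x in E) (f j)^\- x.
  by apply: Rintegral_ge0 => x _; exact: funrneg_ge0.
have Pf : (\int[mu]_(x in E) P x)%E \is a fin_num by exact: integrable_fin_num.
have Nf : (\int[mu]_(x in E) N x)%E \is a fin_num by exact: integrable_fin_num.
have eP : ((\int[mu]_(x in E) P x) = \esum_(j in D) (\int[mu]_(x in E) (f j)^\+ x)%:E)%E.
  rewrite intP; apply: eq_esum => j Dj; rewrite fineK//.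
  by apply: integrable_fin_num => //; exact: fjp.
have eN : ((\int[mu]_(x in E) N x) = \esum_(j in D) (\int[mu]_(x in E) (f j)^\- x)%:E)%E.
  rewrite intN; apply: eq_esum => j Dj; rewrite fineK//.
  by apply: integrable_fin_num => //; exact: fjn.
rewrite (@eq_asum _ _ _ _ (fun j =>
    \int[mu]_(x in E) (f j)^\+ x - \int[mu]_(x in E) (f j)^\- x)); last first.
  move=> j Dj; rewrite -RintegralB//; [|exact: fjp|exact: fjn].
  by apply: eq_Rintegral => x _; rewrite -[in LHS](funrposBneg (f j)).
rewrite asum_diff//; last 2 first.
- rewrite /abs_summable /summable (@eq_esum _ _ _ _ (fun j => (\int[mu]_(x in E) (f j)^\+ x)%:E))%E.
    by rewrite -eP; move: Pf; rewrite fin_numElt => /andP[].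
  by move=> j _ /=; rewrite ger0_norm.
- rewrite /abs_summable /summable (@eq_esum _ _ _ _ (fun j => (\int[mu]_(x in E) (f j)^\- x)%:E))%E.
    by rewrite -eN; move: Nf; rewrite fin_numElt => /andP[].
  by move=> j _ /=; rewrite ger0_norm.
rewrite !asum_ge0E// -eP -eN -fineB// -integralB// /Rintegral.
congr fine; apply: ae_eq_integral => //.
- by apply/measurable_EFinP; exact: measurable_asum.
- exact: emeasurable_funB.
Qed.

End IntegralOfSums.

Section SumsOverProducts.
Context {R : realType}.

Lemma asum_reindex (X Y : choiceType) (P : set X) (Q : set Y) (e : X -> Y) (f : Y -> R) :
  set_bij P Q e -> asum Q f = asum P (f \o e).
Proof.
move=> be; rewrite /asum; congr (fine (_ - _)%E); exact: reindex_esum.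
Qed.

(** Tonelli applied to the positive and to the negative parts, whose double sums
    are finite. *)
Lemma asum_prod (X Y : choiceType) (P : set X) (Q : set Y) (f : X -> Y -> R) :
  abs_summable (P `*` Q) (fun a => f a.1 a.2) ->
  asum (P `*` Q) (fun a => f a.1 a.2) = asum P (fun x => asum Q (f x)).
Proof.
have prodE (u : X -> Y -> R) : (forall x y, 0 <= u x y) ->
    (\esum_(a in P `*` Q) (u a.1 a.2)%:E
      = \esum_(x in P) \esum_(y in Q) (u x y)%:E)%E.
  move=> u0; rewrite (@esum_esum _ _ _ _ (fun=> Q) (fun x y => (u x y)%:E))//.
  by move=> x y _ _; rewrite lee_fin.
have inner (u : X -> Y -> R) : (forall x y, 0 <= u x y) ->
    abs_summable (P `*` Q) (fun a => u a.1 a.2) -> forall x, P x ->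
    ((\esum_(y in Q) (u x y)%:E)%E \is a fin_num) * abs_summable Q (u x).
  move=> u0 su x Px.
  have e : (\esum_(y in Q) (u x y)%:E < +oo)%E.
    have : (\esum_(a in P `*` Q) (u a.1 a.2)%:E < +oo)%E.
      by apply: le_lt_trans su; apply: le_esum => a _; rewrite lee_fin ler_norm.
    have esg0 z : (0 <= \esum_(y in Q) (u z y)%:E)%E.
      by apply: esum_ge0 => y _; rewrite lee_fin.
    rewrite prodE// (esumID [set x])// setI1 mem_set// esum_set1//.
    by apply: le_lt_trans; apply: leeDl; exact: esum_ge0.
  split; last first.
    by apply: le_lt_trans e; apply: le_esum => y _ /=; rewrite lee_fin ger0_norm.
  by rewrite ge0_fin_numE// esum_ge0// => y _; rewrite lee_fin.
have fineE (u : X -> Y -> R) : (forall x y, 0 <= u x y) ->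
    abs_summable (P `*` Q) (fun a => u a.1 a.2) ->
    (\esum_(a in P `*` Q) (u a.1 a.2)%:E = \esum_(x in P) (asum Q (u x))%:E)%E.
  move=> u0 su; rewrite prodE//; apply: eq_esum => x Px.
  by rewrite asum_ge0E// fineK// (inner _ u0 su _ Px).
move=> sf; have sP := abs_summable_pos sf; have sN := abs_summable_neg sf.
pose fp x y := (f x)^\+ y; pose fn x y := (f x)^\- y.
have fp0 x y : 0 <= fp x y by exact: funrpos_ge0.
have fn0 x y : 0 <= fn x y by exact: funrneg_ge0.
have sQ (u : X -> Y -> R) : (forall x y, 0 <= u x y) ->
    abs_summable (P `*` Q) (fun a => u a.1 a.2) ->
    abs_summable P (fun x => asum Q (u x)).
  move=> u0 su; rewrite /abs_summable /summable.
  rewrite (@eq_esum _ _ _ _ (fun x => (asum Q (u x))%:E)); last first.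
    by move=> x _ /=; rewrite ger0_norm// asum_ge0.
  rewrite -fineE//; apply: le_lt_trans su.
  by apply: le_esum => a _; rewrite lee_fin ler_norm.
rewrite [LHS](asum_posneg sf) [RHS](@eq_asum _ _ _ _
  (fun x => asum Q (fp x) - asum Q (fn x))); last first.
  move=> x Px; rewrite -asum_diff//.
  - by apply: eq_asum => y _; rewrite -[in LHS](funrposBneg (f x)).
  - exact: (inner fp fp0 sP _ Px).2.
  - exact: (inner fn fn0 sN _ Px).2.
rewrite asum_diff; last 4 first.
- exact: sQ fp0 sP.
- exact: sQ fn0 sN.
- by move=> x _; exact: asum_ge0.
- by move=> x _; exact: asum_ge0.
congr (_ - _).
  rewrite !asum_ge0E//; first exact: congr1 _ (fineE fp fp0 sP).
  by move=> x _; exact: asum_ge0.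
rewrite !asum_ge0E//; first exact: congr1 _ (fineE fn fn0 sN).
by move=> x _; exact: asum_ge0.
Qed.

Lemma abs_summable_prod (X Y : choiceType) (P : set X) (Q : set Y) (f : X -> Y -> R)
    (b : X -> R) : (forall x, P x -> \esum_(y in Q) `|f x y|%:E <= (b x)%:E)%E ->
  (\esum_(a in P `*` Q) `|f a.1 a.2|%:E <= \esum_(x in P) (b x)%:E)%E.
Proof.
move=> fb; rewrite -(@esum_esum _ _ _ _ (fun=> Q) (fun x y => `|f x y|%:E)%E)//.
by apply: le_esum => x /fb.
Qed.

Lemma nneseries_EFin (u : nat -> R) (l : R) :
  \sum_(0 <= j < n) u j @[n --> \oo] --> l -> (\sum_(0 <= j <oo) (u j)%:E = l%:E)%E.
Proof.
move=> ul; apply/cvg_lim => //.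
rewrite (_ : (fun n => _) = (fun n => (\sum_(0 <= j < n) u j)%:E)).
  by apply: cvg_EFin => //; exact: nearW.
by apply/funext => n; rewrite sumEFin.
Qed.

Lemma asum_cvg (f : nat -> R) : abs_summable setT f ->
  \sum_(0 <= j < n) f j @[n --> \oo] --> asum setT f.
Proof.
have pos (u : nat -> R) : (forall j, 0 <= u j) -> abs_summable setT u ->
    \sum_(0 <= j < n) u j @[n --> \oo] --> asum setT u.
  move=> u0 su; rewrite (_ : (fun n => _) =
      fine \o (fun n => \sum_(0 <= j < n) (u j)%:E)%E); last first.
    by apply/funext => n /=; rewrite sumEFin.
  apply: fine_cvg; rewrite asum_ge0E// fineK; last exact: esum_fin.
  rewrite -nneseries_esumT; last by move=> n; rewrite lee_fin.
  by apply: is_cvg_nneseries => n _ _; rewrite lee_fin.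
move=> sf; rewrite asum_posneg//.
rewrite (_ : (fun n => _) = (fun n => \sum_(0 <= j < n) f^\+ j - \sum_(0 <= j < n) f^\- j)).
  apply: cvgB; apply: pos.
  - by move=> j; exact: funrpos_ge0.
  - exact: abs_summable_pos.
  - by move=> j; exact: funrneg_ge0.
  - exact: abs_summable_neg.
by apply/funext => n; rewrite -sumrB; apply: eq_bigr => j _; rewrite -[in LHS](funrposBneg f).
Qed.

Lemma cvg_geometric_sum (r B : R) : 0 <= r < 1 ->
  \sum_(0 <= t < n) (r ^+ t * B) @[n --> \oo] --> B / (1 - r).
Proof.
move=> /andP[r0 r1]; have := @cvg_geometric_series R B r.
rewrite ger0_norm// => /(_ r1); rewrite (_ : series _ = fun n => \sum_(0 <= t < n) (r ^+ t * B))//.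
by apply/funext => n; rewrite /series /=; apply: eq_bigr => i _; rewrite mulrC.
Qed.

Lemma summable_geometric (r B : R) : 0 <= r < 1 ->
  abs_summable setT (fun t => r ^+ t * B).
Proof.
move=> r01; rewrite /abs_summable /summable.
rewrite (@eq_esum _ _ _ _ (fun t => (r ^+ t * `|B|)%:E)); last first.
  by move=> t _ /=; rewrite normrM ger0_norm// exprn_ge0//; case/andP: r01.
rewrite -nneseries_esumT; last first.
  by move=> n; rewrite lee_fin mulr_ge0// exprn_ge0//; case/andP: r01.
by rewrite (nneseries_EFin (@cvg_geometric_sum r `|B| r01)) ltry.
Qed.

Lemma asum_geometric (r B : R) : 0 <= r < 1 ->
  asum setT (fun t => r ^+ t * B) = B / (1 - r).
Proof.
move=> r01; have h := asum_cvg (summable_geometric B r01).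
exact: cvg_unique h (@cvg_geometric_sum r B r01).
Qed.

End SumsOverProducts.

(** * Affine change of variables and primitives *)

Section AffineChangeOfVariables.
Context {R : realType}.
Variables (c e : R).
Hypothesis c0 : c != 0.
Local Notation leb := (@lebesgue_measure R).
Let phi (x : measurableTypeR R) : measurableTypeR R := c * x + e.

Lemma measurable_affine : measurable_fun [set: measurableTypeR R] phi.
Proof. by apply: measurable_funD => //; apply: measurable_funM. Qed.

Let image : {measure set (measurableTypeR R) -> \bar R} :=
  measure_function_pushforward__canonical__measure_function_Measure leb measurable_affine.

Let nu : {measure set (measurableTypeR R) -> \bar R} := mscale (NngNum (normr_ge0 c)) image.

(** Lebesgue measure is determined by its values on half-open intervals. For
    [c < 0] the preimage of such an interval is closed at the other end, which
    does not change its length. *)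
Lemma lebesgue_measure_affine (A : set (measurableTypeR R)) : measurable A ->
  leb A = (`|c|%:E * leb [set x | A ((c * x + e)%R)])%E.
Proof.
move=> mA; apply: (@lebesgue_measure_unique R nu) mA => _ [[a b] _ <-] /=.
rewrite /nu /mscale/= /pushforward/= lebesgue_measure_itv/= lte_fin.
have [cp|cn] : 0 < c \/ c < 0 by case: (ltgtP c 0) c0; auto.
  have -> : phi @^-1` `]a, b]%classic = `](a - e) / c, (b - e) / c]%classic.
    apply/seteqP; split => x; rewrite /= !in_itv/= /phi ltr_pdivrMr// ler_pdivlMr//;
    by rewrite ltrBlDr lerBrDr mulrC.
  rewrite lebesgue_measure_itv/= lte_fin ltr_pM2r ?invr_gt0// ltrD2r gtr0_norm//.
  case: ifP => _; last by rewrite mule0.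
  by rewrite -!EFinB -EFinM; congr EFin; field; rewrite gt_eqF.
have -> : phi @^-1` `]a, b]%classic = `[(b - e) / c, (a - e) / c[%classic.
  apply/seteqP; split => x; rewrite /= !in_itv/= /phi ltr_ndivlMr// ler_ndivrMr//;
  by rewrite ltrBlDr lerBrDr mulrC andbC.
rewrite lebesgue_measure_itv/= lte_fin ltr_nM2r ?invr_lt0// ltrD2r ltr0_norm//.
case: ifP => _; last by rewrite mule0.
by rewrite -!EFinB -EFinM; congr EFin; field; rewrite lt_eqF.
Qed.

Lemma ge0_integral_affine (f : R -> \bar R) : measurable_fun setT f ->
  (forall x, 0 <= f x)%E ->
  (\int[leb]_x f x = `|c|%:E * \int[leb]_x f (c * x + e)%R)%E.
Proof.
move=> mf f0; rewrite (eq_measure_integral nu); last first.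
  by move=> A mA _; exact: lebesgue_measure_affine.
rewrite ge0_integral_mscale//= ge0_integral_pushforward//.
exact: measurable_affine.
Qed.

Lemma integrable_affine (f : R -> R) : leb.-integrable setT (EFin \o f) ->
  leb.-integrable setT (EFin \o (fun x => f (c * x + e))).
Proof.
move=> /integrableP[/measurable_EFinP mf fi]; apply/integrableP; split.
  by apply/measurable_EFinP; apply: measurableT_comp mf measurable_affine.
have := ge0_integral_affine (f := fun x => `|(f x)%:E|%E).
rewrite /= => h; rewrite h in fi => //; last first.
  by apply/measurable_EFinP; apply: measurableT_comp.
rewrite ltNge; apply/negP; rewrite leye_eq => /eqP fi'; move: fi.
by rewrite fi' mulry gtr0_sg ?normr_gt0// mul1e ltxx.
Qed.

Lemma Rintegral_affine (f : R -> R) : leb.-integrable setT (EFin \o f) ->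
  \int[leb]_x f x = `|c| * \int[leb]_x f (c * x + e).
Proof.
have pos (g : R -> R) : (forall x, 0 <= g x) -> leb.-integrable setT (EFin \o g) ->
    \int[leb]_x g x = `|c| * \int[leb]_x g (c * x + e).
  move=> g0 gi; rewrite /Rintegral (ge0_integral_affine (f := fun x => (g x)%:E)).
  - by rewrite fineM//; apply: (integrable_fin_num _ (integrable_affine gi)).
  - by case/integrableP : gi.
  - by move=> x; rewrite lee_fin.
move=> fi.
have fp : leb.-integrable setT (EFin \o f^\+) by apply: integrable_funrpos.
have fn : leb.-integrable setT (EFin \o f^\-) by apply: integrable_funrneg.
have split (g : R -> R) : leb.-integrable setT (EFin \o g) ->
    \int[leb]_x g x = \int[leb]_x g^\+ x - \int[leb]_x g^\- x.
  move=> gi; rewrite -RintegralB//; [|exact: integrable_funrpos|exact: integrable_funrneg].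
  by apply: eq_Rintegral => x _; rewrite -[in LHS](funrposBneg g).
rewrite split// (pos _ _ fp); last by move=> x; exact: funrpos_ge0.
rewrite (pos _ _ fn); last by move=> x; exact: funrneg_ge0.
by rewrite (split _ (integrable_affine fi)) mulrBr.
Qed.

End AffineChangeOfVariables.

Section Primitives.
Context {R : realType}.
Local Notation leb := (@lebesgue_measure R).

Definition bounded_measurable (f : R -> R) :=
  measurable_fun [set: measurableTypeR R] f /\ exists K, forall x, `|f x| <= K.

Lemma Rintegral_indic (A D : set (measurableTypeR R)) (f : R -> R) :
  A `<=` D -> \int[leb]_(x in D) (\1_A x * f x) = \int[leb]_(x in A) f x.
Proof.
move=> AD; rewrite -{2}(setIidr AD) Rintegral_mkcondr.
by apply: eq_Rintegral => x _; rewrite patch_indic /= mulrC.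
Qed.

Lemma bounded_near (A : set (measurableTypeR R)) (f : R -> R) K : (forall x, `|f x| <= K) ->
  [bounded f x | x in A].
Proof.
move=> fK; exists K; split; first exact: num_real.
by move=> M KM x _; rewrite /= (le_trans (fK x))// ltW.
Qed.

Lemma integrable_mul_bounded (A : set (measurableTypeR R)) (h f : R -> R) : measurable A ->
  leb.-integrable A (EFin \o h) -> bounded_measurable f ->
  leb.-integrable A (EFin \o (fun x => h x * f x)).
Proof.
move=> mA hi [mf [K fK]].
have := integrableMl mA hi (measurable_funTS mf) (bounded_near _ fK).
by apply: eq_integrable => // x _; rewrite /= EFinM.
Qed.

Lemma integrable_bounded (A : set (measurableTypeR R)) (f : R -> R) : measurable A -> (leb A < +oo)%E ->
  bounded_measurable f -> leb.-integrable A (EFin \o f).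
Proof.
move=> mA fA [mf [K fK]]; exact: (measurable_bounded_integrable mA fA (measurable_funTS mf) (bounded_near _ fK)).
Qed.

Lemma lebesgue_itv_lty (i : interval R) (a b : R) : [set` i] `<=` `[a, b] ->
  (leb [set` i] < +oo)%E.
Proof.
move=> iab; apply: (@le_lt_trans _ _ (leb `[a, b]%classic)).
  by apply: le_measure => //; rewrite inE.
by rewrite lebesgue_measure_itv/=; case: ifP; rewrite ?ltry.
Qed.

(** Written as a pairing over the whole of [0, 1] with an indicator, so that
    identities for integrals against bounded functions apply to it directly. *)
Definition primitive (f : R -> R) (y : R) : R :=
  \int[leb]_(x in `[0, 1]) (\1_(`[0, y[) x * f x).

Lemma primitiveE (f : R -> R) y : y <= 1 -> primitive f y = \int[leb]_(x in `[0, y[) f x.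
Proof.
move=> y1; apply: Rintegral_indic => x; rewrite /= !in_itv/= => /andP[-> xy].
by rewrite (le_trans (ltW xy)).
Qed.

Lemma primitiveB (f : R -> R) a b : bounded_measurable f -> 0 <= a <= b -> b <= 1 ->
  primitive f b - primitive f a = \int[leb]_(x in `]a, b[) f x.
Proof.
move=> bf /andP[a0 ab] b1; have a1 := le_trans ab b1.
rewrite !primitiveE//.
have fin (i : interval R) : [set` i] `<=` `[0, 1] -> leb.-integrable [set` i] (EFin \o f).
  by move=> i01; apply: integrable_bounded => //; exact: lebesgue_itv_lty i01.
have E : `[0, b[%classic = `[0, a[%classic `|` `[a, b[%classic :> set R.
  by rewrite -itv_bndbnd_setU// bnd_simp.
rewrite E Rintegral_setU//; last 2 first.
- by rewrite -E; apply: fin => x; rewrite /= !in_itv/= => /andP[-> xb]; rewrite (le_trans (ltW xb)).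
- apply/disj_setPS => x [/=]; rewrite !in_itv/= => /andP[_ xa] /andP[ax _].
  by move: xa; rewrite ltNge ax.
rewrite addrC addKr Rintegral_itv_obnd_cbnd//; apply: fin => x.
rewrite /= !in_itv/= => /andP[ax xb]; rewrite (le_trans a0 (ltW ax))/=.
exact: le_trans (ltW xb) b1.
Qed.

(** For [c < 0] the two end points are exchanged, and the sign of [c^-1]
    compensates for it. *)
Lemma integral_affine (f : R -> R) (c e u v : R) : bounded_measurable f -> c != 0 ->
  u <= v -> 0 <= c * u + e <= 1 -> 0 <= c * v + e <= 1 ->
  \int[leb]_(x in `]u, v[) f (c * x + e) =
  c^-1 * (primitive f (c * v + e) - primitive f (c * u + e)).
Proof.
move=> bf c0 uv /andP[u0 u1] /andP[v0 v1].
have key a b : 0 <= a <= b -> b <= 1 ->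
    (forall x, (a < c * x + e < b) = (u < x < v)) ->
    \int[leb]_(x in `]u, v[) f (c * x + e) = `|c|^-1 * (primitive f b - primitive f a).
  move=> /andP[a0 ab] b1 E; rewrite primitiveB//; last by rewrite a0.
  have Ei x : \1_(`]a, b[) (c * x + e) = \1_(`]u, v[) x :> R.
    rewrite !indicE; congr (nat_of_bool _)%:R; apply/idP/idP => /set_mem /=;
    by rewrite in_itv/= => h; apply/mem_set; rewrite /= in_itv/= ?E// -?E.
  have fi : leb.-integrable setT (EFin \o (fun x => \1_(`]a, b[) x * f x)).
    rewrite (_ : EFin \o _ = (EFin \o f) \_ `]a, b[); last first.
      by apply/funext => x; rewrite /= epatch_indic /= mulrC.
    rewrite -integrable_mkcond//; apply: integrable_bounded => //.
    by apply: (@lebesgue_itv_lty _ a b) => x; rewrite /= !in_itv/= => /andP[/ltW -> /ltW ->].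
  rewrite -(@Rintegral_indic _ setT)// -(@Rintegral_indic `]a, b[ setT)//.
  rewrite (Rintegral_affine e c0 fi) mulrA mulVf ?mul1r ?normr_eq0//.
  by apply: eq_Rintegral => x _; rewrite Ei.
have [cp|cn] : 0 < c \/ c < 0 by case: (ltgtP c 0) c0; auto.
  rewrite (key (c * u + e) (c * v + e)) ?gtr0_norm// ?u0 ?lerD2r ?ler_pM2l//.
  by move=> x; rewrite !ltrD2r !ltr_pM2l.
rewrite (key (c * v + e) (c * u + e)) ?ltr0_norm// ?v0 ?lerD2r ?ler_nM2l//.
  by rewrite invrN mulNr -mulrN opprB.
by move=> x; rewrite !ltrD2r !ltr_nM2l// andbC.
Qed.

End Primitives.

(** * Continuity of integrals with respect to primitives *)

Section SmallPrimitives.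
Context {R : realType}.
Local Notation leb := (@lebesgue_measure R).

Lemma uniform_continuity01 (g : R -> R) (eps : R) : continuous g -> 0 < eps ->
  exists n : nat, forall x y, 0 <= x <= 1 -> `|x - y| <= n.+1%:R^-1 -> `|g x - g y| <= eps.
Proof.
move=> cg e0.
pose P (r : R) (x : R) := forall y, `|x - y| <= r -> `|g x - g y| <= eps.
have := @segment_compact R 0 1; move/compact_near_coveringP/(_ R 0^'+ P _).
case=> [x _|r /= r0 h].
  have /cvgrPdist_le /(_ (eps / 2)) := cg x; rewrite divr_gt0// => /(_ isT).
  move=> [r /= r0 hr].
  exists (ball x (r / 2), [set t | t < r / 2]) => /=.
    by split; [apply: nbhsx_ballx|apply: nbhs_right_lt]; rewrite divr_gt0.
  move=> [x' t] /= [xx' tr] y x'y.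
  have hx' : `|g x - g x'| <= eps / 2.
    by apply: hr; rewrite /ball/= (lt_le_trans xx')// ler_pdivrMr// ler_peMr ?ltW// ltr1n.
  have hy : `|g x - g y| <= eps / 2.
    apply: hr => /=; have -> : x - y = (x - x') + (x' - y) by ring.
    rewrite [ltRHS](splitr r); apply: le_lt_trans (ler_normD _ _) _.
    by apply: ltrD => //; exact: le_lt_trans tr.
  have -> : g x' - g y = (g x - g y) - (g x - g x') by ring.
  by rewrite [leRHS](splitr eps) (le_trans (ler_normB _ _))// lerD.
have [n nr] : exists n : nat, n.+1%:R^-1 < r.
  by have [n _ /(_ n (leqnn _))] := near_infty_natSinv_lt (PosNum r0); exists n.
exists n => x y x01 xy; apply: (h n.+1%:R^-1 _ _ x _ y) => //=.
by rewrite sub0r normrN gtr0_norm ?invr_gt0.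
Qed.

Lemma bounded_measurableM (f g : R -> R) : bounded_measurable f -> bounded_measurable g ->
  bounded_measurable (fun x => f x * g x).
Proof.
move=> [mf [K fK]] [mg [K' gK']]; split; first exact: measurable_funM.
by exists (K * K') => x; rewrite normrM ler_pM.
Qed.

Lemma bounded_measurableD (f g : R -> R) a : bounded_measurable f -> bounded_measurable g ->
  bounded_measurable (fun x => f x + a * g x).
Proof.
move=> [mf [K fK]] [mg [K' gK']]; split.
  by apply: measurable_funD => //; apply: measurable_funM.
exists (K + `|a| * K') => x; rewrite (le_trans (ler_normD _ _))// normrM.
by rewrite lerD// ler_wpM2l.
Qed.

Lemma bounded_measurable_cst (c : R) : bounded_measurable (fun=> c).
Proof. by split; [exact: measurable_cst|exists `|c|]. Qed.

Lemma bounded_measurable_indic (A : set (measurableTypeR R)) : measurable A ->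
  bounded_measurable \1_A.
Proof.
split; first exact: measurable_indic.
by exists 1 => x; rewrite indicE; case: (_ \in _); rewrite ?normr1 ?normr0.
Qed.

Lemma measurable_bounded_continuous (g : R -> R) : continuous g ->
  bounded_measurable (fun x => \1_(`[0, 1]) x * g x).
Proof.
move=> cg; split.
  apply: measurable_funM; first exact: measurable_indic.
  exact: continuous_measurable_fun.
have [|c _ cM] := @EVT_max R (fun x => `|g x|) 0 1 ler01.
  by apply: continuous_subspaceT => x; apply: cvg_norm; exact: cg.
exists `|g c| => x; rewrite indicE; case: (boolP (x \in _)) => [/set_mem/= x01|_].
  by rewrite mul1r; exact: cM.
by rewrite mul0r normr0.
Qed.

Lemma normr_Rintegral_le (f : R -> R) (C u v : R) : bounded_measurable f ->
  u <= v -> (forall x, u < x < v -> `|f x| <= C) -> `|\int[leb]_(x in `]u, v[) f x| <= C * (v - u).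
Proof.
move=> bf uv fC.
have muv : measurable (`]u, v[%classic : set (measurableTypeR R)) by [].
have uvl : (leb `]u, v[%classic < +oo)%E.
  by apply: (@lebesgue_itv_lty _ _ u v) => x; rewrite /= !in_itv/= => /andP[/ltW -> /ltW ->].
have fi := integrable_bounded muv uvl bf.
apply: le_trans (le_normr_Rintegral muv fi) _.
have -> : C * (v - u) = \int[leb]_(_ in `]u, v[) C.
  rewrite (Rintegral_cst _ muv)/= lebesgue_measure_itv/= lte_fin; case: ltP => //.
  by move=> vu; rewrite (le_anti (_ : u <= v <= u)) ?uv// subrr.
apply: le_Rintegral => //.
- exact: integrable_norm.
- by apply: integrable_bounded => //; exact: bounded_measurable_cst.
Qed.

(** On each of [n + 1] intervals of equal length, [g] is close to its value at the
    left end point. The main term is that value times a difference of two values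
    of the primitive, which is small once [n] has been fixed. *)
Lemma continuous_small_primitive (g : R -> R) (K eta : R) : continuous g -> 0 <= K -> 0 < eta ->
  exists2 delta, 0 < delta & forall f, bounded_measurable f -> (forall x, `|f x| <= K) ->
    (forall y, 0 <= y <= 1 -> `|primitive f y| <= delta) ->
    `|\int[leb]_(x in `[0, 1]) (g x * f x)| <= eta.
Proof.
move=> cg K0 e0; have bG := measurable_bounded_continuous cg.
pose G x := \1_(`[0, 1]) x * g x.
have [M GM] : exists M, forall x, `|G x| <= M by case: bG.
have M0 : 0 <= M by exact: le_trans (GM 0).
have K1 : 0 < K + 1 by rewrite ltr_wpDl.
pose eps := eta / 2 / (K + 1).
have eps0 : 0 < eps by rewrite !divr_gt0.
have [n gn] := uniform_continuity01 cg eps0.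
have n0 : 0 < n.+1%:R :> R by [].
have Mn : 0 < n.+1%:R * M + 1 by rewrite ltr_wpDl// mulr_ge0.
(* Each of the [n + 1] main terms is at most [2 * delta * M]; the summand 1 keeps
   the denominator positive. *)
exists (eta / 4 / (n.+1%:R * M + 1)); first by rewrite !divr_gt0.
set delta := eta / 4 / _ => f bf fK fd.
have delta0 : 0 <= delta by apply: le_trans (fd 0 _); rewrite ?lexx ?ler01.
pose w x := G x * f x; have bw : bounded_measurable w by exact: bounded_measurableM.
pose pt m : R := m%:R / n.+1%:R.
have pt01 m : (m <= n.+1)%N -> 0 <= pt m <= 1.
  by move=> mn; rewrite divr_ge0//= ler_pdivrMr// mul1r ler_nat.
have ptS m : pt m.+1 - pt m = n.+1%:R^-1.
  by rewrite /pt -mulrBl -natrB// subSnn mul1r.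
have piece m : (m <= n)%N -> `|\int[leb]_(x in `]pt m, pt m.+1[) w x| <=
    M * (delta + delta) + eps * K * n.+1%:R^-1.
  move=> mn; have lt01 := pt01 _ (leqW mn); have rt01 := pt01 _ (mn : m < n.+1)%N.
  have lert : pt m <= pt m.+1 by rewrite -subr_ge0 ptS invr_ge0.
  have mm : measurable (`]pt m, pt m.+1[%classic : set (measurableTypeR R)) by [].
  have fm : (leb `]pt m, pt m.+1[%classic < +oo)%E.
    by apply: (@lebesgue_itv_lty _ _ (pt m) (pt m.+1)) => x; rewrite /= !in_itv/= => /andP[/ltW -> /ltW ->].
  pose r x := (w x + - G (pt m) * f x).
  have br : bounded_measurable r by exact: bounded_measurableD.
  have -> : \int[leb]_(x in `]pt m, pt m.+1[) w x =
      G (pt m) * \int[leb]_(x in `]pt m, pt m.+1[) f x +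
      \int[leb]_(x in `]pt m, pt m.+1[) r x.
    rewrite -RintegralZl//; last exact: integrable_bounded.
    rewrite -RintegralD//; last exact: integrable_bounded.
      by apply: eq_Rintegral => x _; rewrite /r; ring.
    apply: integrable_bounded => //; apply: bounded_measurableM => //.
    exact: bounded_measurable_cst.
  apply: le_trans (ler_normD _ _) _; apply: lerD.
    rewrite normrM; apply: ler_pM => //.
    rewrite -primitiveB//; last by case/andP: rt01.
      by rewrite (le_trans (ler_normB _ _))// lerD// fd.
    by rewrite lert andbT; case/andP: lt01.
  rewrite -(ptS m); apply: normr_Rintegral_le => // x /andP[mx xm].
  have x01 : 0 <= x <= 1.
    case/andP: lt01 => l0 _; case/andP: rt01 => _ r1.
    by rewrite (le_trans l0 (ltW mx)) (le_trans (ltW xm) r1).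
  have G01 u : 0 <= u <= 1 -> G u = g u.
    by move=> u01; rewrite /G indicE mem_set ?mul1r//= in_itv.
  rewrite /r /w -mulrDl normrM !G01//; apply: ler_pM => //.
  apply: gn => //; rewrite -(ptS m) ger0_norm; last by rewrite subr_ge0 ltW.
  by rewrite lerD2r ltW.
have sum m : (m <= n.+1)%N -> `|primitive w (pt m)| <=
    m%:R * (M * (delta + delta) + eps * K * n.+1%:R^-1).
  elim: m => [_|m ih mn].
    rewrite mul0r /pt mul0r primitiveE ?ler01// set_itv_ge ?Rintegral_set0 ?normr0//.
    by rewrite bnd_simp ltxx.
  have -> : primitive w (pt m.+1) = primitive w (pt m) +
      \int[leb]_(x in `]pt m, pt m.+1[) w x.
    rewrite -primitiveB; first by ring.
    - by [].
    - by rewrite (andP (pt01 _ (ltnW mn))).1 -subr_ge0 ptS invr_ge0/=.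
    - by case/andP: (pt01 _ mn).
  rewrite -natr1 mulrDl mul1r; apply: le_trans (ler_normD _ _) _.
  by apply: lerD; [exact/ih/ltnW|exact: piece].
have -> : \int[leb]_(x in `[0, 1]) (g x * f x) = primitive w (pt n.+1).
  rewrite /pt divff ?gt_eqF// primitiveE// Rintegral_itv_bndo_bndc.
    apply: eq_Rintegral => x /set_mem/= x01; rewrite /w /G indicE mem_set ?mul1r//.
  apply: integrable_bounded => //; apply: (@lebesgue_itv_lty _ _ 0 1) => x.
  by rewrite /= !in_itv/= => /andP[-> /ltW ->].
apply: le_trans (sum _ (leqnn _)) _.
have -> : n.+1%:R * (M * (delta + delta) + eps * K * n.+1%:R^-1) =
    2 * delta * (n.+1%:R * M) + eps * K by field.
rewrite [leRHS](splitr eta); apply: lerD.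
  apply: (@le_trans _ _ (2 * delta * (n.+1%:R * M + 1))).
    by apply: ler_wpM2l; [rewrite mulr_ge0|rewrite lerDl].
  by rewrite /delta -mulrA divfK ?gt_eqF//; lra.
by rewrite /eps mulrAC ler_pdivrMr// ler_pM2l ?divr_gt0// lerDl.
Qed.

(** Continuous functions are dense in L1 and [f] is bounded by [K], which reduces
    the claim to continuous [h]. *)
Lemma integrable_small_primitive (h : R -> R) (K eta : R) :
  leb.-integrable `[0, 1] (EFin \o h) -> 0 <= K -> 0 < eta ->
  exists2 delta, 0 < delta & forall f, bounded_measurable f -> (forall x, `|f x| <= K) ->
    (forall y, 0 <= y <= 1 -> `|primitive f y| <= delta) ->
    `|\int[leb]_(x in `[0, 1]) (h x * f x)| <= eta.
Proof.
move=> hi K0 e0.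
have m01 : measurable (`[0, 1]%classic : set (measurableTypeR R)) by [].
have f01 : (leb `[0%R, 1%R]%classic < +oo)%E by apply: (@lebesgue_itv_lty _ _ 0 1).
have [g_ [cg ig /fine_cvg g0]] := approximation_continuous_integrable m01 f01 hi.
have K1 : 0 < K + 1 by rewrite ltr_wpDl.
have /cvgrPdist_le := g0 => /(_ (eta / 2 / (K + 1))); rewrite !divr_gt0//.
move=> /(_ isT) [n _ /(_ n (leqnn _))] /=.
rewrite sub0r normrN => hn.
have [dl d0 hd] := continuous_small_primitive (cg n) K0 (divr_gt0 e0 (ltr0n R 2) : 0 < eta / 2).
exists dl => // f bf fK fd; have := hd _ bf fK fd => hf.
have i1 := integrable_mul_bounded m01 hi bf.
have i2 := integrable_mul_bounded m01 (ig n) bf.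
have i3 : leb.-integrable `[0, 1] (EFin \o (fun x => h x - g_ n x)).
  by apply: eq_integrable (integrableB _ hi (ig n)).
have -> : \int[leb]_(x in `[0, 1]) (h x * f x) = \int[leb]_(x in `[0, 1]) (g_ n x * f x) +
    \int[leb]_(x in `[0, 1]) ((h x - g_ n x) * f x).
  rewrite -RintegralD//; last exact: integrable_mul_bounded.
  by apply: eq_Rintegral => x _; ring.
rewrite [leRHS](splitr eta); apply: le_trans (ler_normD _ _) _; apply: lerD => //.
apply: le_trans (le_normr_Rintegral m01 _) _; first exact: integrable_mul_bounded.
apply: (@le_trans _ _ (\int[leb]_(x in `[0, 1]) (`|h x - g_ n x| * (K + 1)))).
  apply: le_Rintegral => //.
  - by apply: integrable_norm; exact: integrable_mul_bounded.
  - apply: integrable_mul_bounded; [by []|exact: integrable_norm|exact: bounded_measurable_cst].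
  - by move=> x _; rewrite normrM ler_wpM2l// (le_trans (fK x))// lerDl.
rewrite RintegralZr//; last exact: integrable_norm.
rewrite -ler_pdivlMr//; apply: le_trans hn; exact: ler_norm.
Qed.

End SmallPrimitives.

(** * Integrals of sums of bounded families *)

Section BoundedFamilies.
Context {R : realType}.
Local Notation leb := (@lebesgue_measure R).
Implicit Types (A : set (measurableTypeR R)) (D : set nat).

Lemma Rintegral_sum A n m (f : nat -> R -> R) : measurable A ->
  (forall i, (n <= i < m)%N -> leb.-integrable A (EFin \o f i)) ->
  leb.-integrable A (EFin \o (fun x => \sum_(n <= i < m) f i x)) /\
  \int[leb]_(x in A) (\sum_(n <= i < m) f i x) = \sum_(n <= i < m) \int[leb]_(x in A) f i x.
Proof.
move=> mA fi.
have : forall i, i \in index_iota n m -> leb.-integrable A (EFin \o f i).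
  by move=> i; rewrite mem_index_iota; exact: fi.
elim: (index_iota n m) => [_|i s ih sfi].
  have -> : (fun x => \sum_(i <- [::]) f i x) = cst 0 by apply/funext => x; rewrite big_nil.
  rewrite big_nil Rintegral_cst// mul0r; split => //.
  exact: integrable0.
have fii : leb.-integrable A (EFin \o f i) by apply: sfi; rewrite mem_head.
have [is' eq] := ih (fun j js => sfi j (mem_behead (s := i :: s) js)).
split.
  rewrite (_ : EFin \o _ = (EFin \o f i) \+ (EFin \o (fun x => (\sum_(i <- s) f i x)%R)))%E.
    exact: integrableD.
  by apply/funext => x; rewrite /= big_cons EFinD.
rewrite big_cons -eq -RintegralD//.
by apply: eq_Rintegral => x _; rewrite big_cons.
Qed.

Lemma bounded_measurable_asum D (v : nat -> R -> R) (b : nat -> R) :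
  (forall j, D j -> measurable_fun [set: measurableTypeR R] (v j)) ->
  (forall j x, D j -> `|v j x| <= b j) -> abs_summable D b ->
  bounded_measurable (fun x => asum D (v^~ x)).
Proof.
move=> mv vb sb; split; first exact: measurable_asum.
by exists (asum D b) => x; apply: ler_norm_asum => // j Dj; exact: vb.
Qed.

Lemma Rintegral_mul_asum A D (h : R -> R) (v : nat -> R -> R) (b : nat -> R) :
  measurable A -> leb.-integrable A (EFin \o h) ->
  (forall j, D j -> measurable_fun [set: measurableTypeR R] (v j)) ->
  (forall j x, D j -> `|v j x| <= b j) -> abs_summable D b ->
  \int[leb]_(x in A) (h x * asum D (v^~ x)) =
  asum D (fun j => \int[leb]_(x in A) (h x * v j x)).
Proof.
move=> mA hi mv vb sb.
have mh : measurable_fun A h by case/integrableP : hi => /measurable_EFinP.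
rewrite -(@Rintegral_asum _ _ _ leb A D (fun j x => h x * v j x))//.
- by apply: eq_Rintegral => x _; rewrite asumZ.
- by move=> j Dj; apply: measurable_funM => //; apply: measurable_funTS; exact: mv.
pose c := fine (\int[leb]_(x in A) `|(h x)%:E|)%E.
have ci : (\int[leb]_(x in A) `|(h x)%:E|)%E \is a fin_num.
  rewrite ge0_fin_numE; last exact: integral_ge0.
  by case/integrableP : hi.
have c0 : 0 <= c by rewrite fine_ge0// integral_ge0.
apply: (@le_lt_trans _ _ (\esum_(j in D) (c%:E * `|b j|%:E))%E); last first.
  by rewrite esumZ// lte_mul_pinfty// lee_fin.
have mah : measurable_fun A (fun x => `|(h x)%:E|%E).
  by apply: measurableT_comp => //; apply/measurable_EFinP.
apply: le_esum => j Dj; rewrite fineK// muleC -ge0_integralZl//.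
- apply: ge0_le_integral => //.
  + apply: measurableT_comp => //; apply/measurable_EFinP; apply: measurable_funM => //.
    by apply: measurable_funTS; exact: mv.
  + by apply: emeasurable_funM => //; exact: measurable_cst.
  + move=> x _; rewrite -EFinM lee_fin normrM mulrC ler_wpM2r//.
    by rewrite (le_trans (vb j x Dj))// ler_norm.
Qed.

End BoundedFamilies.

(** * Functionals that factor through a kernel *)

Section CompatibleFunctionals.
Context {F : fieldType} {N : nat} {Y : Type}.

(** [f] factors through a linear form on the span of the values of [v]. The index
    type [Y] has no linear structure, so the condition is stated on finite
    families. *)
Definition compatible (v : Y -> 'cV[F]_N) (f : Y -> F) :=
  forall (n : nat) (ys : 'I_n -> Y) (a : 'I_n -> F),
    \sum_i a i *: v (ys i) = 0 -> \sum_i a i * f (ys i) = 0.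

Lemma compatible_comb (v : Y -> 'cV[F]_N) f n (ys : 'I_n -> Y) (a : 'I_n -> F) y :
  compatible v f -> v y = \sum_i a i *: v (ys i) -> f y = \sum_i a i * f (ys i).
Proof.
move=> vf vy.
pose zs (i : 'I_n.+1) := if unlift ord0 i is Some j then ys j else y.
pose b (i : 'I_n.+1) := if unlift ord0 i is Some j then - a j else 1.
have := vf _ zs b; rewrite !big_ord_recl /zs /b unlift_none scale1r mul1r.
under eq_bigr do rewrite liftK scaleNr.
under [X in _ -> _ + X = 0]eq_bigr do rewrite liftK mulNr.
by rewrite !sumrN -vy subrr => /(_ erefl)/eqP; rewrite subr_eq0 => /eqP.
Qed.

(** Choose finitely many indices [ys] for which the vectors [v (ys i)] span all
    the values of [v]; let [V] and [U] be the matrices with columns [v (ys i)] and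
    [u (ys i)], and let the rows of [K] span the left kernel of [B]. Compatibility
    says that the row of values of [f], and every row of [K *m U], lie in the row
    space of [V]. Injectivity gives [K *m U] the rank of [K], which is the
    dimension of the right kernel of [B] and therefore at least the rank of [V].
    So the two row spaces coincide, and the values of [f] form a combination of
    the rows of [K *m U]. *)
Lemma compatible_left_kernel (B : 'M[F]_N) (u v : Y -> 'cV[F]_N) (f : Y -> F) :
  (forall y, B *m v y = 0) ->
  compatible v f ->
  (forall g : 'rV_N, g *m B = 0 -> compatible v (fun y => (g *m u y) 0 0)) ->
  (forall g : 'rV_N, g *m B = 0 -> (forall y, (g *m u y) 0 0 = 0) -> g = 0) ->
  exists2 g : 'rV_N, g *m B = 0 & forall y, f y = (g *m u y) 0 0.
Proof.
move=> Bv vf vu inj.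
pose mat (w : Y -> 'cV[F]_N) q (ys : 'I_q -> Y) := \matrix_(i < N, j < q) w (ys j) i 0.
have mat_mul w q (ys : 'I_q -> Y) (a : 'cV_q) :
    mat w q ys *m a = \sum_i a i 0 *: w (ys i).
  apply/colP => i; rewrite !mxE summxE; apply: eq_bigr => j _.
  by rewrite !mxE mulrC.
(* A family of maximal rank spans all the values of [v]. *)
pose P r := `[< exists q (ys : 'I_q -> Y), \rank (mat v q ys) = r >].
have exP : exists r, P r.
  exists 0%N; apply/asboolP; exists 0%N; exists (fun i : 'I_0 => match i with Ordinal m h => False_rect Y (notF h) end).
  by apply/eqP; rewrite -leqn0 rank_leq_col.
have Pmax r : P r -> (r <= N)%N.
  by move=> /asboolP[q [ys <-]]; exact: rank_leq_row.
case: (ex_maxnP exP Pmax) => r /asboolP[q [ys rV]] maxr.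
set V := mat v q ys in rV; pose U := mat u q ys.
have span y : exists a : 'cV_q, v y = V *m a.
  pose zs (i : 'I_(q + 1)) := match fintype.split i with inl j => ys j | inr _ => y end.
  have Vz : mat v _ zs = row_mx V (v y).
    apply/matrixP => i j; rewrite !mxE /zs; case: fintype.splitP => j' jj'.
      by rewrite mxE.
    by rewrite ord1.
  have le : (V^T <= (row_mx V (v y))^T)%MS by rewrite tr_row_mx -addsmxE addsmxSl.
  have := mxrank_leqif_sup le => /leqifP.
  rewrite !mxrank_tr -Vz; case: ifPn => [sub _|_].
    have : ((v y)^T <= V^T)%MS.
      by apply: submx_trans sub; rewrite Vz tr_row_mx -addsmxE addsmxSr.
    by move=> /submxP[a /(congr1 trmx)]; rewrite trmxK trmx_mul trmxK => ->; exists a^T.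
  by rewrite rV ltnNge maxr//; apply/asboolP; exists (q + 1)%N; exists zs.
have comb w y a : compatible v w -> v y = V *m a -> w y = \sum_i a i 0 * w (ys i).
  by move=> cw; rewrite mat_mul; exact: compatible_comb.
pose K := kermx B.
have KB (g : 'rV_N) : (g <= K)%MS -> g *m B = 0 by move=> /sub_kermxP.
have cokerE (w : Y -> F) : compatible v w ->
    (\row_j w (ys j)) *m cokermx V = 0.
  move=> cw; move: (cokermx V) (mulmx_coker V) => C VC; apply/rowP => c; rewrite !mxE.
  have := cw _ ys (fun j => C j c).
  have -> : \sum_i C i c *: v (ys i) = V *m col c C.
    by rewrite /V mat_mul; apply: eq_bigr => j _; rewrite mxE.
  rewrite colE mulmxA VC mul0mx => /(_ erefl) h; rewrite -[RHS]h.
  by apply: eq_bigr => j _; rewrite !mxE mulrC.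
have KUV : (K *m U <= V)%MS.
  rewrite submxE; apply/eqP/row_matrixP => m; rewrite row0 row_mul.
  have := cokerE _ (vu (row m K) (KB (row m K) (row_sub m K))).
  congr (_ *m _ = 0); apply/rowP => j; rewrite !mxE.
  by apply: eq_bigr => i _; rewrite !mxE.
have rKU : \rank (K *m U) = \rank K.
  apply/mxrank_injP; rewrite -submx0; apply/row_subP => m.
  set g := row m _; have : (g <= K :&: kermx U)%MS by exact: row_sub.
  rewrite sub_capmx => /andP[gK /sub_kermxP gU].
  rewrite (inj g) ?sub0mx ?(KB _ gK)// => y; have [a vy] := span y.
  rewrite (comb _ _ _ (vu g (KB _ gK)) vy) big1// => j _.
  have : (g *m U) 0 j = 0 by rewrite gU mxE.
  rewrite [X in X = 0 -> _]mxE [X in a j 0 * X]mxE => gUj.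
  rewrite (_ : \sum_j0 _ = 0) ?mulr0// -[RHS]gUj.
  by apply: eq_bigr => i _; rewrite !mxE.
have VKU : (V <= K *m U)%MS.
  have := mxrank_leqif_sup KUV => /leqifP; case: ifPn => // _.
  rewrite rKU mxrank_ker ltnNge.
  have BV : B *m V = 0.
    apply/matrixP => i j; have := Bv (ys j) => /matrixP/(_ i 0).
    rewrite !mxE => h; rewrite -[RHS]h; apply: eq_bigr => m _; rewrite !mxE//.
  have := mulmx0_rank_max BV; rewrite -leq_subRL ?rank_leq_row// => h1.
  by rewrite h1.
have : (\row_j f (ys j) <= K *m U)%MS.
  by apply: submx_trans VKU; rewrite submxE cokerE.
move=> /submxP[x fx]; exists (x *m K).
  by rewrite -mulmxA mulmx_ker mulmx0.
have gB : (x *m K) *m B = 0 by rewrite -mulmxA mulmx_ker mulmx0.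
move=> y; have [a vy] := span y.
rewrite (comb _ _ _ vf vy) (comb _ _ _ (vu _ gB) vy); apply: eq_bigr => j _; congr (_ * _).
have -> : f (ys j) = ((x *m K) *m U) 0 j.
  by rewrite -mulmxA -fx mxE.
by rewrite [LHS]mxE [RHS]mxE; apply: eq_bigr => i _; rewrite [U i j]mxE.
Qed.

End CompatibleFunctionals.

(** * The random system *)

Section RandomSystem.
Context {R : realType} (S : random_pl R).
Hypotheses (hsys : random_system S) (hpart : common_linear_partition S).
Hypothesis (hexp : expanding S).
Local Notation Om := (Omega S).
Local Notation p := (prob S).
Local Notation N := (nint S).
Local Notation z := (zpt S).
Local Notation I := (piece S).
Local Notation k := (slope S).
Local Notation d := (icpt S).

Lemma prob_gt0 j : Om j -> 0 < p j.
Proof. by case: hsys => _ h _; exact: h. Qed.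

Lemma Tmap01 j y : Om j -> 0 <= y <= 1 -> 0 <= Tmap S j y <= 1.
Proof. by move=> Oj y01; case: hsys => h _ _; exact: h. Qed.

Lemma summable_prob : abs_summable Om p.
Proof.
case: hsys => _ p0 ps; rewrite /abs_summable /summable.
rewrite (@eq_esum _ _ _ _ (fun j => (p j)%:E)); first by rewrite ps ltry.
by move=> j Oj /=; rewrite ger0_norm// ltW// p0.
Qed.

Lemma asum_prob : asum Om p = 1.
Proof.
case: hsys => _ p0 ps; rewrite asum_ge0E ?ps//.
by move=> j /p0/ltW.
Qed.

Lemma nint_gt0 : (0 < N)%N.
Proof.
case: hpart => -[z0 zN] _ _ _ _; rewrite lt0n; apply/negP => /eqP N0.
by move/eqP: zN; rewrite N0 z0 eq_sym oner_eq0.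
Qed.

Lemma zpt_lt i : (i < N)%N -> z i < z i.+1.
Proof. by case: hpart => _ [h _] _ _ _; exact: h. Qed.

Lemma zpt_le i i' : (i <= i' <= N)%N -> z i <= z i'.
Proof.
elim: i' => [|i' ih]; first by rewrite leqn0 => /andP[/eqP ->].
rewrite leq_eqVlt => /andP[/predU1P[->//|ii'] i'N].
by rewrite (le_trans (ih _)) ?ltW ?zpt_lt// -ltnS ii' ltnW.
Qed.

Lemma zpt0 : z 0%N = 0. Proof. by case: hpart => -[]. Qed.
Lemma zptN : z N = 1. Proof. by case: hpart => -[]. Qed.

Lemma zpt01 i : (i <= N)%N -> 0 <= z i <= 1.
Proof. by move=> iN; rewrite -{1}zpt0 -zptN !zpt_le ?leqnn ?iN. Qed.

Lemma piece_itv i y : (1 <= i <= N)%N -> I i y -> z i.-1 <= y <= z i.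
Proof. by case: hpart => _ _ h _ _ /h[_ h2] /h2; rewrite /= in_itv. Qed.

Lemma itv_piece i y : (1 <= i <= N)%N -> z i.-1 < y < z i -> I i y.
Proof. by case: hpart => _ _ h _ _ /h[h1 _] yi; apply: h1; rewrite /= in_itv. Qed.

Lemma exists_piece y : 0 <= y <= 1 -> exists2 i, (1 <= i <= N)%N & I i y.
Proof.
move=> y01; case: hpart => _ _ _ [h _ _] _.
have : `[0, 1]%classic y by rewrite /= in_itv.
by rewrite -h => -[i /= iN iy]; exists i.
Qed.

Lemma piece01 i y : (1 <= i <= N)%N -> I i y -> 0 <= y <= 1.
Proof.
move=> iN iy; case: hpart => _ _ _ [h _ _] _.
suff : `[0, 1]%classic y by rewrite /= in_itv.
by rewrite -h; exists i.
Qed.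

Lemma piece_uniq i i' y : (1 <= i <= N)%N -> (1 <= i' <= N)%N -> I i y -> I i' y -> i = i'.
Proof.
move=> iN i'N iy i'y; case: hpart => _ _ _ [_ h _] _.
by apply: h => //; exists y.
Qed.

Lemma slope_gt1 i j : (1 <= i <= N)%N -> Om j -> 1 < `|k i j|.
Proof. exact: hexp. Qed.

Lemma slope_neq0 i j : (1 <= i <= N)%N -> Om j -> k i j != 0.
Proof. by move=> iN Oj; rewrite -normr_gt0 (lt_trans _ (slope_gt1 iN Oj)). Qed.

Lemma Tmap_affine i j y : (1 <= i <= N)%N -> Om j -> I i y -> Tmap S j y = k i j * y + d i j.
Proof. by case: hpart => _ _ _ _ h iN Oj; case: (h i j iN Oj) => _ hx; exact: hx. Qed.

Lemma le1_of_segment (A C : R) : (forall t, 0 < t <= 1 -> A + t * C <= 1) -> A <= 1.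
Proof.
move=> h; apply/ler_addgt0Pl => e e0.
pose t := Num.min 1 (e / (1 + `|C|)).
have C0 : 0 < 1 + `|C| by rewrite ltr_pwDl.
have t0 : 0 < t by rewrite lt_min ltr01 divr_gt0.
have := h t; rewrite t0 ge_min lexx => /(_ isT) ht.
have : t * - C <= e.
  apply: (@le_trans _ _ (t * (1 + `|C|))).
    rewrite ler_pM2l//; apply: le_trans (ler_norm _) _.
    by rewrite normrN lerDr.
  by rewrite -ler_pdivlMr// ge_min lexx orbT.
lra.
Qed.

(** An end point of a piece may belong to the neighbouring piece, where another
    branch is in force. The value of this branch there is still a limit of values
    of the map inside the piece, which lie in [0, 1]. *)
Lemma affine_endpoint01 i j (w : R) : (1 <= i <= N)%N -> Om j ->
  w = z i.-1 \/ w = z i -> 0 <= k i j * w + d i j <= 1.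
Proof.
move=> iN Oj wE; pose m := (z i.-1 + z i) / 2.
have zlt : z i.-1 < z i.
  by case: i iN {wE m} => // i /andP[_ iN]; exact: zpt_lt.
have h t : 0 < t <= 1 -> 0 <= (k i j * w + d i j) + t * (k i j * (m - w)) <= 1.
  move=> t01; have -> : (k i j * w + d i j) + t * (k i j * (m - w)) =
     k i j * (w + t * (m - w)) + d i j by ring.
  have Iw : I i (w + t * (m - w)).
    case/andP: t01 => t0 t1; have := mulr_gt0 t0 (_ : 0 < z i - z i.-1).
    rewrite subr_gt0 => /(_ zlt) h1.
    have h2 : t * (z i - z i.-1) <= z i - z i.-1 by rewrite ler_piMl// subr_ge0 ltW.
    by apply: itv_piece => //; rewrite /m; case: wE => ->; apply/andP; split; lra.
  by rewrite -Tmap_affine//; apply: Tmap01 => //; exact: piece01 Iw.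
apply/andP; split; last by apply: (@le1_of_segment _ (k i j * (m - w))) => t /h /andP[].
have : 1 - (k i j * w + d i j) <= 1.
  by apply: (@le1_of_segment _ (- (k i j * (m - w)))) => t /h /andP[h0 _]; rewrite mulrN; lra.
lra.
Qed.

Lemma a_01 i j : (1 <= i <= N)%N -> Om j -> 0 <= a_ S i j <= 1.
Proof. by move=> iN Oj; apply: affine_endpoint01 => //; right. Qed.

Lemma b_01 i j : (i < N)%N -> Om j -> 0 <= b_ S i j <= 1.
Proof. by move=> iN Oj; apply: (@affine_endpoint01 i.+1) => //; left. Qed.

(** * The contraction ratio *)

Definition weight (j : nat) (y : R) : R :=
  \sum_(1 <= i < N.+1) \1_(I i) y * (p j / k i j).

Lemma weightE i j y : (1 <= i <= N)%N -> I i y -> weight j y = p j / k i j.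
Proof.
move=> iN iy; rewrite /weight (bigD1_seq i)/= ?mem_index_iota ?iota_uniq//.
rewrite indicE mem_set// mul1r big_seq_cond big1 ?addr0// => i'.
rewrite mem_index_iota ltnS => /andP[i'N i'i].
rewrite indicE memNset ?mul0r// => i'y; move/eqP: i'i; apply.
exact: piece_uniq i'y iy.
Qed.

Definition rho i := asum Om (fun j => p j / `|k i j|).
Definition ratio : R := \big[Num.max/0]_(1 <= i < N.+1) rho i.

Lemma prob_slope_le i j : (1 <= i <= N)%N -> Om j -> `|p j / `|k i j| | <= p j.
Proof.
move=> iN Oj; have p0 := prob_gt0 Oj; have k1 := slope_gt1 iN Oj.
rewrite normf_div normr_id (gtr0_norm p0) ler_pdivrMr ?ler_peMr//; first exact: ltW.
  exact: ltW.
exact: lt_trans k1.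
Qed.

Lemma summable_rho i : (1 <= i <= N)%N -> abs_summable Om (fun j => p j / `|k i j|).
Proof.
move=> iN; apply: le_abs_summable summable_prob => j Oj; exact: prob_slope_le.
Qed.

(** Each term is at most [p j] and the probabilities sum to 1; a single letter
    makes the inequality strict. *)
Lemma rho_lt1 i : (1 <= i <= N)%N -> rho i < 1.
Proof.
move=> iN; have [j0 Oj0] : exists j, Om j.
  apply: contrapT => Om0; have := asum_prob.
  rewrite (@eq_asum _ _ _ _ (fun=> 0)) ?asum0; last by move=> j Oj; case: Om0; exists j.
  by move/eqP; rewrite eq_sym oner_eq0.
have c0 : 0 < p j0 - p j0 / `|k i j0|.
  have k1 := slope_gt1 iN Oj0.
  by rewrite subr_gt0 ltr_pdivrMr ?ltr_pMr ?prob_gt0// (lt_trans _ k1).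
rewrite -asum_prob -subr_gt0 -asumB; [|exact: summable_prob|exact: summable_rho].
apply: (lt_le_trans c0); apply: (asum_ge_term Oj0) => [j Oj|].
  by rewrite subr_ge0 (le_trans (ler_norm _))// prob_slope_le.
apply: abs_summableD; first exact: summable_prob.
by apply: abs_summableN; exact: summable_rho.
Qed.

Lemma rho_le i : (1 <= i <= N)%N -> rho i <= ratio.
Proof.
by move=> iN; apply: (@le_bigmax_seq _ _ _ _ 0 i predT rho) => //; rewrite mem_index_iota ltnS.
Qed.

Lemma ratio01 : 0 <= ratio < 1.
Proof.
apply/andP; split; first exact: bigmax_ge_id.
rewrite /ratio big_seq; apply: bigmax_lt => // i.
by rewrite mem_index_iota ltnS => /rho_lt1.
Qed.

Lemma branch_le i (u : nat -> R) B : (1 <= i <= N)%N ->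
  (forall j, Om j -> `|u j| <= B) ->
  forall j, Om j -> `|p j / k i j * u j| <= B * (p j / `|k i j|).
Proof.
move=> iN uB j Oj; rewrite mulrC normrM ler_pM ?normr_ge0 ?uB//.
by rewrite normf_div [X in X / _]ger0_norm// ltW// prob_gt0.
Qed.

Lemma summable_branch i (u : nat -> R) B : (1 <= i <= N)%N ->
  (forall j, Om j -> `|u j| <= B) -> abs_summable Om (fun j => p j / k i j * u j).
Proof.
move=> iN uB; apply: le_abs_summable (branch_le iN uB) _.
by apply: abs_summableZ; exact: summable_rho.
Qed.

Lemma branch_bound i (u : nat -> R) B : (1 <= i <= N)%N -> 0 <= B ->
  (forall j, Om j -> `|u j| <= B) ->
  `|asum Om (fun j => p j / k i j * u j)| <= ratio * B.
Proof.
move=> iN B0 uB; apply: (@le_trans _ _ (asum Om (fun j => B * (p j / `|k i j|)))).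
  by apply: ler_norm_asum (branch_le iN uB); apply: abs_summableZ; exact: summable_rho.
rewrite asumZ.
by rewrite mulrC ler_wpM2r// rho_le.
Qed.

(** * The averaging operator and its resolvent *)

Definition bounded01 (f : R -> R) (B : R) := forall y, 0 <= y <= 1 -> `|f y| <= B.

(** The iterates of this operator are the sums over words of a given length, the
    first letter being applied first ([sum_words]). *)
Definition avg (f : R -> R) (y : R) : R := asum Om (fun j => weight j y * f (Tmap S j y)).

Lemma avgE f i y : (1 <= i <= N)%N -> I i y ->
  avg f y = asum Om (fun j => p j / k i j * f (Tmap S j y)).
Proof. by move=> iN iy; apply: eq_asum => j _; rewrite (weightE _ iN iy). Qed.

Lemma bounded01_lin f g a B B' : bounded01 f B -> bounded01 g B' ->
  bounded01 (fun y => f y + a * g y) (B + `|a| * B').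
Proof.
move=> uB vB x x01; apply: le_trans (ler_normD _ _) _; rewrite normrM.
by apply: lerD; [exact: uB|apply: ler_wpM2l => //; exact: vB].
Qed.

Lemma bounded01_ge0 f B : bounded01 f B -> 0 <= B.
Proof. by move=> fB; apply: le_trans (fB 0 _) => //; rewrite lexx ler01. Qed.

Lemma avg_bounded f B : bounded01 f B -> bounded01 (avg f) (ratio * B).
Proof.
move=> fB y y01; have [i iN iy] := exists_piece y01; rewrite (avgE _ iN iy).
by apply: branch_bound => //[|j Oj]; [exact: bounded01_ge0 fB|exact/fB/Tmap01].
Qed.

Lemma iter_avg_bounded t f B : bounded01 f B ->
  bounded01 (iter t avg f) (ratio ^+ t * B).
Proof.
move=> fB; elim: t => [|t ih]; first by rewrite expr0 mul1r.
by rewrite iterS exprS -mulrA; exact: avg_bounded.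
Qed.

Lemma eq_avg f g : (forall y, 0 <= y <= 1 -> f y = g y) ->
  forall y, 0 <= y <= 1 -> avg f y = avg g y.
Proof. by move=> fg y y01; apply: eq_asum => j Oj; rewrite fg//; exact: Tmap01. Qed.

Lemma summable_avg f B y : bounded01 f B -> 0 <= y <= 1 ->
  abs_summable Om (fun j => weight j y * f (Tmap S j y)).
Proof.
move=> fB y01; have [i iN iy] := exists_piece y01.
apply: (@le_abs_summable _ _ _ _ (fun j => B * (p j / `|k i j|))).
  move=> j Oj; rewrite (weightE _ iN iy).
  by apply: (branch_le (u := fun j => f (Tmap S j y))) => // j' Oj'; exact/fB/Tmap01.
by apply: abs_summableZ; exact: summable_rho.
Qed.

Lemma avg_sum (F : nat -> R -> R) (b : nat -> R) n y :
  (forall t, bounded01 (F t) (b t)) -> 0 <= y <= 1 ->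
  avg (fun x => \sum_(0 <= t < n) F t x) y = \sum_(0 <= t < n) avg (F t) y.
Proof.
move=> Fb y01; rewrite /avg.
under eq_asum do rewrite mulr_sumr.
by apply: asum_sum => t _; exact: summable_avg (Fb t) y01.
Qed.

Lemma avg_lin f g a B B' y : bounded01 f B -> bounded01 g B' -> 0 <= y <= 1 ->
  avg (fun y => f y + a * g y) y = avg f y + a * avg g y.
Proof.
move=> fB gB y01; rewrite /avg -asumZ -asumD; last 2 first.
- exact: summable_avg fB y01.
- exact/abs_summableZ/(summable_avg gB y01).
by apply: eq_asum => j _; rewrite mulrDr mulrCA.
Qed.

Lemma avg_cvg (f : nat -> R -> R) (g : R -> R) B :
  (forall n, bounded01 (f n) B) ->
  (forall y, 0 <= y <= 1 -> f n y @[n --> \oo] --> g y) ->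
  forall y, 0 <= y <= 1 -> avg (f n) y @[n --> \oo] --> avg g y.
Proof.
move=> fB fg y y01; have [i iN iy] := exists_piece y01.
apply: (@asum_dominated_cvg _ _ _ _ (fun j => B * (p j / `|k i j|))).
- by move=> j Oj; apply: cvgMr; apply: fg; exact: Tmap01.
- move=> n j Oj; rewrite (weightE _ iN iy).
  by apply: (branch_le (u := fun j => f n (Tmap S j y))) => // j' Oj'; exact/fB/Tmap01.
- by apply: abs_summableZ; exact: summable_rho.
Qed.

Lemma avg_fixpoint_eq0 f B : bounded01 f B ->
  (forall y, 0 <= y <= 1 -> f y = avg f y) -> forall y, 0 <= y <= 1 -> f y = 0.
Proof.
move=> fB ff y y01; apply/eqP; rewrite -normr_le0.
have fit t : bounded01 f (ratio ^+ t * B).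
  elim: t => [|t ih]; first by rewrite expr0 mul1r.
  by move=> x x01; rewrite ff// exprS -mulrA; exact: avg_bounded.
have [r0 r1] := andP ratio01.
have : ratio ^+ t * B @[t --> \oo] --> 0 * B.
  by apply: cvgMl; apply: cvg_expr; rewrite ger0_norm.
rewrite mul0r => h; apply: (ler_cvg_to (cvg_cst `|f y|) h).
by apply: nearW => t; exact: fit.
Qed.

(** The inverse of [1 - avg] as a Neumann series. *)
Definition resolvent (f : R -> R) (y : R) : R := asum setT (fun t => iter t avg f y).

Lemma summable_resolvent f B y : bounded01 f B -> 0 <= y <= 1 ->
  abs_summable setT (fun t => iter t avg f y).
Proof.
move=> fB y01; apply: le_abs_summable (summable_geometric B ratio01) => t _.
exact: iter_avg_bounded.
Qed.

Lemma resolvent_bounded f B : bounded01 f B -> bounded01 (resolvent f) (B / (1 - ratio)).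
Proof.
move=> fB y y01; rewrite -(asum_geometric B ratio01).
apply: ler_norm_asum => [|t _]; first exact: summable_geometric ratio01.
exact: iter_avg_bounded.
Qed.

Lemma resolventE f B y : bounded01 f B -> 0 <= y <= 1 ->
  resolvent f y = f y + avg (resolvent f) y.
Proof.
move=> fB y01.
pose s n y := \sum_(0 <= t < n) iter t avg f y.
have sS n x : 0 <= x <= 1 -> s n.+1 x = f x + avg (s n) x.
  move=> x01; rewrite /s big_nat_recl//= (avg_sum (b := fun t => ratio ^+ t * B))//.
  by move=> t; exact: iter_avg_bounded.
have sB n : bounded01 (s n) (B / (1 - ratio)).
  elim: n => [|n ih] x x01.
    rewrite /s big_geq// normr0 divr_ge0 ?(bounded01_ge0 fB)// subr_ge0.
    by case/andP: ratio01 => _ /ltW.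
  have [_ r1] := andP ratio01.
  rewrite sS//; apply: le_trans (ler_normD _ _) _.
  have -> : B / (1 - ratio) = B + ratio * (B / (1 - ratio)).
    by field; rewrite subr_eq0 gt_eqF.
  by apply: lerD; [exact: fB|exact: avg_bounded ih _ x01].
have sr x : 0 <= x <= 1 -> s n x @[n --> \oo] --> resolvent f x.
  by move=> x01; apply: asum_cvg; exact: summable_resolvent fB x01.
have := sr y y01; rewrite -(cvg_shiftS (s^~ y)) /=.
under eq_fun do rewrite sS//.
move=> h; apply: (cvg_unique _ h) => //.
by apply: cvgD; [exact: cvg_cst|exact: avg_cvg sB sr _ y01].
Qed.

(** The difference of two bounded solutions is a bounded fixed point of the
    contraction [avg], hence 0. *)
Lemma resolvent_unique f g B B' : bounded01 f B -> bounded01 g B' ->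
  (forall y, 0 <= y <= 1 -> g y = f y + avg g y) ->
  forall y, 0 <= y <= 1 -> g y = resolvent f y.
Proof.
move=> fB gB gE y y01; have rB := resolvent_bounded fB.
have h x : 0 <= x <= 1 -> g x + -1 * resolvent f x =
    avg (fun x => g x + -1 * resolvent f x) x.
  move=> x01; rewrite (avg_lin _ gB rB x01) gE// (resolventE fB x01); lra.
apply/eqP; rewrite -subr_eq0 -mulN1r; apply/eqP.
apply: (avg_fixpoint_eq0 (B := B' + B / (1 - ratio))) h _ y01 => x x01.
rewrite mulN1r; apply: le_trans (ler_normB _ _) _.
by apply: lerD; [exact: gB|exact: rB].
Qed.

Lemma resolvent_lin f g a B B' y : bounded01 f B -> bounded01 g B' -> 0 <= y <= 1 ->
  resolvent (fun y => f y + a * g y) y = resolvent f y + a * resolvent g y.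
Proof.
move=> fB gB y01.
have [rf rg] := (resolvent_bounded fB, resolvent_bounded gB).
symmetry; apply: (resolvent_unique (bounded01_lin a fB gB) (bounded01_lin a rf rg)) y01 => x x01.
rewrite (avg_lin _ rf rg x01) (resolventE fB x01) (resolventE gB x01); ring.
Qed.

Lemma eq_resolvent f g y : (forall y, 0 <= y <= 1 -> f y = g y) -> 0 <= y <= 1 ->
  resolvent f y = resolvent g y.
Proof.
move=> fg y01; apply: eq_asum => t _; elim: t y y01 => [|t ih] y y01; first exact: fg.
by rewrite !iterS; exact: eq_avg.
Qed.

Lemma resolvent_cvg (f : nat -> R -> R) (g : R -> R) B :
  (forall n, bounded01 (f n) B) ->
  (forall y, 0 <= y <= 1 -> f n y @[n --> \oo] --> g y) ->
  forall y, 0 <= y <= 1 -> resolvent (f n) y @[n --> \oo] --> resolvent g y.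
Proof.
move=> fB fg y y01.
apply: (@asum_dominated_cvg _ _ _ _ (fun t => ratio ^+ t * B)).
- move=> t _; elim: t y y01 => [|t ih] y y01; first exact: fg.
  by apply: (avg_cvg (B := ratio ^+ t * B)) ih y y01 => n; exact: iter_avg_bounded.
- by move=> n t _; exact: iter_avg_bounded.
- exact: summable_geometric ratio01.
Qed.

(** * Sums over words *)

Lemma words_bij t : set_bij (Om `*` words S t) (words S t.+1) (fun a => a.1 :: a.2).
Proof.
split.
- move=> [j w] [/= Oj [wt wO]]; split => [|i]; first by rewrite /= wt.
  by rewrite inE => /predU1P[->//|/wO].
- by move=> [j w] [j' w'] _ _ /= [-> ->].
- move=> [|j w] []//= /eqP; rewrite eqSS => /eqP wt wO; exists (j, w) => //; split => /=.
    by apply: wO; rewrite mem_head.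
  by split => // i iw; apply: wO; rewrite inE iw orbT.
Qed.

Lemma words_step t (F : seq nat -> R) (b : nat -> R) :
  (forall j, Om j -> \esum_(w in words S t) `|F (j :: w)|%:E <= (b j)%:E)%E ->
  abs_summable Om b ->
  (\esum_(w in words S t.+1) `|F w|%:E <= \esum_(j in Om) (b j)%:E)%E /\
  asum (words S t.+1) F = asum Om (fun j => asum (words S t) (fun w => F (j :: w))).
Proof.
move=> Fb sb; have be := words_bij t.
have le := @abs_summable_prod _ _ _ Om (words S t) (fun j w => F (j :: w)) b Fb.
split; first by rewrite (reindex_esum _ _ _ _ be).
rewrite (asum_reindex F be); apply: (@asum_prod _ _ _ _ _ (fun j w => F (j :: w))).
apply: le_lt_trans le _; apply: le_lt_trans sb; apply: le_esum => j Oj.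
by rewrite lee_fin ler_norm.
Qed.

Lemma words0 : words S 0 = [set [::]].
Proof. by apply/seteqP; split => [w [/size0nil ->]|_ ->]. Qed.

(** A summand that splits off a factor for the first letter turns the sum over
    words of length [t + t0] into the [t]-th iterate of [avg] applied to the sum
    over words of length [t0]. The base length is 0 for the sums in [L_fun] and 1
    for those in [KI], whose indicator looks at the image before the last letter. *)
Lemma sum_words (F : seq nat -> R -> R) (t0 : nat) (B : R) :
  (forall j w y, (t0 <= size w)%N -> F (j :: w) y = weight j y * F w (Tmap S j y)) ->
  (forall y, 0 <= y <= 1 -> (\esum_(w in words S t0) `|F w y|%:E <= B%:E)%E) ->
  forall t y, 0 <= y <= 1 ->
  asum (words S (t + t0)) (F^~ y) = iter t avg (fun y => asum (words S t0) (F^~ y)) y.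
Proof.
move=> FS FB.
suff h t : (forall y, 0 <= y <= 1 ->
      (\esum_(w in words S (t + t0)) `|F w y|%:E <= (ratio ^+ t * B)%:E)%E) /\
    forall y, 0 <= y <= 1 -> asum (words S (t + t0)) (F^~ y) =
      iter t avg (fun y => asum (words S t0) (F^~ y)) y.
  by move=> t; case: (h t).
elim: t => [|t [ihB ih]]; first by split => // y y01; rewrite expr0 mul1r FB.
suff hs y : 0 <= y <= 1 ->
    (\esum_(w in words S (t + t0).+1) `|F w y|%:E <= (ratio ^+ t.+1 * B)%:E)%E /\
    asum (words S (t + t0).+1) (F^~ y) = avg (fun y => asum (words S (t + t0)) (F^~ y)) y.
  split=> y y01; rewrite addSn; case: (hs y y01) => // _ ->.
  by rewrite iterS; apply: eq_avg.
move=> y01; have [i iN iy] := exists_piece y01.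
have FE j : Om j -> forall w, words S (t + t0) w ->
    F (j :: w) y = weight j y * F w (Tmap S j y).
  by move=> Oj w [wt _]; rewrite FS// wt leq_addl.
have FBj j : Om j -> (\esum_(w in words S (t + t0)) `|F (j :: w) y|%:E <=
    ((ratio ^+ t * B) * (p j / `|k i j|))%:E)%E.
  move=> Oj; rewrite (@eq_esum _ _ _ _ (fun w => `|weight j y|%:E * `|F w (Tmap S j y)|%:E)%E).
    rewrite esumZ//; have h := ihB _ (Tmap01 Oj y01).
    rewrite (weightE _ iN iy) normf_div (gtr0_norm (prob_gt0 Oj)).
    rewrite [X in (_ <= X%:E)%E]mulrC [X in (_ <= X)%E]EFinM.
    apply: lee_wpmul2l => //; rewrite lee_fin divr_ge0// ltW// prob_gt0//.
  by move=> w ww; rewrite FE// normrM EFinM.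
have [sumB ->] := @words_step (t + t0) (F^~ y) _ FBj (abs_summableZ _ (summable_rho iN)).
split.
  apply: le_trans sumB _; have sr := summable_rho iN.
  have r0 j : Om j -> 0 <= p j / `|k i j| by move=> /prob_gt0 p0; rewrite divr_ge0// ltW.
  have B0 : 0 <= ratio ^+ t * B.
    by rewrite -lee_fin; apply: le_trans (ihB y y01); exact: esum_ge0.
  have b0 j : Om j -> 0 <= ratio ^+ t * B * (p j / `|k i j|).
    by move=> Oj; rewrite mulr_ge0// r0.
  rewrite -[leLHS]fineK; last by apply: esum_fin => //; exact: abs_summableZ.
  rewrite -asum_ge0E// asumZ// lee_fin.
  rewrite (_ : ratio ^+ t.+1 * B = ratio ^+ t * B * ratio); last by rewrite exprS; ring.
  by apply: ler_wpM2l => //; exact: rho_le.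
by apply: eq_asum => j Oj; rewrite (eq_asum (FE j Oj)) asumZ.
Qed.

Lemma delta_cons j w y t : delta S (j :: w) y t.+1 = weight j y * delta S w (Tmap S j y) t.
Proof.
rewrite /delta !big_nat_recl//= !mul1r; congr (_ * _).
Qed.

Lemma delta0 w y : delta S w y 0 = 1.
Proof. by rewrite /delta big_nat1. Qed.

Lemma delta1 j y : delta S [:: j] y 1 = weight j y.
Proof. by rewrite delta_cons delta0 mulr1. Qed.

Lemma asum_set1 (X : choiceType) (x : X) (f : X -> R) : asum [set x] f = f x.
Proof.
rewrite /asum !esum_set1 ?lee_fin ?funrpos_ge0 ?funrneg_ge0//.
by rewrite -EFinB /= -[in RHS](funrposBneg f).
Qed.

Lemma sum_words_final (G : R -> R) B t y : bounded01 G B -> 0 <= y <= 1 ->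
  asum (words S t) (fun w => delta S w y t * G (Tword S w y)) = iter t avg G y.
Proof.
move=> GB y01; pose F w y := delta S w y (size w) * G (Tword S w y).
have F0 u : asum (words S 0) (F^~ u) = G u.
  by rewrite words0 asum_set1 /F delta0 mul1r.
rewrite (@eq_asum _ _ _ _ (F^~ y)); last by move=> w [wt _]; rewrite /F wt.
rewrite -[t in LHS]addn0 (@sum_words F 0 B)// => [|j w u _|u u01].
- by congr (iter t avg _ y); apply/funext.
- by rewrite /F delta_cons mulrA.
- by rewrite words0 esum_set1// lee_fin /F delta0 mul1r GB.
Qed.

Lemma L_funE y x : 0 <= y <= 1 ->
  L_fun S y x = resolvent (fun u => \1_(`[0, u[) x) y.
Proof.
move=> y01; apply: eq_asum => t _.
apply: (@sum_words_final (fun u => \1_(`[0, u[) x) 1) => // u _.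
by rewrite indicE; case: (_ \in _); rewrite ?normr1 ?normr0.
Qed.

(** The last letter of a word acts after the indicator has been evaluated in piece
    [n], so summing over it produces the factor [mean_inv_slope S n]. *)
Lemma KIE n y : (1 <= n <= N)%N -> 0 <= y <= 1 ->
  KI S n y = mean_inv_slope S n * resolvent \1_(I n) y.
Proof.
move=> nN y01.
pose F w y := delta S w y (size w) * \1_(I n) (Tword S (take (size w).-1 w) y).
have FS j w u : (1 <= size w)%N -> F (j :: w) u = weight j u * F w (Tmap S j u).
  by case: w => // i w _; rewrite /F delta_cons -mulrA.
have F1 j u : F [:: j] u = weight j u * \1_(I n) u.
  by rewrite /F delta1.
have FB u : 0 <= u <= 1 -> (\esum_(w in words S 1) `|F w u|%:E <= ratio%:E)%E /\
    asum (words S 1) (F^~ u) = mean_inv_slope S n * \1_(I n) u.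
  move=> u01; have [i iN iu] := exists_piece u01.
  have [] := @words_step 0 (F^~ u) (fun j => p j / `|k i j|) _ (summable_rho iN).
    move=> j Oj; rewrite words0 esum_set1// lee_fin F1 (weightE _ iN iu) normrM.
    rewrite normf_div (gtr0_norm (prob_gt0 Oj)) ler_piMr//; last first.
      by rewrite indicE; case: (_ \in _); rewrite ?normr1 ?normr0.
    by rewrite divr_ge0// ltW// prob_gt0.
  move=> sumF ->; split.
    apply: le_trans sumF _; have r0 j : Om j -> 0 <= p j / `|k i j|.
      by move=> /prob_gt0 p0; rewrite divr_ge0// ltW.
    rewrite -[leLHS]fineK; last by apply: esum_fin => //; exact: summable_rho.
    by rewrite -asum_ge0E// lee_fin; exact: rho_le.
  have [niu|niu] := pselect (I n u); last first.
    rewrite indicE memNset// mulr0 -[RHS](@asum0 _ _ Om); apply: eq_asum => j Oj.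
    by rewrite words0 asum_set1 F1 indicE memNset// mulr0.
  rewrite indicE mem_set// mulr1; apply: eq_asum => j Oj.
  by rewrite words0 asum_set1 F1 indicE mem_set// mulr1 (weightE _ nN niu).
have be : set_bij [set: nat] [set t | (1 <= t)%N] succn.
  by split => //= [? ? _ _ [->]//|[|t]// _]; exists t.
rewrite /KI (asum_reindex _ be) /resolvent -asumZ.
apply: eq_asum => t _ /=.
rewrite (@eq_asum _ _ _ _ (F^~ y)); last by move=> w [wt _]; rewrite /F wt.
rewrite -addn1 (sum_words FS (fun u u01 => (FB u u01).1))//.
elim: t y y01 => [|t ih] u u01 /=; first exact: (FB u u01).2.
rewrite (eq_avg ih u01); have [i iN iu] := exists_piece u01.
by rewrite !(avgE _ iN iu) -asumZ; apply: eq_asum => j _; rewrite mulrCA.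
Qed.

(** * Jumps at the partition points and the fundamental matrix *)

Definition boundedfun f := exists B, bounded01 f B.

Lemma boundedfun_lin f g a : boundedfun f -> boundedfun g ->
  boundedfun (fun y => f y + a * g y).
Proof. by move=> [B fB] [B' gB']; exists (B + `|a| * B'); exact: bounded01_lin. Qed.

Lemma boundedfun_sum n (c : nat -> R) (F : nat -> R -> R) :
  (forall m, boundedfun (F m)) -> boundedfun (fun y => \sum_(0 <= m < n) c m * F m y).
Proof.
move=> Fb; elim: n => [|n ih].
  by exists 0 => y _; rewrite big_geq// normr0.
under eq_fun do rewrite big_nat_recr//=.
exact: boundedfun_lin.
Qed.

Lemma boundedfun_resolvent f : boundedfun f -> boundedfun (resolvent f).
Proof. by move=> [B fB]; exists (B / (1 - ratio)); exact: resolvent_bounded. Qed.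

Lemma resolvent_sum n (c : nat -> R) (F : nat -> R -> R) y :
  (forall m, boundedfun (F m)) -> 0 <= y <= 1 ->
  resolvent (fun y => \sum_(0 <= m < n) c m * F m y) y =
  \sum_(0 <= m < n) c m * resolvent (F m) y.
Proof.
move=> Fb y01; elim: n => [|n ih].
  rewrite big_geq//; rewrite (@eq_resolvent _ (fun=> 0)) => [|u _|//]; last by rewrite big_geq.
  have zb : bounded01 (fun=> 0) 0 by move=> u _; rewrite normr0.
  by apply/eqP; rewrite -normr_le0 (le_trans (resolvent_bounded zb y01))// mul0r.
rewrite big_nat_recr//= -ih.
have [[B sB] [B' FB]] := (boundedfun_sum n c Fb, Fb n).
rewrite -(resolvent_lin _ sB FB)//.
by apply: eq_resolvent => // u _; rewrite big_nat_recr.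
Qed.

(** For continuous [f] these are the limits of [avg f] at [zpt S i] from the left
    ([right_end], through piece [i]) and from the right ([left_end], through piece
    [i.+1]). *)
Definition right_end (i : nat) (f : R -> R) : R :=
  asum Om (fun j => p j / k i j * f (a_ S i j)).
Definition left_end (i : nat) (f : R -> R) : R :=
  asum Om (fun j => p j / k i.+1 j * f (b_ S i j)).

(** The limit from the left counts as 0 at the point 0. *)
Definition jump (m : nat) (f : R -> R) : R :=
  (if m == 0%N then 0 else right_end m f) - left_end m f.

Lemma right_end_lin i f g a : (1 <= i <= N)%N -> boundedfun f -> boundedfun g ->
  right_end i (fun y => f y + a * g y) = right_end i f + a * right_end i g.
Proof.
move=> iN [B fB] [B' gB]; rewrite /right_end.
have sf : abs_summable Om (fun j => p j / k i j * f (a_ S i j)).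
  by apply: (summable_branch iN (B := B)) => j Oj; apply/fB/a_01.
have sg : abs_summable Om (fun j => p j / k i j * g (a_ S i j)).
  by apply: (summable_branch iN (B := B')) => j Oj; apply/gB/a_01.
rewrite -asumZ// -asumD//; last exact: abs_summableZ.
by apply: eq_asum => j _; rewrite mulrDr (mulrCA a).
Qed.

Lemma left_end_lin i f g a : (i < N)%N -> boundedfun f -> boundedfun g ->
  left_end i (fun y => f y + a * g y) = left_end i f + a * left_end i g.
Proof.
move=> iN [B fB] [B' gB]; rewrite /left_end.
have sf : abs_summable Om (fun j => p j / k i.+1 j * f (b_ S i j)).
  by apply: (@summable_branch i.+1 _ B) => // j Oj; apply/fB/b_01.
have sg : abs_summable Om (fun j => p j / k i.+1 j * g (b_ S i j)).
  by apply: (@summable_branch i.+1 _ B') => // j Oj; apply/gB/b_01.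
rewrite -asumZ// -asumD//; last exact: abs_summableZ.
by apply: eq_asum => j _; rewrite mulrDr (mulrCA a).
Qed.

Lemma jump_lin m f g a : (m < N)%N -> boundedfun f -> boundedfun g ->
  jump m (fun y => f y + a * g y) = jump m f + a * jump m g.
Proof.
move=> mN fb gb; rewrite /jump left_end_lin//; case: eqVneq => [_|m0]; first by ring.
have mN' : (1 <= m <= N)%N by rewrite lt0n m0 ltnW.
by rewrite right_end_lin//; ring.
Qed.

Lemma eq_jump m f g : (m < N)%N -> (forall y, 0 <= y <= 1 -> f y = g y) ->
  jump m f = jump m g.
Proof.
move=> mN fg; rewrite /jump; congr (_ - _); last first.
  by apply: eq_asum => j Oj; rewrite fg// b_01.
case: eqVneq => // m0; have mN' : (1 <= m <= N)%N by rewrite lt0n m0 ltnW.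
by apply: eq_asum => j Oj; rewrite fg// a_01.
Qed.

Lemma jump_bounded m f B : (m < N)%N -> bounded01 f B -> `|jump m f| <= 2 * B.
Proof.
move=> mN fB; have B0 := bounded01_ge0 fB; have [r0 r1] := andP ratio01.
have rB : ratio * B <= B by rewrite ler_piMl// ltW.
rewrite /jump; apply: le_trans (ler_normB _ _) _.
have hl : `|left_end m f| <= B.
  by apply: le_trans rB; apply: (@branch_bound m.+1) => // j Oj; exact/fB/b_01.
have hr : `|if m == 0%N then 0 else right_end m f| <= B.
  case: eqVneq => [_|m0]; first by rewrite normr0.
  have mN' : (1 <= m <= N)%N by rewrite lt0n m0 ltnW.
  by apply: le_trans rB; apply: (@branch_bound m) => // j Oj; exact/fB/a_01.
lra.
Qed.

Lemma jump_cvg m (f : nat -> R -> R) g B : (m < N)%N ->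
  (forall n, bounded01 (f n) B) ->
  (forall y, 0 <= y <= 1 -> f n y @[n --> \oo] --> g y) ->
  jump m (f n) @[n --> \oo] --> jump m g.
Proof.
move=> mN fB fg; rewrite /jump; apply: cvgB.
  case: eqVneq => [_|m0]; first exact: cvg_cst.
  have mN' : (1 <= m <= N)%N by rewrite lt0n m0 ltnW.
  apply: (@asum_dominated_cvg _ _ _ _ (fun j => B * (p j / `|k m j|))).
  - by move=> j Oj; apply: cvgMr; apply: fg; exact: a_01.
  - move=> n j Oj; apply: (branch_le (u := fun j => f n (a_ S m j))) => // j' Oj'.
    by apply/fB/a_01.
  - by apply: abs_summableZ; exact: summable_rho.
apply: (@asum_dominated_cvg _ _ _ _ (fun j => B * (p j / `|k m.+1 j|))).
- by move=> j Oj; apply: cvgMr; apply: fg; exact: b_01.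
- move=> n j Oj; apply: (@branch_le m.+1 (fun j => f n (b_ S m j))) => // j' Oj'.
  by apply/fB/b_01.
- by apply: abs_summableZ; exact: summable_rho.
Qed.

Lemma jump0 m : (m < N)%N -> jump m (fun=> 0) = 0.
Proof.
move=> mN; apply/eqP; rewrite -normr_le0.
have zb : bounded01 (fun=> 0) 0 by move=> u _; rewrite normr0.
by apply: le_trans (jump_bounded mN zb) _; rewrite mulr0.
Qed.

Lemma jump_sum m n (c : nat -> R) (F : nat -> R -> R) : (m < N)%N ->
  (forall i, boundedfun (F i)) ->
  jump m (fun y => \sum_(0 <= i < n) c i * F i y) = \sum_(0 <= i < n) c i * jump m (F i).
Proof.
move=> mN Fb; elim: n => [|n ih].
  by rewrite big_geq// -[RHS](jump0 mN); apply: eq_jump => // y _; rewrite big_geq.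
rewrite big_nat_recr//= -ih -jump_lin//; last exact: boundedfun_sum.
by apply: eq_jump => // y _; rewrite big_nat_recr.
Qed.

(** The value at [zpt S m] is 0 or 1 according to the piece that contains this
    point. *)
Definition step (m : nat) (y : R) : R := \sum_(m.+1 <= n < N.+1) \1_(I n) y.

Lemma indic_piece i n y : (1 <= i <= N)%N -> (1 <= n <= N)%N -> I i y ->
  \1_(I n) y = (n == i)%:R :> R.
Proof.
move=> iN nN iy; rewrite indicE; case: eqVneq => [->|ni]; first by rewrite mem_set.
by rewrite memNset// => /(piece_uniq nN iN)/(_ iy)/eqP; rewrite (negPf ni).
Qed.

Lemma stepE i m y : (1 <= i <= N)%N -> I i y -> step m y = (m < i)%:R.
Proof.
move=> iN iy; rewrite /step (eq_big_nat _ _ (F2 := fun n => (n == i)%:R)); last first.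
  by move=> n /andP[mn nN]; apply: indic_piece => //; rewrite (leq_ltn_trans _ mn).
have [mi|im] := ltnP m i.
  rewrite (bigD1_seq i)/= ?iota_uniq// ?mem_index_iota ?mi ?ltnS; last by case/andP: iN.
  by rewrite eqxx big1 ?addr0// => n /negPf ->.
rewrite big_nat big1// => n /andP[mn _]; case: eqVneq => // ni.
by move: mn; rewrite ni ltnNge im.
Qed.

Lemma step_bounded m : bounded01 (step m) 1.
Proof.
move=> y y01; have [i iN iy] := exists_piece y01.
by rewrite (stepE _ iN iy); case: (_ < _)%N; rewrite ?normr1 ?normr0.
Qed.

Lemma sum_stepE c i y : (1 <= i <= N)%N -> I i y ->
  \sum_(0 <= m < N) c m * step m y = \sum_(0 <= m < i) c m.
Proof.
move=> iN iy; have /andP[_ iN'] := iN.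
rewrite (@big_cat_nat _ _ _ i)//= [X in _ + X]big_nat [X in _ + X]big1 ?addr0.
  by apply: eq_big_nat => m /andP[_ mi]; rewrite (stepE _ iN iy) mi mulr1.
by move=> m /andP[im _]; rewrite (stepE _ iN iy) ltnNge im mulr0.
Qed.

Lemma boundedfun_step m : boundedfun (step m). Proof. by exists 1; exact: step_bounded. Qed.

Lemma boundedfun_indic n : boundedfun (\1_(I n) : R -> R).
Proof. by exists 1 => y _; rewrite indicE; case: (_ \in _); rewrite ?normr1 ?normr0. Qed.

Definition step_resolvent (m : nat) : R -> R := resolvent (step m).

Lemma boundedfun_step_resolvent m : boundedfun (step_resolvent m).
Proof. exact/boundedfun_resolvent/boundedfun_step. Qed.

Lemma mean_inv_slopeE i : mean_inv_slope S i = asum Om (fun j => p j / k i j * 1).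
Proof. by apply: eq_asum => j _; rewrite mulr1. Qed.

Lemma jump1E m : jump m (fun=> 1) =
  (if m == 0%N then 0 else mean_inv_slope S m) - mean_inv_slope S m.+1.
Proof. by rewrite /jump !mean_inv_slopeE. Qed.

Lemma sum_jump1 i : (0 < i)%N ->
  \sum_(0 <= m < i) jump m (fun=> 1) = - mean_inv_slope S i.
Proof.
case: i => // i _; elim: i => [|i ih].
  by rewrite big_nat1 jump1E/= sub0r.
by rewrite big_nat_recr//= ih jump1E/=; ring.
Qed.

(** The left kernel of [1 - G], where [G] is the matrix of the numbers
    [jump m (step_resolvent m')], with coordinates 0, ..., N - 1. *)
Definition left_kernel (g : nat -> R) : Prop := forall m', (m' < N)%N ->
  g m' = \sum_(0 <= m < N) g m * jump m (step_resolvent m').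

(** The jumps of the constant 1 add up to minus the mean inverse slope of the
    current piece, so [1 - avg 1] is the sum of [step 0] and of the functions
    [jump m 1 * step m]. Hence 1 is a combination of the functions
    [step_resolvent m] whose coefficients are its own jumps, with 1 added at
    [m = 0]. Pairing the jumps of both sides with [c] gives [c 0 = 0]. *)
Lemma left_kernel_head (c : nat -> R) : left_kernel c -> c 0%N = 0.
Proof.
move=> cE; pose bt m := jump m (fun=> 1) + (m == 0%N)%:R.
have oneE y : 0 <= y <= 1 -> 1 = \sum_(0 <= m < N) bt m * step_resolvent m y.
  move=> y01; rewrite -resolvent_sum//; last by move=> m; exact: boundedfun_step.
  have [B fB] := boundedfun_sum N bt boundedfun_step.
  have b1 : bounded01 (fun=> 1) 1 by move=> u _; rewrite normr1.
  apply: (resolvent_unique fB b1) y01 => u u01; have [i iN iu] := exists_piece u01.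
  have i0 : (0 < i)%N by case/andP: iN.
  rewrite (sum_stepE _ iN iu) (avgE _ iN iu) -mean_inv_slopeE big_split/= sum_jump1//.
  rewrite big_ltn// eqxx [X in 1 + X]big_nat [X in 1 + X]big1; first by ring.
  by case=> // m /andP[].
have : \sum_(0 <= m < N) c m * jump m (fun=> 1) = \sum_(0 <= m < N) bt m * c m.
  rewrite [RHS](eq_big_nat _ _ (F2 := fun m' =>
    \sum_(0 <= m < N) c m * (bt m' * jump m (step_resolvent m')))); last first.
    move=> m' /andP[_ m'N]; rewrite [in LHS]cE// mulr_sumr.
    by apply: eq_bigr => m _; rewrite mulrCA.
  rewrite exchange_big/=; apply: eq_big_nat => m /andP[_ mN].
  rewrite -mulr_sumr -jump_sum//; last by move=> i; exact: boundedfun_step_resolvent.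
  by congr (_ * _); apply: eq_jump.
have -> : \sum_(0 <= m < N) bt m * c m = c 0%N + \sum_(0 <= m < N) c m * jump m (fun=> 1).
  under eq_bigr do rewrite /bt mulrDl [_%:R * _]mulrC [_ * c _]mulrC.
  rewrite big_split/= addrC; congr (_ + _).
  rewrite big_ltn ?nint_gt0// eqxx mulr1 big_nat big1 ?addr0//.
  by case=> // m _; rewrite mulr0.
by move/eqP; rewrite -subr_eq0 opprD addrCA subrr addr0 oppr_eq0 => /eqP.
Qed.

Lemma muE n i : (1 <= n <= N)%N -> (1 <= i < N)%N ->
  mu S n i = mean_inv_slope S n * jump i (resolvent \1_(I n)) + epsilon S n i.
Proof.
move=> nN /andP[i1 iN]; rewrite /mu; congr (_ + _).
have iN' : (1 <= i <= N)%N by rewrite i1 ltnW.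
have [B KB] := boundedfun_resolvent (boundedfun_indic n).
have mKB : forall y, 0 <= y <= 1 -> `|KI S n y| <= `|mean_inv_slope S n| * B.
  by move=> y y01; rewrite KIE// normrM ler_wpM2l//; exact: KB.
rewrite asumB; last 2 first.
- by apply: (summable_branch iN' (B := `|mean_inv_slope S n| * B)) => j Oj; apply/mKB/a_01.
- apply: (@summable_branch i.+1 _ (`|mean_inv_slope S n| * B)) => // j Oj.
  by apply/mKB/b_01.
have i0 : (i == 0%N) = false by case: i i1 {iN iN'}.
rewrite -(addr0 (mean_inv_slope S n * _)) -[0](mulr0 (mean_inv_slope S n)).
have -> : mean_inv_slope S n * jump i (resolvent \1_(I n)) =
   jump i (fun y => 0 + mean_inv_slope S n * resolvent \1_(I n) y).
  rewrite jump_lin//; first by rewrite jump0// add0r.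
  - by exists 0 => u _; rewrite normr0.
  - by exists B.
rewrite mulr0 addr0 /jump i0; congr (_ - _); apply: eq_asum => j Oj.
  by rewrite KIE ?a_01// add0r.
by rewrite KIE ?b_01// add0r.
Qed.

Hypothesis hs : nonzero_mean_inv_slope S.

Lemma sum_delta (g : nat -> R) a n : (a < n)%N ->
  \sum_(0 <= m < n) g m * (m == a)%:R = g a.
Proof.
move=> an; rewrite (bigD1_seq a)/= ?iota_uniq ?mem_index_iota//.
by rewrite eqxx mulr1 big1 ?addr0// => m /negPf ->; rewrite mulr0.
Qed.

(** Let [e n] be the pairing of [g] with the jumps of the resolvent of the
    indicator of piece [n]. The [n]-th equation of the system is
    [e n + g n - g n.-1 = 0] times the mean inverse slope of piece [n], and the
    [m']-th kernel equation says that [g m'] is the sum of [e n] over [n > m'].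
    The two are equivalent by telescoping from [g N = 0]. *)
Lemma left_kernelP (g : nat -> R) : g 0%N = 0 -> g N = 0 ->
  (forall n, (1 <= n <= N)%N -> \sum_(0 <= m < N) g m * mu S n m = 0) <->
  left_kernel g.
Proof.
move=> g0 gN; pose e n := \sum_(0 <= m < N) g m * jump m (resolvent \1_(I n)).
have eps n : (1 <= n <= N)%N ->
    \sum_(0 <= m < N) g m * epsilon S n m = mean_inv_slope S n * (g n - g n.-1).
  move=> /andP[n1 nN]; have n0 : (n.-1 < N)%N by rewrite prednK.
  have -> : \sum_(0 <= m < N) g m * epsilon S n m = mean_inv_slope S n *
      (\sum_(0 <= m < N) g m * (m == n)%:R - \sum_(0 <= m < N) g m * (m == n.-1)%:R).
    rewrite -sumrB mulr_sumr; apply: eq_bigr => m _; rewrite /epsilon.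
    case: (eqVneq n m) => [<-|nm].
      have -> : (n == n.-1) = false by rewrite gtn_eqF// prednK.
      by rewrite ?eqxx /=; ring.
    case: (eqVneq n m.+1) => [->|nm1] /=.
      by rewrite eqxx ?(ltn_eqF (ltnSn m)) /=; ring.
    rewrite ?(eq_sym m n) ?(negPf nm) (_ : (m == n.-1) = false) /=; first by ring.
    by apply/eqP => mn; move/eqP: nm1; rewrite mn prednK.
  rewrite (sum_delta g n0); congr (_ * (_ - _)).
  move: nN; rewrite leq_eqVlt => /predU1P[nN|/(sum_delta g)//].
  by rewrite nN gN big_nat big1// => m /andP[_ mN]; rewrite ltn_eqF// mulr0.
have h1 n : (1 <= n <= N)%N -> \sum_(0 <= m < N) g m * mu S n m =
    mean_inv_slope S n * (e n + g n - g n.-1).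
  move=> nN; rewrite -addrA mulrDr -eps// /e mulr_sumr -big_split/=.
  apply: eq_big_nat => -[_|m /andP[_ mN]]; first by rewrite g0 !mul0r mulr0 addr0.
  by rewrite muE//; ring.
have h2 m' : (m' < N)%N -> \sum_(0 <= m < N) g m * jump m (step_resolvent m') =
    \sum_(m'.+1 <= n < N.+1) e n.
  move=> m'N; pose c n : R := (m' < n)%N%:R.
  have cut (F : nat -> R) :
      \sum_(0 <= n < N.+1) c n * F n = \sum_(m'.+1 <= n < N.+1) F n.
    rewrite (@big_cat_nat _ _ _ m'.+1)//= ?ltnS ?(ltnW m'N)//.
    rewrite big_nat big1 ?add0r; last by move=> n /andP[_ nm]; rewrite /c ltnNge -ltnS nm mul0r.
    by apply: eq_big_nat => n /andP[mn _]; rewrite /c mn mul1r.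
  rewrite -cut (eq_big_nat _ _ (F2 := fun m => \sum_(0 <= n < N.+1)
      c n * (g m * jump m (resolvent \1_(I n))))).
    by rewrite exchange_big/=; apply: eq_bigr => n _; rewrite mulr_sumr.
  move=> m /andP[_ mN]; under [RHS]eq_bigr do rewrite mulrCA.
  rewrite -mulr_sumr -jump_sum//; last by move=> n; exact/boundedfun_resolvent/boundedfun_indic.
  congr (_ * _); apply: eq_jump => // y y01.
  rewrite -resolvent_sum//; last by move=> n; exact: boundedfun_indic.
  by apply: eq_resolvent => // u _; rewrite cut.
split=> [h m' m'N|h n nN].
  rewrite h2//; have en n : (1 <= n <= N)%N -> e n = g n.-1 - g n.
    move=> nN; have /eqP := h _ nN; rewrite h1// mulf_eq0.
    by have /eqP/negPf -> := hs nN; move=> /= /eqP ?; lra.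
  rewrite (eq_big_nat _ _ (F2 := fun n => g n.-1 - g n)).
    rewrite big_add1/= -[RHS]opprK -sumrN (eq_bigr (fun n => g n.+1 - g n)).
      by rewrite telescope_sumr ?(ltnW m'N)// gN; ring.
    by move=> n _; rewrite opprB.
  by move=> n /andP[m'n nN]; apply: en; rewrite (leq_ltn_trans _ m'n).
have gE m' : (m' <= N)%N -> g m' = \sum_(m'.+1 <= n < N.+1) e n.
  rewrite leq_eqVlt => /predU1P[->|m'N]; first by rewrite gN big_geq.
  by rewrite -h2//; exact: h.
rewrite h1//; case: n nN => // n nN; rewrite [g n.+1.-1]gE; last exact: ltnW.
by rewrite big_ltn ?ltnS// -gE//; ring.
Qed.

(** * The Koopman operator and primitives *)

Local Notation leb := (@lebesgue_measure R).
Definition open_piece (i : nat) : set (measurableTypeR R) := `]z i.-1, z i[.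

Lemma measurable_open_piece i : measurable (open_piece i).
Proof. exact: measurable_itv. Qed.

Definition branch_mean (i : nat) (f : R -> R) (x : R) : R :=
  asum Om (fun j => p j * f (k i j * x + d i j)).

(** The value 0 at the partition points, which form a null set, spares the choice
    of a branch there. *)
Definition koopman (f : R -> R) (x : R) : R :=
  \sum_(1 <= i < N.+1) \1_(open_piece i) x * branch_mean i f x.

Lemma measurable_unit_itv : measurable (`[0, 1]%classic : set (measurableTypeR R)).
Proof. by []. Qed.
Local Notation m01 := measurable_unit_itv.

Lemma unit_itv_lty : (leb `[0%R, 1%R]%classic < +oo)%E.
Proof. exact: (@lebesgue_itv_lty _ _ 0 1). Qed.

Lemma open_piece01 i : (1 <= i <= N)%N -> open_piece i `<=` `[0, 1].
Proof.
move=> /andP[i1 iN] x; rewrite /open_piece /= !in_itv/= => /andP[ix xi].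
have /andP[z0 _] := @zpt01 i.-1 (leq_trans (leq_pred _) iN).
by have /andP[_ z1] := zpt01 iN; rewrite (le_trans z0 (ltW ix)) (le_trans (ltW xi) z1).
Qed.

Lemma open_piece_piece i x : (1 <= i <= N)%N -> open_piece i x -> I i x.
Proof. by move=> iN; rewrite /open_piece /= in_itv/=; exact: itv_piece. Qed.

Lemma primitive0 f : primitive f 0 = 0 :> R.
Proof. by rewrite primitiveE// set_itv_ge ?Rintegral_set0// bnd_simp ltxx. Qed.

Lemma primitive_bounded f K : bounded_measurable f -> (forall x, `|f x| <= K) ->
  bounded01 (primitive f) K.
Proof.
move=> bf fK y /andP[y0 y1]; have K0 : 0 <= K by exact: le_trans (fK 0).
rewrite -[primitive f y]subr0 -(primitive0 f) primitiveB// ?lexx//.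
apply: (@le_trans _ _ (K * (y - 0))); first exact: normr_Rintegral_le.
by rewrite subr0 ler_piMr.
Qed.

Lemma asum_prob_bounded (u : nat -> R) K : (forall j, Om j -> `|u j| <= K) ->
  abs_summable Om (fun j => p j * u j) /\ `|asum Om (fun j => p j * u j)| <= K.
Proof.
move=> uK; have le j : Om j -> `|p j * u j| <= K * p j.
  by move=> Oj; rewrite normrM (gtr0_norm (prob_gt0 Oj)) mulrC ler_wpM2r ?uK// ltW// prob_gt0.
have sK : abs_summable Om (fun j => K * p j) by apply: abs_summableZ; exact: summable_prob.
split; first exact: le_abs_summable le sK.
apply: le_trans (ler_norm_asum sK le) _.
by rewrite asumZ ?asum_prob ?mulr1//; exact: summable_prob.
Qed.

Lemma branch_mean_bounded i f K : (forall x, `|f x| <= K) ->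
  forall x, `|branch_mean i f x| <= K.
Proof. by move=> fK x; apply: (asum_prob_bounded (K := K) _).2 => j _; exact: fK. Qed.

Lemma bounded_measurable_branch_mean i f : bounded_measurable f ->
  bounded_measurable (branch_mean i f).
Proof.
move=> [mf [K fK]].
apply: (@bounded_measurable_asum _ _ _ (fun j => K * p j)) => [j Oj|j x Oj|].
- by apply: measurable_funM => //; apply: measurableT_comp mf (measurable_affine _ _).
- by rewrite normrM (gtr0_norm (prob_gt0 Oj)) mulrC ler_wpM2r// ltW// prob_gt0.
- by apply: abs_summableZ; exact: summable_prob.
Qed.

Lemma koopmanE i f x : (1 <= i <= N)%N -> open_piece i x -> koopman f x = branch_mean i f x.
Proof.
move=> iN ix; rewrite /koopman (bigD1_seq i)/= ?mem_index_iota ?iota_uniq//.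
rewrite indicE mem_set// mul1r big_seq_cond big1 ?addr0// => i'.
rewrite mem_index_iota ltnS => /andP[i'N i'i].
rewrite indicE memNset ?mul0r// => i'x; move/eqP: i'i; apply.
by apply: (@piece_uniq i' i x) => //; exact: open_piece_piece.
Qed.

Lemma koopman_bounded f K : (forall x, `|f x| <= K) -> forall x, `|koopman f x| <= K.
Proof.
move=> fK x; have [[i iN ix]|nx] := pselect (exists2 i, (1 <= i <= N)%N & open_piece i x).
  by rewrite (koopmanE _ iN ix); exact: branch_mean_bounded.
rewrite /koopman big_nat big1 ?normr0 ?(le_trans _ (fK 0))// => i iN.
by rewrite indicE memNset ?mul0r// => ix; apply: nx; exists i.
Qed.

Lemma bounded_measurable_koopman f : bounded_measurable f -> bounded_measurable (koopman f).
Proof.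
move=> bf; split; last first.
  by case: bf => _ [K fK]; exists K; exact: koopman_bounded.
rewrite /koopman; apply: measurable_sum => i; apply: measurable_funM.
  exact: (bounded_measurable_indic (measurable_open_piece i)).1.
by case: (bounded_measurable_branch_mean i bf).
Qed.

Lemma integral_koopman (h f : R -> R) : leb.-integrable `[0, 1] (EFin \o h) ->
  bounded_measurable f ->
  \int[leb]_(x in `[0, 1]) (h x * koopman f x) =
  \sum_(1 <= i < N.+1) asum Om (fun j =>
    p j * \int[leb]_(x in open_piece i) (h x * f (k i j * x + d i j))).
Proof.
move=> hi bf; have [mf [K fK]] := bf.
rewrite (@eq_Rintegral _ _ _ _ _ (fun x : measurableTypeR R => \sum_(1 <= i < N.+1)
    (h x * (\1_(open_piece i) x * branch_mean i f x)))); last first.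
  by move=> x _; rewrite mulr_sumr.
have mi := measurable_open_piece.
rewrite (Rintegral_sum m01 _).2; last first.
  move=> i _; apply: integrable_mul_bounded => //; apply: bounded_measurableM.
    exact: bounded_measurable_indic.
  exact: bounded_measurable_branch_mean.
apply: eq_big_nat => i iN; have sub := open_piece01 iN.
under eq_Rintegral do rewrite mulrCA.
rewrite Rintegral_indic//.
have hii : leb.-integrable (open_piece i) (EFin \o h) by apply: integrableS hi.
rewrite /branch_mean (@Rintegral_mul_asum _ _ _ _ _ (fun j => K * p j))//.
- apply: eq_asum => j Oj; rewrite -RintegralZl//.
    by apply: eq_Rintegral => x _; rewrite mulrCA.
  apply: integrable_mul_bounded => //; split; last by exists K.
  exact: measurableT_comp mf (measurable_affine _ _).
- by move=> j Oj; apply: measurable_funM => //; apply: measurableT_comp mf (measurable_affine _ _).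
- by move=> j x Oj; rewrite normrM (gtr0_norm (prob_gt0 Oj)) mulrC ler_wpM2r// ltW// prob_gt0.
- by apply: abs_summableZ; exact: summable_prob.
Qed.

Lemma sum_jumpE f i : (0 < i)%N ->
  \sum_(0 <= m < i) jump m f = \sum_(1 <= n < i) (right_end n f - left_end n.-1 f) - left_end i.-1 f.
Proof.
case: i => // i _; elim: i => [|i ih]; first by rewrite big_nat1 big_geq// /jump/= sub0r add0r.
by rewrite big_nat_recr//= ih [in RHS]big_nat_recr//= /jump/=; ring.
Qed.

(** The change of variables given by the branch turns the integral over a piece
    into a difference of two values of [primitive f]. A piece left of [y]
    contributes the difference of its end values, and the piece of [y] the value at
    [y] minus its left end value; grouped by partition points, the end values are
    the jumps. *)
Lemma primitive_koopman f i y : bounded_measurable f -> (1 <= i <= N)%N -> I i y ->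
  primitive (koopman f) y =
  avg (primitive f) y + \sum_(0 <= m < i) jump m (primitive f).
Proof.
move=> bf iN iy; have [mf [K fK]] := bf.
have /andP[zy yz] := piece_itv iN iy.
have y01 := piece01 iN iy; have /andP[y0 y1] := y01.
have PK := primitive_bounded bf fK.
rewrite {1}/primitive integral_koopman//; last first.
  by apply: integrable_bounded => //; [exact: unit_itv_lty|exact: bounded_measurable_indic].
have zero n j : (i < n <= N)%N ->
    \int[leb]_(x in open_piece n) (\1_(`[0, y[) x * f (k n j * x + d n j)) = 0.
  move=> /andP[iln nN]; rewrite -[RHS](mul0r (fine (leb (open_piece n)))).
  rewrite -(Rintegral_cst _ (measurable_open_piece n)); apply: eq_Rintegral => x /set_mem.
  rewrite /open_piece /= in_itv/= => /andP[zx _].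
  rewrite indicE memNset ?mul0r//= in_itv/= => /andP[_]; apply/negP; rewrite -leNgt.
  apply: le_trans (ltW zx); apply: le_trans yz _; apply: zpt_le.
  apply/andP; split; last exact: leq_trans (leq_pred _) nN.
  by case: n iln {nN zx} => // n; rewrite ltnS.
have full n j v : (1 <= n <= N)%N -> Om j -> z n.-1 <= v <= z n ->
    (forall x, z n.-1 < x < z n -> (x < y) = (x < v)) -> 0 <= k n j * v + d n j <= 1 ->
    \int[leb]_(x in open_piece n) (\1_(`[0, y[) x * f (k n j * x + d n j)) =
    (k n j)^-1 * (primitive f (k n j * v + d n j) - primitive f (b_ S n.-1 j)).
  move=> nN Oj /andP[zv vz] yv kv; have /andP[n1 nN'] := nN.
  have nE : n.-1.+1 = n by rewrite prednK.
  have b01 : 0 <= k n j * z n.-1 + d n j <= 1.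
    by have := @b_01 n.-1 j; rewrite /b_ nE; apply.
  rewrite /b_ nE -integral_affine ?slope_neq0//.
  rewrite -(@Rintegral_indic _ `]z n.-1, v[ (open_piece n)); last first.
    by move=> x; rewrite /open_piece /= !in_itv/= => /andP[-> xv]; rewrite (lt_le_trans xv).
  apply: eq_Rintegral => x /set_mem xn; congr (_ * _); move: (xn).
  rewrite /open_piece /= in_itv/= => xz; have /andP[zx _] := xz.
  have x0 : 0 <= x by have := open_piece01 nN xn; rewrite /= in_itv/= => /andP[].
  rewrite !indicE; congr (nat_of_bool _)%:R.
  by apply/idP/idP => /set_mem; rewrite /= !in_itv/= => /andP[_ h]; apply/mem_set;
    rewrite /= in_itv/= ?zx ?x0/= ?yv// -yv.
have term n (v : nat -> R) : (1 <= n <= N)%N -> (forall j, Om j -> 0 <= v j <= 1) ->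
    asum Om (fun j => p j * ((k n j)^-1 * (primitive f (v j) - primitive f (b_ S n.-1 j)))) =
    asum Om (fun j => p j / k n j * primitive f (v j)) - left_end n.-1 (primitive f).
  move=> nN v01; have /andP[n1 nN'] := nN; have nE : n.-1.+1 = n by rewrite prednK.
  rewrite /left_end nE -asumB.
  - by apply: eq_asum => j _; ring.
  - by apply: (summable_branch nN (B := K)) => j Oj; exact/PK/v01.
  - apply: (summable_branch nN (B := K)) => j Oj; apply/PK/b_01 => //.
    by rewrite nE.
have left n : (1 <= n < i)%N -> asum Om (fun j =>
    p j * \int[leb]_(x in open_piece n) (\1_(`[0, y[) x * f (k n j * x + d n j))) =
    right_end n (primitive f) - left_end n.-1 (primitive f).
  move=> /andP[n1 ni]; have nN : (1 <= n <= N)%N.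
    by rewrite n1 (leq_trans (ltnW ni))//; case/andP: iN.
  rewrite /right_end -(term n (a_ S n))//; last by move=> j Oj; exact: a_01.
  apply: eq_asum => j Oj; congr (_ * _); apply: full => //; last exact: a_01.
    by rewrite lexx andbT zpt_le// leq_pred; case/andP: nN.
  move=> x /andP[_ xz]; rewrite xz (lt_le_trans xz)//; apply: le_trans zy.
  apply: zpt_le; apply/andP; split; last by apply: leq_trans (leq_pred _) _; case/andP: iN.
  by rewrite -ltnS prednK//; case/andP: iN.
rewrite (@big_cat_nat _ _ _ i.+1)//=; last by rewrite ltnS; case/andP: iN.
rewrite [X in _ + X]big_nat [X in _ + X]big1 ?addr0; last first.
  move=> n nN; rewrite -[RHS](@asum0 _ _ Om); apply: eq_asum => j Oj.
  by rewrite zero// mulr0.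
rewrite big_nat_recr//=; last by case/andP: iN.
rewrite (eq_big_nat _ _ left) sum_jumpE; last by case/andP: iN.
rewrite [RHS]addrCA; congr (_ + _).
rewrite (avgE _ iN iy).
rewrite -(term i (fun j => Tmap S j y))//; last by move=> j Oj; exact: Tmap01.
apply: eq_asum => j Oj; congr (_ * _); rewrite (Tmap_affine iN Oj iy).
by apply: full => //; [rewrite zy|rewrite -Tmap_affine//; exact: Tmap01].
Qed.

(** * Averages along the Koopman operator *)

Lemma primitive_lin (f g : R -> R) a y : bounded_measurable f -> bounded_measurable g ->
  primitive (fun x => f x + a * g x) y = primitive f y + a * primitive g y.
Proof.
move=> bf bg; have bi := bounded_measurable_indic (measurable_itv `[0, y[).
have int (u : R -> R) : bounded_measurable u ->
    leb.-integrable `[0, 1] (EFin \o (fun x => \1_(`[0, y[) x * u x)).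
  move=> bu; apply: integrable_bounded; [by []|exact: unit_itv_lty|exact: bounded_measurableM].
rewrite /primitive -RintegralZl//; last exact: int.
rewrite -RintegralD//; [|exact: int|].
  by apply: eq_Rintegral => x _; ring.
rewrite (_ : EFin \o _ = EFin \o (fun x => \1_(`[0, y[) x * (0 + a * g x))).
  by apply: int; apply: bounded_measurableD => //; exact: bounded_measurable_cst.
by apply/funext => x /=; congr EFin; ring.
Qed.

Definition linear_functional (L : (R -> R) -> R) := forall f g a,
  bounded_measurable f -> bounded_measurable g ->
  L (fun x => f x + a * g x) = L f + a * L g.

Definition koopman_invariant (L : (R -> R) -> R) := forall f,
  bounded_measurable f -> L (koopman f) = L f.

(** Continuity at 0 for uniform convergence of primitives on bounded sets of
    functions. *)
Definition primitive_continuous (L : (R -> R) -> R) := forall K eta, 0 <= K -> 0 < eta ->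
  exists2 delta, 0 < delta & forall f, bounded_measurable f -> (forall x, `|f x| <= K) ->
    bounded01 (primitive f) delta -> `|L f| <= eta.

Lemma linear_functional_sum L (J : Type) (s : seq J) (a : J -> R) (F : J -> R -> R) :
  linear_functional L -> (forall i, bounded_measurable (F i)) ->
  bounded_measurable (fun x => \sum_(i <- s) a i * F i x) /\
  L (fun x => \sum_(i <- s) a i * F i x) = \sum_(i <- s) a i * L (F i).
Proof.
move=> linL bF; elim: s => [|i s [ihb ih]].
  have -> : (fun x : R => \sum_(i <- [::]) a i * F i x) = fun=> 0.
    by apply/funext => x; rewrite big_nil.
  have b0 : bounded_measurable (fun=> 0 : R) by exact: bounded_measurable_cst.
  rewrite big_nil; split => //; have := linL _ _ (-1) b0 b0.
  by rewrite (_ : (fun x => 0 + -1 * 0) = (fun=> 0)) ?mulN1r ?subrr//; apply/funext => x; ring.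
have -> : (fun x : R => \sum_(j <- i :: s) a j * F j x) =
    fun x => \sum_(j <- s) a j * F j x + a i * F i x.
  by apply/funext => x; rewrite big_cons addrC.
by rewrite big_cons addrC -ih -linL//; split => //; exact: bounded_measurableD.
Qed.

Lemma linear_functional_primitive y : linear_functional (fun f : R -> R => primitive f y).
Proof. by move=> f g a bf bg; exact: primitive_lin. Qed.

Lemma avg_sumZ n (c : nat -> R) (F : nat -> R -> R) y : (forall m, boundedfun (F m)) ->
  0 <= y <= 1 ->
  avg (fun y => \sum_(0 <= m < n) c m * F m y) y = \sum_(0 <= m < n) c m * avg (F m) y.
Proof.
move=> Fb y01; elim: n => [|n ih].
  rewrite big_geq// /avg -[RHS](@asum0 _ _ Om).
  by apply: eq_asum => j _; rewrite big_geq// mulr0.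
rewrite [RHS]big_nat_recr//= -ih.
have [[B sB] [B' FB]] := (boundedfun_sum n c Fb, Fb n).
rewrite -(avg_lin _ sB FB)//.
by apply: eq_avg => // u _; rewrite big_nat_recr.
Qed.

Lemma bounded_measurable_iter_koopman f t : bounded_measurable f -> bounded_measurable (iter t koopman f).
Proof. by move=> bf; elim: t => //= t; exact: bounded_measurable_koopman. Qed.

Lemma iter_koopman_le f t K : (forall x, `|f x| <= K) ->
  forall x, `|iter t koopman f x| <= K.
Proof. by move=> fK; elim: t => //= t; exact: koopman_bounded. Qed.

Definition cesaro (n : nat) (f : R -> R) (x : R) : R :=
  \sum_(0 <= t < n.+1) n.+1%:R^-1 * iter t koopman f x.

Lemma sum_inv n (K : R) : \sum_(0 <= t < n.+1) n.+1%:R^-1 * K = K.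
Proof.
by rewrite big_const_nat subn0 iter_addr addr0 -[_ *+ _]mulr_natl mulrA divff ?mul1r// pnatr_eq0.
Qed.

Lemma cesaro_le n f K : (forall x, `|f x| <= K) -> forall x, `|cesaro n f x| <= K.
Proof.
move=> fK x; rewrite -[leRHS](sum_inv n); apply: le_trans (ler_norm_sum _ _ _) _.
by apply: ler_sum => t _; rewrite normrM gtr0_norm// ler_wpM2l// iter_koopman_le.
Qed.

Lemma bounded_measurable_cesaro n f : bounded_measurable f -> bounded_measurable (cesaro n f).
Proof.
move=> bf; by have [] := @linear_functional_sum _ nat (index_iota 0 n.+1)
  (fun=> n.+1%:R^-1) (fun t => iter t koopman f) (linear_functional_primitive 0)
  (fun t => bounded_measurable_iter_koopman t bf).
Qed.

Lemma cesaro_invariant L n f : linear_functional L ->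
  koopman_invariant L ->
  bounded_measurable f -> L (cesaro n f) = L f.
Proof.
move=> linL invL bf.
have := @linear_functional_sum L nat (index_iota 0 n.+1)
  (fun=> n.+1%:R^-1) (fun t => iter t koopman f) linL.
move=> /(_ (fun t => bounded_measurable_iter_koopman t bf))[_ ->].
rewrite -[RHS](sum_inv n); apply: eq_bigr => t _; congr (_ * _).
by elim: t => //= t <-; rewrite invL//; exact: bounded_measurable_iter_koopman.
Qed.

Lemma primitive_koopman_step f y : bounded_measurable f -> 0 <= y <= 1 ->
  primitive (koopman f) y =
  avg (primitive f) y + \sum_(0 <= m < N) jump m (primitive f) * step m y.
Proof.
move=> bf y01; have [i iN iy] := exists_piece y01.
by rewrite (primitive_koopman bf iN iy) (sum_stepE _ iN iy).
Qed.

(** The primitive of the telescoped sum [cesaro n f - koopman (cesaro n f)]. *)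
Definition cesaro_error (n : nat) (f : R -> R) (y : R) : R :=
  n.+1%:R^-1 * (primitive f y - primitive (iter n.+1 koopman f) y).

Lemma cesaro_error_bounded n f K : bounded_measurable f -> (forall x, `|f x| <= K) ->
  bounded01 (cesaro_error n f) (n.+1%:R^-1 * (K + K)).
Proof.
move=> bf fK y y01; rewrite /cesaro_error normrM gtr0_norm//; apply: ler_wpM2l => //.
apply: le_trans (ler_normB _ _) _; apply: lerD.
  exact: primitive_bounded fK _ y01.
apply: primitive_bounded y01; first exact: bounded_measurable_iter_koopman.
exact: iter_koopman_le.
Qed.

(** Averaging [primitive_koopman_step] over the iterates shows that the primitive
    [P] of the mean solves [P = avg P + cesaro_error n f] plus the sum of
    [jump m P * step m]; apply the resolvent. *)
Lemma primitive_cesaro n f y : bounded_measurable f -> 0 <= y <= 1 ->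
  primitive (cesaro n f) y = resolvent (cesaro_error n f) y +
    \sum_(0 <= m < N) jump m (primitive (cesaro n f)) * step_resolvent m y.
Proof.
move=> bf y01; have [_ [K fK]] := bf.
pose Pt t := primitive (iter t koopman f).
have Pb t : boundedfun (Pt t).
  exists K; apply: primitive_bounded; first exact: bounded_measurable_iter_koopman.
  exact: iter_koopman_le.
have RE x : primitive (cesaro n f) x = \sum_(0 <= t < n.+1) n.+1%:R^-1 * Pt t x.
  by have [] := @linear_functional_sum _ nat (index_iota 0 n.+1)
    (fun=> n.+1%:R^-1) (fun t => iter t koopman f) (linear_functional_primitive x)
    (fun t => bounded_measurable_iter_koopman t bf).
have Rb : boundedfun (primitive (cesaro n f)).
  exists K; apply: primitive_bounded; first exact: bounded_measurable_cesaro.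
  exact: cesaro_le.
have [B RB] := Rb.
have eb := cesaro_error_bounded n bf fK.
have [B' JB] := boundedfun_sum N (jump^~ (primitive (cesaro n f))) boundedfun_step.
rewrite -(resolvent_sum _ _ boundedfun_step)// -[X in _ + X]mul1r -(resolvent_lin _ eb JB)//.
apply: (resolvent_unique (bounded01_lin _ eb JB) RB) y01 => x x01.
have jE m : (m < N)%N -> jump m (primitive (cesaro n f)) =
    \sum_(0 <= t < n.+1) n.+1%:R^-1 * jump m (Pt t).
  by move=> mN; rewrite -jump_sum//; apply: eq_jump.
rewrite mul1r (eq_big_nat _ _ (F2 := fun m =>
    \sum_(0 <= t < n.+1) n.+1%:R^-1 * (jump m (Pt t) * step m x))); last first.
  by move=> m /andP[_ mN]; rewrite jE// mulr_suml; apply: eq_bigr => t _; rewrite mulrA.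
rewrite exchange_big/= -addrA.
have -> : avg (primitive (cesaro n f)) x = \sum_(0 <= t < n.+1) n.+1%:R^-1 * avg (Pt t) x.
  by rewrite -avg_sumZ//; apply: eq_avg.
rewrite -big_split/= (eq_bigr (fun t => n.+1%:R^-1 * Pt t.+1 x)); last first.
  move=> t _; rewrite /Pt iterS primitive_koopman_step//; last exact: bounded_measurable_iter_koopman.
  by rewrite mulrDr addrC; congr (_ + _); rewrite mulr_sumr.
rewrite RE [LHS]big_nat_recl//= [in RHS]big_nat_recr//= /cesaro_error /Pt /=; ring.
Qed.

(** * Limits of the averages along an ultrafilter *)

Lemma cvg_sumr (U : set_system nat) (FU : Filter U) (J : Type) (s : seq J) (u : J -> nat -> R) (l : J -> R) :
  (forall i, u i n @[n --> U] --> l i) ->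
  \sum_(i <- s) u i n @[n --> U] --> \sum_(i <- s) l i.
Proof.
move=> ul; elim: s => [|i s ih].
  by under eq_fun do rewrite big_nil; rewrite big_nil; exact: cvg_cst.
by under eq_fun do rewrite big_cons; rewrite big_cons; exact: cvgD.
Qed.

Section UltrafilterLimits.
Variables (U : set_system nat) (ultraU : UltraFilter U) (subU : \oo `<=` U).

Lemma ultra_cvg (c : nat -> R) (l : R) : c n @[n --> \oo] --> l -> c n @[n --> U] --> l.
Proof. by move=> cl P /cl; exact: subU. Qed.

Definition ulim (c : nat -> R) : R := lim (c n @[n --> U]).

(** The image of an ultrafilter is an ultrafilter, and closed bounded intervals are
    compact. *)
Lemma ulim_cvg (c : nat -> R) K : (forall n, `|c n| <= K) -> c n @[n --> U] --> ulim c.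
Proof.
move=> cK.
have ultrac : UltraFilter (c n @[n --> U]).
  split; first exact: fmap_proper_filter.
  move=> G PG UG; apply/seteqP; split => // A GA.
  have [//|nA] := in_ultra_setVsetC (c @^-1` A) ultraU.
  have FG : Filter G by exact: filter_filter.
  have GnA : G (~` A) by exact: UG.
  have := @filterI _ _ FG _ _ GA GnA; rewrite setICr => G0.
  exfalso; exact: (@filter_not_empty _ _ PG G0).
have := @segment_compact R (- K) K; rewrite compact_ultra => /(_ _ ultrac)[].
  suff : U (c @^-1` `[- K, K]) by [].
  by apply: filterS filterT => n _ /=; rewrite in_itv/= -ler_norml; exact: cK.
by move=> l [_ cl]; exact: (cvgP _ cl).
Qed.

(** The limit is taken along one fixed ultrafilter so that it exists for all
    functions at once and respects linear relations. *)
Definition limvec (f : R -> R) : 'cV[R]_N :=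
  \col_m ulim (fun n => jump m (primitive (cesaro n f))).

Definition kernel_matrix : 'M[R]_N :=
  1%:M - \matrix_(m' < N, m < N) jump m' (step_resolvent m).

Lemma limvec_cvg f (m : 'I_N) : bounded_measurable f ->
  jump m (primitive (cesaro n f)) @[n --> U] --> limvec f m 0.
Proof.
move=> bf; rewrite mxE; have [_ [K fK]] := bf.
apply: (@ulim_cvg _ (2 * K)) => n; apply: jump_bounded => //.
apply: primitive_bounded; first exact: bounded_measurable_cesaro.
exact: cesaro_le.
Qed.

Lemma inv_succ_cvg0 (K : R) : n.+1%:R^-1 * K @[n --> \oo] --> (0 : R).
Proof.
rewrite -[X in _ --> X](mul0r K); apply: cvgMl; exact: cvg_harmonic.
Qed.

Lemma limvec_kernel f : bounded_measurable f -> kernel_matrix *m limvec f = 0.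
Proof.
move=> bf; have [_ [K fK]] := bf.
apply/colP => m'; rewrite mulmxBl mul1mx !mxE.
pose s n := jump m' (primitive (cesaro n f)) -
  \sum_(m < N) jump m' (step_resolvent m) * jump m (primitive (cesaro n f)).
have sl : s n @[n --> U] --> (ulim (fun n => jump m' (primitive (cesaro n f))) -
    \sum_(m < N) (\matrix_(i < N, j < N) jump i (step_resolvent j)) m' m * limvec f m 0).
  apply: cvgB; first by have := @limvec_cvg f m' bf; rewrite mxE.
  by apply: (cvg_sumr _) => m; rewrite mxE; apply: cvgMr; exact: limvec_cvg.
apply: (cvg_unique _ sl) => //; apply: ultra_cvg.
have sE n : s n = jump m' (resolvent (cesaro_error n f)).
  have eb := cesaro_error_bounded n bf fK.
  have rb := boundedfun_resolvent (ex_intro _ _ eb).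
  have sb := boundedfun_sum N (jump^~ (primitive (cesaro n f))) boundedfun_step_resolvent.
  rewrite /s; have -> : jump m' (primitive (cesaro n f)) = jump m' (fun y => resolvent (cesaro_error n f) y +
      1 * \sum_(0 <= m < N) jump m (primitive (cesaro n f)) * step_resolvent m y).
    by apply: eq_jump => // y y01; rewrite mul1r primitive_cesaro.
  rewrite jump_lin// jump_sum//; last exact: boundedfun_step_resolvent.
  rewrite big_mkord mul1r; under [X in _ - X]eq_bigr do rewrite mulrC.
  by rewrite addrK.
have sB n : `|s n| <= n.+1%:R^-1 * (2 * ((K + K) / (1 - ratio))).
  rewrite sE; apply: le_trans (jump_bounded _ _) _ => //.
    exact: resolvent_bounded (cesaro_error_bounded n bf fK).
  by rewrite -mulrA mulrCA.
apply: norm_cvg0; apply: (squeeze_cvgr _ (cvg_cst 0) (inv_succ_cvg0 _)).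
by apply: nearW => n; rewrite normr_ge0/=; exact: sB.
Qed.

(** If a combination of limit vectors vanishes, the same combination of Cesaro
    means has primitives that become uniformly small along the ultrafilter: their
    components on the functions [step_resolvent m] tend to 0 by assumption and the
    errors tend to 0 like [1/n]. The value of [L] does not depend on [n], so it
    is 0. *)
Lemma compatible_functional L : linear_functional L ->
  koopman_invariant L ->
  primitive_continuous L ->
  compatible (fun f : {f : R -> R | bounded_measurable f} => limvec (proj1_sig f))
    (fun f => L (proj1_sig f)).
Proof.
move=> linL invL contL q ys a va0.
pose F i := proj1_sig (ys i); have bF i : bounded_measurable (F i) by exact: proj2_sig (ys i).
have /choice[K FK] : forall i, exists K, forall x, `|F i x| <= K.
  by move=> i; case: (bF i).
have K0 i : 0 <= K i by exact: le_trans (FK i 0).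
pose S0 n x := \sum_i a i * cesaro n (F i) x.
have bC n i : bounded_measurable (cesaro n (F i)) by exact: bounded_measurable_cesaro.
have SL n : bounded_measurable (S0 n) /\ L (S0 n) = \sum_i a i * L (F i).
  have [bS ->] := linear_functional_sum (index_enum 'I_q) a linL (bC n).
  by split => //; apply: eq_bigr => i _; rewrite cesaro_invariant.
pose KS := \sum_i `|a i| * K i.
have SK n x : `|S0 n x| <= KS.
  apply: le_trans (ler_norm_sum _ _ _) _; apply: ler_sum => i _.
  by rewrite normrM ler_wpM2l// cesaro_le.
have KS0 : 0 <= KS by apply: sumr_ge0 => i _; rewrite mulr_ge0.
have r1 : 0 < 1 - ratio by rewrite subr_gt0; case/andP: ratio01.
pose bnd n := \sum_i `|a i| * (n.+1%:R^-1 * ((K i + K i) / (1 - ratio))) +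
  \sum_(m < N) `|\sum_i a i * jump m (primitive (cesaro n (F i)))| * (1 / (1 - ratio)).
have Sb n : bounded01 (primitive (S0 n)) (bnd n).
  move=> y y01.
  have [_ ->] := linear_functional_sum (index_enum 'I_q) a (linear_functional_primitive y) (bC n).
  rewrite (eq_bigr (fun i => a i * resolvent (cesaro_error n (F i)) y +
      \sum_(m < N) a i * jump m (primitive (cesaro n (F i))) * step_resolvent m y)); last first.
    move=> i _; rewrite primitive_cesaro// mulrDr big_mkord mulr_sumr.
    by congr (_ + _); apply: eq_bigr => m _; rewrite mulrA.
  rewrite big_split/= exchange_big/=; apply: le_trans (ler_normD _ _) _; apply: lerD.
    apply: le_trans (ler_norm_sum _ _ _) _; apply: ler_sum => i _.
    rewrite normrM ler_wpM2l//.
    have := resolvent_bounded (cesaro_error_bounded n (bF i) (FK i)) y01.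
    by rewrite -mulrA.
  apply: le_trans (ler_norm_sum _ _ _) _; apply: ler_sum => m _.
  rewrite -mulr_suml normrM ler_wpM2l//.
  exact: resolvent_bounded (step_bounded m) _ y01.
have bnd0 : bnd n @[n --> U] --> 0.
  rewrite -[X in _ --> X]addr0; apply: cvgD.
    rewrite [X in _ --> X](_ : 0 = \sum_(i < q) (0 : R)); last by rewrite big1.
    apply: (cvg_sumr _) => i; rewrite -(mulr0 `|a i|); apply: cvgMr.
    by apply: ultra_cvg; exact: inv_succ_cvg0.
  rewrite [X in _ --> X](_ : 0 = \sum_(m < N) (0 : R)); last by rewrite big1.
  apply: (cvg_sumr _) => m; rewrite -[X in _ --> X](mul0r (1 / (1 - ratio))); apply: cvgMl.
  rewrite -[X in _ --> X](normr0 R); apply: cvg_norm.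
  rewrite [X in _ --> X](_ : 0 = \sum_i a i * limvec (F i) m 0); last first.
    have /colP/(_ m) := va0; rewrite [RHS]mxE summxE => h; rewrite -[LHS]h.
    by apply: eq_bigr => i _; rewrite !mxE.
  by apply: (cvg_sumr _) => i; apply: cvgMr; exact: limvec_cvg.
apply/eqP; rewrite -normr_le0; apply/ler_addgt0Pl => eta eta0; rewrite addr0.
have [delta delta0 hd] := contL KS eta KS0 eta0.
have /cvgr0_norm_le /(_ delta delta0) hU := bnd0.
have [n hn] := @filter_ex _ U _ _ hU.
have [bS <-] := SL n; apply: hd => // y y01.
by apply: le_trans (Sb n y y01) _; apply: le_trans hn; exact: ler_norm.
Qed.

End UltrafilterLimits.

(** * The functionals attached to the left kernel *)

Lemma boundedfun_primitive f : bounded_measurable f -> boundedfun (primitive f).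
Proof. by move=> bf; have [_ [K fK]] := bf; exists K; exact: primitive_bounded. Qed.

Definition kernel_functional (g : nat -> R) (f : R -> R) : R :=
  \sum_(0 <= m < N) g m * jump m (resolvent (primitive f)).

Lemma kernel_functional_linear g : linear_functional (kernel_functional g).
Proof.
move=> f f' a bf bf'; rewrite /kernel_functional mulr_sumr -big_split/=.
have [B PB] := boundedfun_primitive bf; have [B' PB'] := boundedfun_primitive bf'.
have br : boundedfun (resolvent (primitive f)) by apply: boundedfun_resolvent; exists B.
have br' : boundedfun (resolvent (primitive f')) by apply: boundedfun_resolvent; exists B'.
have rE y : 0 <= y <= 1 -> resolvent (primitive (fun x => f x + a * f' x)) y =
    resolvent (primitive f) y + a * resolvent (primitive f') y.
  move=> y01; rewrite -(resolvent_lin _ PB PB' y01).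
  by apply: eq_resolvent y01 => x _; exact: primitive_lin.
apply: eq_big_nat => m /andP[_ mN].
by rewrite (eq_jump mN rE) (jump_lin _ mN br br') mulrDr (mulrCA a).
Qed.

Lemma resolvent_avg f B y : bounded01 f B -> 0 <= y <= 1 ->
  resolvent (avg f) y = resolvent f y - f y.
Proof.
move=> fB y01; have rB := resolvent_bounded fB; symmetry.
have bd : bounded01 (fun x => resolvent f x - f x) (B / (1 - ratio) + B).
  by move=> x x01; rewrite (le_trans (ler_normB _ _))// lerD ?rB ?fB.
apply: (resolvent_unique (avg_bounded fB) bd) y01 => x x01.
have -> : avg (fun x => resolvent f x - f x) x = avg (fun x => resolvent f x + -1 * f x) x.
  by apply: eq_avg => // u _; rewrite mulN1r.
rewrite (avg_lin _ rB fB)// {1}(resolventE fB x01); ring.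
Qed.

(** The resolvent of [primitive_koopman_step] expresses the resolvent of
    [primitive (koopman f)] by that of [primitive f], by [primitive f] itself and by
    the functions [step_resolvent m]. After pairing with [g], the kernel equations
    cancel the last two contributions. *)
Lemma kernel_functional_invariant g : left_kernel g ->
  koopman_invariant (kernel_functional g).
Proof.
move=> gk f bf; have [B PB] := boundedfun_primitive bf.
have bP : boundedfun (primitive f) by exists B.
have aB := avg_bounded PB.
have [B' SB] := boundedfun_sum N (jump^~ (primitive f)) boundedfun_step.
have rE y : 0 <= y <= 1 -> resolvent (primitive (koopman f)) y =
    (resolvent (primitive f) y + -1 * primitive f y) +
    1 * \sum_(0 <= m < N) jump m (primitive f) * step_resolvent m y.
  move=> y01; rewrite (@eq_resolvent _ (fun y => avg (primitive f) y +
      1 * \sum_(0 <= m < N) jump m (primitive f) * step m y))//; last first.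
    by move=> u u01; rewrite mul1r primitive_koopman_step.
  rewrite (resolvent_lin _ aB SB)// (resolvent_avg PB)// resolvent_sum//; last exact: boundedfun_step.
  by rewrite mulN1r.
have br := boundedfun_resolvent bP.
have be := boundedfun_sum N (jump^~ (primitive f)) boundedfun_step_resolvent.
transitivity (\sum_(0 <= m < N) (g m * jump m (resolvent (primitive f)) +
    (- (g m * jump m (primitive f)) +
    \sum_(0 <= i < N) jump i (primitive f) * (g m * jump m (step_resolvent i))))).
  apply: eq_big_nat => m /andP[_ mN]; rewrite (eq_jump mN rE).
  rewrite (jump_lin _ mN (boundedfun_lin _ br bP) be) (jump_lin _ mN br bP).
  rewrite (jump_sum _ _ mN boundedfun_step_resolvent).
  under [X in _ = _ + (_ + X)]eq_bigr do rewrite mulrCA.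
  by rewrite -mulr_sumr mul1r mulN1r mulrDr mulrBr addrA.
rewrite !big_split/= exchange_big/= sumrN.
rewrite [X in _ + (_ + X)](eq_big_nat _ _ (F2 := fun i => g i * jump i (primitive f))).
  by rewrite addNr addr0.
by move=> i /andP[_ iN]; rewrite -mulr_sumr mulrC -gk.
Qed.

Lemma kernel_functional_continuous g : primitive_continuous (kernel_functional g).
Proof.
move=> K eta _ eta0; have r1 : 0 < 1 - ratio by rewrite subr_gt0; case/andP: ratio01.
pose G := \sum_(0 <= m < N) `|g m|; have G0 : 0 <= G by exact: sumr_ge0.
have G1 : 0 < 2 * G + 1 by rewrite ltr_wpDl// mulr_ge0.
exists (eta * (1 - ratio) / (2 * G + 1)); first by rewrite divr_gt0// mulr_gt0.
move=> f _ _ fd; rewrite /kernel_functional.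
apply: (@le_trans _ _ (G * (2 * (eta / (2 * G + 1))))).
  rewrite /G mulr_suml; apply: le_trans (ler_norm_sum _ _ _) _.
  rewrite big_nat [leRHS]big_nat; apply: ler_sum => m /andP[_ mN].
  rewrite normrM ler_wpM2l//; have := jump_bounded mN (resolvent_bounded fd).
  by rewrite [eta * _ / _]mulrAC mulfK// gt_eqF.
rewrite !mulrA [G * 2]mulrC ler_pdivrMr// [leRHS]mulrC.
by apply: ler_wpM2r; [exact: ltW|rewrite lerDl].
Qed.

(** * Test functions whose primitives approximate steps *)

Definition bump (s : R) (n : nat) : R -> R :=
  fun x => n.+1%:R * \1_(`[s, s + n.+1%:R^-1[) x.

Lemma bounded_measurable_bump s n : bounded_measurable (bump s n).
Proof.
by apply: bounded_measurableM; [exact: bounded_measurable_cst|exact: bounded_measurable_indic].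
Qed.

Lemma primitive_bump s n y : y <= 1 ->
  primitive (bump s n) y = n.+1%:R * fine (leb (`[s, s + n.+1%:R^-1[ `&` `[0, y[)).
Proof.
move=> y1; rewrite primitiveE// /bump RintegralZl//.
  by rewrite /Rintegral integral_indic.
apply: integrable_bounded => //; last exact: bounded_measurable_indic.
apply: (@lebesgue_itv_lty _ _ 0 1) => x; rewrite /= !in_itv/= => /andP[-> xy].
exact: le_trans (ltW xy) y1.
Qed.

Lemma leb_bump s n : leb `[s, s + n.+1%:R^-1[%classic = (n.+1%:R^-1)%:E.
Proof.
by rewrite lebesgue_measure_itv/= lte_fin ltrDl invr_gt0 ltr0n -EFinB addrAC subrr add0r.
Qed.

Lemma primitive_bump_bounded s n : bounded01 (primitive (bump s n)) 1.
Proof.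
move=> y /andP[_ y1]; rewrite primitive_bump// normrM ger0_norm//.
rewrite ger0_norm ?fine_ge0//.
rewrite -ler_pdivlMl// mulr1 -lee_fin -(leb_bump s) fineK.
  by apply: le_measure; [rewrite inE; exact: measurableI|rewrite inE|exact: subIsetl].
rewrite ge0_fin_numE//; apply: le_lt_trans (ltry (n.+1%:R^-1 : R)).
by rewrite -(leb_bump s); apply: le_measure; [rewrite inE; exact: measurableI|rewrite inE|exact: subIsetl].
Qed.

Lemma primitive_bump_left s n y : y <= 1 -> y <= s -> primitive (bump s n) y = 0.
Proof.
move=> y1 ys; rewrite primitive_bump// (_ : _ `&` _ = set0) ?measure0 ?mulr0//.
apply/seteqP; split => // x [/=]; rewrite !in_itv/= => /andP[sx _] /andP[_ xy].
by have := lt_le_trans xy (le_trans ys sx); rewrite ltxx.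
Qed.

Lemma primitive_bump_right s n y : y <= 1 -> 0 <= s -> s + n.+1%:R^-1 <= y ->
  primitive (bump s n) y = 1.
Proof.
move=> y1 s0 sy; rewrite primitive_bump// setIidl ?leb_bump/= ?divff ?pnatr_eq0//.
move=> x; rewrite /= !in_itv/= => /andP[sx xs].
by rewrite (le_trans s0 sx) (lt_le_trans xs).
Qed.

(** The primitive of a narrow bump next to [zpt S m] climbs from 0 to 1. To have
    the value of [step m] in the limit at [zpt S m] itself, the bump is placed to
    the left of that point if [step m] is 1 there, and to the right otherwise. *)
Lemma step_approx m : (0 < m < N)%N -> exists s : nat -> R, forall y, 0 <= y <= 1 ->
  primitive (bump (s n) n) y @[n --> \oo] --> step m y.
Proof.
move=> /andP[m0 mN]; have zm01 := zpt01 (ltnW mN); have /andP[zm0 zm1] := zm01.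
have zpos : 0 < z m.
  rewrite -zpt0; apply: (@lt_le_trans _ _ (z 1%N)); first exact/zpt_lt/(ltn_trans m0).
  by apply: zpt_le; rewrite m0 ltnW.
pose sg : R := step m (z m).
have sg01 : sg = 0 \/ sg = 1.
  have [i iN iz] := exists_piece zm01; rewrite /sg (stepE _ iN iz).
  by case: (_ < _)%N; [right|left].
have above y : 0 <= y <= 1 -> z m < y -> step m y = 1.
  move=> y01 zy; have [i iN iy] := exists_piece y01; rewrite (stepE _ iN iy).
  have /andP[_ yz] := piece_itv iN iy; case: ltnP => // im.
  have imN : (i <= m <= N)%N by rewrite im ltnW.
  by have := lt_le_trans zy (le_trans yz (zpt_le imN)); rewrite ltxx.
have below y : 0 <= y <= 1 -> y < z m -> step m y = 0.
  move=> y01 zy; have [i iN iy] := exists_piece y01; rewrite (stepE _ iN iy).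
  have /andP[yz _] := piece_itv iN iy; case: ltnP => // im.
  have miN : (m <= i.-1 <= N)%N.
    have /andP[i1 iN'] := iN; rewrite (leq_trans (leq_pred _) iN') andbT.
    by rewrite -ltnS prednK.
  by have := le_lt_trans (le_trans (zpt_le miN) yz) zy; rewrite ltxx.
exists (fun n => z m - sg * n.+1%:R^-1) => y y01; have /andP[y0 y1] := y01.
have s0 n : n.+1%:R^-1 < z m -> 0 <= z m - sg * n.+1%:R^-1.
  by move=> nz; case: sg01 => ->; [rewrite mul0r subr0|rewrite mul1r subr_ge0 ltW].
have t0 n : 0 < n.+1%:R^-1 :> R by rewrite invr_gt0.
suff : \forall n \near \oo, primitive (bump (z m - sg * n.+1%:R^-1) n) y = step m y.
  move=> h; apply: (@cvg_trans _ ((fun=> step m y) @ \oo)); last exact: cvg_cst.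
  by apply: near_eq_cvg; apply: filterS h => n ->.
have nearz : \forall n \near \oo, n.+1%:R^-1 < z m :> R.
  exact: (near_infty_natSinv_lt (PosNum zpos)).
case: (ltgtP y (z m)) => [yz|zy|yE].
- have d0 : 0 < z m - y by rewrite subr_gt0.
  apply: filterS (near_infty_natSinv_lt (PosNum d0)) => n /= nd.
  rewrite below// primitive_bump_left//; move: nd (t0 n).
  move: (n.+1%:R^-1 : R) => e ez e0.
  by case: sg01 => ->; rewrite ?mul0r ?mul1r; lra.
- have d0 : 0 < y - z m by rewrite subr_gt0.
  apply: filterS2 nearz (near_infty_natSinv_lt (PosNum d0)) => n nz /= nd.
  rewrite above// primitive_bump_right//; first exact: s0.
  move: nd (t0 n); move: (n.+1%:R^-1 : R) => e ez e0.
  by case: sg01 => ->; rewrite ?mul0r ?mul1r; lra.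
- apply: filterS nearz => n nz; rewrite yE -/sg.
  case: sg01 (s0 n nz) => ->; rewrite ?mul0r ?mul1r => s0'.
    by rewrite primitive_bump_left// subr0.
  by rewrite primitive_bump_right// subrK.
Qed.

(** On bumps whose primitives tend to [step m], the functional tends to the pairing
    of [g] with the jumps of [step_resolvent m], which is [g m]. *)
Lemma kernel_functional_inj g : left_kernel g ->
  (forall f, bounded_measurable f -> kernel_functional g f = 0) ->
  forall m, (m < N)%N -> g m = 0.
Proof.
move=> gk g0 m mN; have [->|m0] := eqVneq m 0%N; first exact: left_kernel_head.
have mN' : (0 < m < N)%N by rewrite lt0n m0.
have [s ss] := step_approx mN'.
have h : kernel_functional g (bump (s n) n) @[n --> \oo] -->
    \sum_(0 <= i < N) g i * jump i (step_resolvent m).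
  rewrite /kernel_functional big_mkord; under eq_fun do rewrite big_mkord.
  apply: (cvg_sumr _) => i; apply: cvgMr.
  apply: (jump_cvg (B := 1 / (1 - ratio))) => // [n|].
    exact/resolvent_bounded/primitive_bump_bounded.
  by apply: (resolvent_cvg (B := 1)) ss => n; exact: primitive_bump_bounded.
rewrite gk//; apply: (cvg_unique _ h) => //.
rewrite (_ : (fun n => _) = fun=> 0); first exact: cvg_cst.
by apply/funext => n; rewrite g0//; exact: bounded_measurable_bump.
Qed.

(** * The representation of invariant functionals *)

(** Both [L] and the functionals of the left kernel factor through the limit
    vectors, which lie in the right kernel; [compatible_left_kernel] compares
    dimensions. *)
Lemma representation L : linear_functional L ->
  koopman_invariant L ->
  primitive_continuous L ->
  exists2 g, left_kernel g & forall f, bounded_measurable f -> L f = kernel_functional g f.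
Proof.
move=> linL invL contL.
have [U [ultraU subU]] := ultraFilterLemma eventually_filter.
pose Y := {f : R -> R | bounded_measurable f}.
pose u (f : Y) : 'cV[R]_N := \col_m jump m (resolvent (primitive (proj1_sig f))).
pose v (f : Y) := limvec U (proj1_sig f).
pose ext (g : 'rV[R]_N) (m : nat) : R := if insub m is Some i then g 0 i else 0.
have extE g (i : 'I_N) : ext g i = g 0 i by rewrite /ext valK.
have kerE (g : 'rV[R]_N) : g *m kernel_matrix = 0 -> left_kernel (ext g).
  move=> gB m' m'N; have /rowP/(_ (Ordinal m'N)) := gB.
  rewrite mulmxBr mulmx1 !mxE => /eqP; rewrite subr_eq0 => /eqP h.
  rewrite -[m']/(nat_of_ord (Ordinal m'N)) extE h big_mkord.
  by apply: eq_bigr => m _; rewrite extE !mxE.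
have funE (g : 'rV[R]_N) f : (g *m u f) 0 0 = kernel_functional (ext g) (proj1_sig f).
  by rewrite mxE /kernel_functional big_mkord; apply: eq_bigr => m _; rewrite extE mxE.
have [||g gB|g gB g0|g gB Lg] := @compatible_left_kernel _ _ Y kernel_matrix u v
  (fun f => L (proj1_sig f)).
- by move=> f; exact: (limvec_kernel ultraU subU (proj2_sig f)).
- exact: (compatible_functional ultraU subU linL invL contL).
- rewrite (_ : (fun y => _) = fun f : Y => kernel_functional (ext g) (proj1_sig f)).
    exact: (compatible_functional ultraU subU (kernel_functional_linear (ext g))
      (kernel_functional_invariant (kerE _ gB)) (@kernel_functional_continuous (ext g))).
  by apply/funext => f; exact: funE.
- apply/rowP => i; rewrite mxE -extE.
  apply: (kernel_functional_inj (kerE _ gB)) => // f bf.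
  by rewrite -[f]/(proj1_sig (exist _ f bf : Y)) -funE.
exists (ext g); first exact: kerE.
by move=> f bf; have := Lg (exist _ f bf); rewrite funE.
Qed.

(** * The pairing with the candidate densities *)

Definition green (y x : R) : R := resolvent (fun u => \1_(`[0, u[) x) y.

Lemma indic_below_bounded x : bounded01 (fun u => \1_(`[0, u[) x) 1.
Proof. by move=> u _; rewrite indicE; case: (_ \in _); rewrite ?normr1 ?normr0. Qed.

Lemma green_bounded y x : 0 <= y <= 1 -> `|green y x| <= 1 / (1 - ratio).
Proof. by move=> y01; exact: resolvent_bounded (indic_below_bounded x) _ y01. Qed.

Lemma greenE y x : 0 <= y <= 1 -> green y x = \1_(`[0, y[) x + avg (green^~ x) y.
Proof. by move=> y01; exact: (resolventE (indic_below_bounded x) y01). Qed.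

Lemma measurable_green y : 0 <= y <= 1 ->
  measurable_fun [set: measurableTypeR R] (green y).
Proof.
move=> y01; apply: measurable_asum => // t _.
elim: t y y01 => [|t ih] y y01 /=.
  by apply: measurable_indic; exact: measurable_itv.
apply: measurable_asum => // j Oj; apply: measurable_funM => //.
by apply: ih; exact: Tmap01.
Qed.

Lemma integrable_unit f : bounded_measurable f -> leb.-integrable `[0, 1] (EFin \o f).
Proof. by move=> bf; apply: integrable_bounded => //; exact: unit_itv_lty. Qed.

Lemma integral_branch (f : R -> R) (i : nat) (w : nat -> R) : bounded_measurable f ->
  (1 <= i <= N)%N -> (forall j, Om j -> 0 <= w j <= 1) ->
  \int[leb]_(x in `[0, 1]) (f x * asum Om (fun j => p j / k i j * green (w j) x)) =
  asum Om (fun j => p j / k i j * \int[leb]_(x in `[0, 1]) (f x * green (w j) x)).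
Proof.
move=> bf iN w01.
have bm j : Om j -> bounded_measurable (green (w j)).
  move=> Oj; split; first by apply: measurable_green; exact: w01.
  by exists (1 / (1 - ratio)) => x; by apply: green_bounded; exact: w01.
rewrite (@Rintegral_mul_asum _ _ _ _ _ (fun j => 1 / (1 - ratio) * (p j / `|k i j|))).
- apply: eq_asum => j Oj; rewrite -RintegralZl//; last first.
    by apply: integrable_unit; apply: bounded_measurableM => //; exact: bm.
  by apply: eq_Rintegral => x _; rewrite mulrCA.
- by [].
- exact: integrable_unit.
- by move=> j Oj; apply: measurable_funM => //; by apply: measurable_green; exact: w01.
- move=> j x Oj; apply: (branch_le (u := fun j => green (w j) x)) => // j' Oj'.
  by apply: green_bounded; exact: w01.
- by apply: abs_summableZ; exact: summable_rho.
Qed.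

Lemma bounded_measurable_green y : 0 <= y <= 1 -> bounded_measurable (green y).
Proof.
move=> y01; split; first exact: measurable_green.
by exists (1 / (1 - ratio)) => x; exact: green_bounded.
Qed.

Lemma bounded_measurable_branch_green i w : (1 <= i <= N)%N ->
  (forall j, Om j -> 0 <= w j <= 1) ->
  bounded_measurable (fun x => asum Om (fun j => p j / k i j * green (w j) x)).
Proof.
move=> iN w01.
apply: (@bounded_measurable_asum _ _ _ (fun j => 1 / (1 - ratio) * (p j / `|k i j|))).
- by move=> j Oj; apply: measurable_funM => //; apply: measurable_green; exact: w01.
- move=> j x Oj; apply: (branch_le (u := fun j => green (w j) x)) => // j' Oj'.
  by apply: green_bounded; exact: w01.
- by apply: abs_summableZ; exact: summable_rho.
Qed.

Lemma integral_unit_le f K : bounded_measurable f -> (forall x, `|f x| <= K) ->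
  `|\int[leb]_(x in `[0, 1]) f x| <= K.
Proof.
move=> bf fK; have : `|primitive f 1| <= K.
  by apply: primitive_bounded => //; rewrite ler01 lexx.
rewrite primitiveE// Rintegral_itv_bndo_bndc//.
apply: integrable_bounded => //; apply: (@lebesgue_itv_lty _ _ 0 1) => x.
by rewrite /= !in_itv/= => /andP[-> /ltW ->].
Qed.

(** By [greenE] and Fubini, the left-hand side solves, as a function of [y], the
    equation that characterises the resolvent of [primitive f]. *)
Lemma integral_green f y : bounded_measurable f -> 0 <= y <= 1 ->
  \int[leb]_(x in `[0, 1]) (f x * green y x) = resolvent (primitive f) y.
Proof.
move=> bf; have [_ [K fK]] := bf; have PK := primitive_bounded bf fK.
have K0 : 0 <= K by exact: le_trans (fK 0).
have c0 : 0 <= 1 / (1 - ratio) by rewrite divr_ge0// subr_ge0; case/andP: ratio01 => _ /ltW.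
pose Phi y := \int[leb]_(x in `[0, 1]) (f x * green y x).
have PhiB : bounded01 Phi (K * (1 / (1 - ratio))).
  move=> u u01; apply: integral_unit_le.
    by apply: bounded_measurableM => //; exact: bounded_measurable_green.
  by move=> x; rewrite normrM; apply: ler_pM => //; exact: green_bounded.
move: y; apply: (resolvent_unique PK PhiB) => y y01.
have [i iN iy] := exists_piece y01.
have gE x : green y x = \1_(`[0, y[) x +
    asum Om (fun j => p j / k i j * green (Tmap S j y) x).
  by rewrite greenE// (avgE _ iN iy).
rewrite (avgE _ iN iy) /Phi -integral_branch//; last by move=> j Oj; exact: Tmap01.
have b1 : bounded_measurable (fun x : R => f x * \1_(`[0, y[) x).
  by apply: bounded_measurableM => //; exact: bounded_measurable_indic.
have b2 : bounded_measurable (fun x => f x * asum Om (fun j => p j / k i j * green (Tmap S j y) x)).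
  apply: bounded_measurableM => //; apply: bounded_measurable_branch_green => // j Oj.
  exact: Tmap01.
rewrite /primitive [X in _ = X + _](_ : _ = \int[leb]_(x in `[0, 1]) (f x * \1_(`[0, y[) x)).
  rewrite -RintegralD//; [|exact: integrable_unit b1|exact: integrable_unit b2].
  by apply: eq_Rintegral => x _; rewrite gE mulrDr.
by apply: eq_Rintegral => x _; rewrite mulrC.
Qed.

Lemma h_basisE m x : (1 <= m < N)%N -> h_basis S m x = jump m (green^~ x).
Proof.
move=> /andP[m1 mN]; have mN' : (1 <= m <= N)%N by rewrite m1 ltnW.
have m0 : (m == 0%N) = false by case: m m1 {mN mN'}.
have Lg y : 0 <= y <= 1 -> L_fun S y x = green y x by move=> y01; exact: L_funE.
rewrite /h_basis /jump m0 asumB.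
- by congr (_ - _); apply: eq_asum => j Oj; rewrite Lg// ?a_01// b_01.
- apply: (summable_branch mN' (B := 1 / (1 - ratio))) => j Oj.
  by rewrite Lg ?a_01//; apply: green_bounded; exact: a_01.
- apply: (@summable_branch m.+1 _ (1 / (1 - ratio))) => // j Oj.
  by rewrite Lg ?b_01//; apply: green_bounded; exact: b_01.
Qed.

Lemma bounded_measurable_h_basis m : (1 <= m < N)%N -> bounded_measurable (h_basis S m).
Proof.
move=> mN; have -> : h_basis S m = fun x => jump m (green^~ x).
  by apply/funext => x; exact: h_basisE.
have /andP[m1 mN0] := mN; have mN' : (1 <= m <= N)%N by rewrite m1 ltnW.
have m0 : (m == 0%N) = false by case: m m1 {mN mN' mN0}.
have br := bounded_measurable_branch_green mN' (fun j Oj => a_01 mN' Oj).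
have bl := @bounded_measurable_branch_green m.+1 _ mN0 (fun j Oj => b_01 mN0 Oj).
have -> : (fun x => jump m (green^~ x)) = fun x => right_end m (green^~ x) +
    -1 * left_end m (green^~ x).
  by apply/funext => x; rewrite /jump m0 mulN1r.
exact: bounded_measurableD.
Qed.

Lemma integral_h_basis m f : (1 <= m < N)%N -> bounded_measurable f ->
  \int[leb]_(x in `[0, 1]) (f x * h_basis S m x) = jump m (resolvent (primitive f)).
Proof.
move=> mN bf; have /andP[m1 mN0] := mN; have mN' : (1 <= m <= N)%N by rewrite m1 ltnW.
have m0 : (m == 0%N) = false by case: m m1 {mN mN' mN0}.
have br := bounded_measurable_branch_green mN' (fun j Oj => a_01 mN' Oj).
have bl := @bounded_measurable_branch_green m.+1 _ mN0 (fun j Oj => b_01 mN0 Oj).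
have -> : \int[leb]_(x in `[0, 1]) (f x * h_basis S m x) =
    \int[leb]_(x in `[0, 1]) (f x * right_end m (green^~ x) - f x * left_end m (green^~ x)).
  by apply: eq_Rintegral => x _; rewrite h_basisE// /jump m0 mulrBr.
rewrite RintegralB//; [|exact: integrable_unit (bounded_measurableM bf br)|
  exact: integrable_unit (bounded_measurableM bf bl)].
rewrite /right_end /left_end integral_branch//; last by move=> j Oj; exact: a_01.
rewrite (@integral_branch _ m.+1)//; last by move=> j Oj; exact: b_01.
rewrite /jump m0; congr (_ - _); apply: eq_asum => j Oj; rewrite integral_green//.
  exact: a_01.
exact: b_01.
Qed.

(** The coefficients as a function of the partition points [zpt S m], with 0 at the
    two end points of [0, 1]. *)
Definition extension (gamma : 'cV[R]_N.-1) (m : nat) : R :=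
  if m is m'.+1 then if insub m' is Some i then gamma i 0 else 0 else 0.

Lemma extensionE gamma (m : 'I_N.-1) : extension gamma m.+1 = gamma m 0.
Proof. by rewrite /extension valK. Qed.

Lemma extension_last gamma : extension gamma N = 0.
Proof.
suff h m : m = N -> extension gamma m = 0 by exact: h.
by case: m => // m mN; rewrite /extension insubF// -mN ltnn.
Qed.

Lemma sum_extension gamma (F : nat -> R) :
  \sum_(0 <= m < N) extension gamma m * F m = \sum_(m < N.-1) gamma m 0 * F m.+1.
Proof.
rewrite -{1}(prednK nint_gt0) big_nat_recl//= mul0r add0r big_mkord.
by apply: eq_bigr => m _; rewrite -extensionE.
Qed.

Lemma ord_pred_range (m : 'I_N.-1) : (1 <= m.+1 < N)%N.
Proof. by rewrite /= -ltn_predRL; exact: ltn_ord. Qed.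

Lemma bounded_measurable_h_gamma gamma : bounded_measurable (h_gamma S gamma).
Proof.
have := @linear_functional_sum (fun f : R -> R => primitive f 0) 'I_N.-1 (index_enum _)
  (fun m => gamma m 0) (fun m => h_basis S m.+1) (linear_functional_primitive 0).
by case => // m; exact: bounded_measurable_h_basis (ord_pred_range m).
Qed.

Lemma linear_functional_pairing (h : R -> R) : leb.-integrable `[0, 1] (EFin \o h) ->
  linear_functional (fun g => \int[leb]_(x in `[0, 1]) (h x * g x)).
Proof.
move=> hi f g a bf bg.
have i1 := integrable_mul_bounded m01 hi bf.
have i2 := integrable_mul_bounded m01 hi bg.
rewrite -RintegralZl// -RintegralD//.
  by apply: eq_Rintegral => x _; ring.
have := integrable_mul_bounded m01 hi (bounded_measurableM (bounded_measurable_cst a) bg).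
by apply: eq_integrable => // x _ /=; congr EFin; ring.
Qed.

Lemma integral_h_gamma gamma f : bounded_measurable f ->
  \int[leb]_(x in `[0, 1]) (h_gamma S gamma x * f x) =
  kernel_functional (extension gamma) f.
Proof.
move=> bf; rewrite /kernel_functional sum_extension.
pose L g := \int[leb]_(x in `[0, 1]) (f x * g x).
have linL : linear_functional L by exact/linear_functional_pairing/integrable_unit.
have [_] := @linear_functional_sum L 'I_N.-1 (index_enum _)
  (fun m => gamma m 0) (fun m => h_basis S m.+1) linL
  (fun m => bounded_measurable_h_basis (ord_pred_range m)).
rewrite /L => e; transitivity (\int[leb]_(x in `[0, 1]) (f x * h_gamma S gamma x)).
  by apply: eq_Rintegral => x _; rewrite mulrC.
rewrite e; apply: eq_bigr => m _; congr (_ * _).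
exact: integral_h_basis (ord_pred_range m) bf.
Qed.

Lemma fundamental_matrix_kernel gamma :
  fundamental_matrix S *m gamma = 0 <-> left_kernel (extension gamma).
Proof.
have kP := @left_kernelP (extension gamma) erefl (extension_last gamma).
split=> [/colP h|/kP h].
  apply/kP => n /andP[n1 nN].
  have n1' : (n.-1 < N)%N by rewrite prednK.
  have := h (Ordinal n1'); rewrite sum_extension !mxE => h'; rewrite -[RHS]h'.
  by apply: eq_bigr => m _; rewrite mxE/= prednK// mulrC.
apply/colP => n; rewrite mxE [RHS]mxE.
have := h n.+1; rewrite sum_extension => h'; rewrite -[RHS]h'; last by rewrite ltn_ord.
by apply: eq_bigr => m _; rewrite mxE mulrC.
Qed.

(** * Duality with the Perron-Frobenius operator *)

(** The contribution of the branch on piece [i]. Restricting it to the open piece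
    affects [PF1] only at the images of partition points. *)
Definition pf_branch (j : nat) (h : R -> R) (i : nat) (x : R) : R :=
  \1_(open_piece i) ((k i j)^-1 * x + - (d i j / k i j)) *
  h ((k i j)^-1 * x + - (d i j / k i j)) / `|k i j|.

Definition pf_regular (h : R -> R) (x : R) : R :=
  asum Om (fun j => p j * \sum_(1 <= i < N.+1) pf_branch j h i x).

Lemma inverse_branch i j x y : (1 <= i <= N)%N -> Om j ->
  (x = (k i j)^-1 * y + - (d i j / k i j)) <-> (k i j * x + d i j = y).
Proof.
move=> iN Oj; have k0 := slope_neq0 iN Oj.
by split=> [->|<-]; field.
Qed.

Lemma derive1_Tmap i j y : (1 <= i <= N)%N -> Om j -> open_piece i y ->
  derive1 (Tmap S j) y = k i j.
Proof.
move=> iN Oj iy; rewrite derive1E.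
rewrite (@near_eq_derive _ _ _ _ (fun y => k i j * y + d i j)).
  have -> : (fun y => k i j * y + d i j) = (k i j *: id + cst (d i j)).
    by apply/funext.
  by rewrite deriveD// deriveZ/= ?derive_id ?derive_cst ?addr0 //; rewrite /GRing.scale/= mulr1.
have : \forall a \near y, open_piece i a.
  by apply: open_nbhs_nbhs; split => //; exact: interval_open.
by apply: filterS => a ia; rewrite (Tmap_affine iN Oj)//; exact: open_piece_piece.
Qed.

Definition endpoint_images : set R :=
  \bigcup_j \bigcup_(i in [set i | (i <= N)%N]) [set Tmap S j (z i)].

(** Away from the images of partition points, every preimage of [x] lies inside a
    piece, and each piece contains at most one. *)
Lemma PF1E j (h : R -> R) x : Om j -> ~ endpoint_images x ->
  PF1 (Tmap S j) h x = \sum_(1 <= i < N.+1) pf_branch j h i x.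
Proof.
move=> Oj xE; pose e i := (k i j)^-1 * x + - (d i j / k i j).
pose J := [set i | (1 <= i <= N)%N /\ open_piece i (e i)].
pose A := [set y : R | 0 <= y <= 1 /\ Tmap S j y = x].
have be : set_bij J A e.
  split.
  - move=> i [iN ie]; have Ii := open_piece_piece iN ie; split; first exact: piece01 Ii.
    by rewrite (Tmap_affine iN Oj Ii); apply/inverse_branch.
  - move=> i i' /set_mem[iN ie] /set_mem[i'N i'e] ee.
    apply: (@piece_uniq i i' (e i)) => //; first exact: open_piece_piece.
    by rewrite ee; exact: open_piece_piece.
  - move=> y [y01 Ty]; have [i iN iy] := exists_piece y01.
    have ey : e i = y by apply/esym/inverse_branch => //; rewrite -(Tmap_affine iN Oj iy).
    exists i => //; split => //; rewrite ey /open_piece /= in_itv/=.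
    have /andP[h1 h2] := piece_itv iN iy; have /andP[i1 iN'] := iN.
    rewrite !lt_neqAle h1 h2 !andbT; apply/andP; split; apply/eqP => zy; apply: xE;
      exists j => //; [exists i.-1|exists i] => //=.
    + exact: leq_trans (leq_pred _) iN'.
    + by rewrite zy Ty.
    + by rewrite -zy Ty.
rewrite /PF1 -/A (reindex_fsbig e J A _ be).
rewrite (eq_fsbigr (fun i => pf_branch j h i x)); last first.
  move=> i /set_mem[iN ie]; rewrite /pf_branch -/(e i) indicE mem_set// mul1r.
  by rewrite (derive1_Tmap iN Oj ie).
rewrite [RHS]fsbig_seq; last exact: iota_uniq.
apply: fsbig_widen; first by move=> i [iN _]; rewrite /= mem_index_iota ltnS.
move=> i [/=]; rewrite mem_index_iota ltnS => iN iJ.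
rewrite /pf_branch -/(e i) indicE memNset ?mul0r// => ie; exact: iJ.
Qed.

Lemma PF_ae h : ae_eq01 (PF S h) (pf_regular h).
Proof.
have cE : countable endpoint_images.
  apply: bigcup_countable => // j _; apply: bigcup_countable => //.
exists endpoint_images; split.
- apply: (@countable_measurable _ (measurableTypeR R)) => //; exact: measurable_set1.
- exact: countable_lebesgue_measure0.
- move=> x /= nx; apply: contrapT => xE; apply: nx => _.
  by apply: eq_asum => j Oj; rewrite PF1E.
Qed.

(** The change of variables given by the branch. *)
Lemma pf_branch_pairing (h f : R -> R) i j : leb.-integrable setT (EFin \o h) ->
  bounded_measurable f -> (1 <= i <= N)%N -> Om j ->
  [/\ measurable_fun [set: measurableTypeR R] (pf_branch j h i),
      leb.-integrable `[0, 1] (EFin \o pf_branch j h i),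
      \int[leb]_(x in `[0, 1]) `|pf_branch j h i x| <= \int[leb]_x `|h x| &
      \int[leb]_(x in `[0, 1]) (pf_branch j h i x * f x) =
      \int[leb]_(x in open_piece i) (h x * f (k i j * x + d i j))].
Proof.
move=> hi bf iN Oj; have k0 := slope_neq0 iN Oj.
have ki0 : (k i j)^-1 != 0 by rewrite invr_neq0.
pose w x := h x * \1_(open_piece i) x.
have wi : leb.-integrable setT (EFin \o w).
  by apply: integrable_mul_bounded => //; exact: (bounded_measurable_indic (measurable_open_piece i)).
have wE x : pf_branch j h i x = w ((k i j)^-1 * x + - (d i j / k i j)) * `|k i j|^-1.
  by rewrite /pf_branch /w mulrC [h _ * _]mulrC mulrC.
have ui : leb.-integrable setT (EFin \o pf_branch j h i).
  have := integrable_mul_bounded measurableT (integrable_affine (- (d i j / k i j)) ki0 wi)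
    (bounded_measurable_cst `|k i j|^-1).
  by apply: eq_integrable => // x _; rewrite /= wE.
have supp x : ~~ (0 <= x <= 1) -> pf_branch j h i x = 0.
  move=> /negP nx; rewrite wE /w indicE memNset ?mulr0 ?mul0r// => ie; apply: nx.
  have Ii := open_piece_piece iN ie; have := Tmap01 Oj (piece01 iN Ii).
  by rewrite (Tmap_affine iN Oj Ii) ((inverse_branch _ x iN Oj).1 erefl).
have toT (u : R -> R) : (forall x, ~~ (0 <= x <= 1) -> u x = 0) ->
    \int[leb]_(x in `[0, 1]) u x = \int[leb]_x u x.
  move=> u0; rewrite -(@Rintegral_indic _ `[0, 1] setT)//; apply: eq_Rintegral => x _.
  rewrite indicE; have [x01|x01] := boolP (x \in _); first by rewrite mul1r.
  rewrite mul0r u0//; apply: contra x01 => x01; apply/mem_set.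
  by rewrite /= in_itv.
have brE x : pf_branch j h i (k i j * x + d i j) = w x * `|k i j|^-1.
  by rewrite wE; congr (w _ * _); apply/esym/inverse_branch.
have nk0 : `|k i j| != 0 by rewrite normr_eq0.
split.
- by move/integrableP : ui => [/measurable_EFinP].
- exact: integrableS ui.
- rewrite toT; last by move=> x /supp ->; rewrite normr0.
  rewrite (Rintegral_affine (d i j) k0); last exact: integrable_norm.
  have win := integrable_norm wi.
  have -> : \int[leb]_x `|pf_branch j h i (k i j * x + d i j)| =
      \int[leb]_x (`|k i j|^-1 * `|w x|).
    apply: eq_Rintegral => x _; rewrite brE normrM mulrC; congr (_ * _).
    by rewrite ger0_norm ?invr_ge0.
  rewrite RintegralZl// mulrA mulfV// mul1r; apply: le_Rintegral => //.
    exact: integrable_norm.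
  move=> x _; rewrite normrM ler_piMr// indicE.
  by case: (_ \in _); rewrite ?normr1 ?normr0.
- rewrite toT; last by move=> x /supp ->; rewrite mul0r.
  rewrite (Rintegral_affine (d i j) k0); last exact: integrable_mul_bounded.
  rewrite -(@Rintegral_indic _ (open_piece i) setT)//.
  have bfa : bounded_measurable (fun x => f (k i j * x + d i j)).
    have [mf [K fK]] := bf; split; last by exists K.
    exact: measurableT_comp mf (measurable_affine _ _).
  rewrite -RintegralZl//; last first.
    have := integrable_mul_bounded measurableT
      (integrable_mul_bounded measurableT wi bfa) (bounded_measurable_cst `|k i j|^-1).
    by apply: eq_integrable => // x _; rewrite /= brE mulrAC.
  apply: eq_Rintegral => x _; rewrite brE /w.
  by rewrite mulrA mulrCA mulfV// mulr1 mulrA [h x * _]mulrC.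
Qed.

(** No branch has a larger L1 norm than [h], so the sum over the letters is
    dominated by a multiple of the probabilities and Fubini applies; the sum of the pairings over branches and letters is that of [integral_koopman]. *)
Lemma integral_pf_regular (h f : R -> R) : leb.-integrable setT (EFin \o h) ->
  bounded_measurable f ->
  leb.-integrable `[0, 1] (EFin \o pf_regular h) /\
  \int[leb]_(x in `[0, 1]) (pf_regular h x * f x) =
  \int[leb]_(x in `[0, 1]) (h x * koopman f x).
Proof.
move=> hi bf; pose C := \int[leb]_x `|h x|.
pose v g j (x : measurableTypeR R) := p j * \sum_(1 <= i < N.+1) (pf_branch j h i x * g x).
have brI g i j : bounded_measurable g -> (1 <= i <= N)%N -> Om j ->
    leb.-integrable `[0, 1] (EFin \o (fun x => pf_branch j h i x * g x)).
  move=> bg iN Oj; have [_ ui _ _] := pf_branch_pairing hi bg iN Oj.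
  exact: integrable_mul_bounded m01 ui bg.
have brK g i j K : bounded_measurable g -> (forall x, `|g x| <= K) ->
    (1 <= i <= N)%N -> Om j ->
    \int[leb]_(x in `[0, 1]) `|pf_branch j h i x * g x| <= C * K.
  move=> bg gK iN Oj; have [_ ui uC _] := pf_branch_pairing hi bg iN Oj.
  have K0 : 0 <= K by exact: le_trans (gK 0).
  apply: (@le_trans _ _ (\int[leb]_(x in `[0, 1]) (`|pf_branch j h i x| * K))).
    apply: le_Rintegral => //.
    - exact: integrable_norm (brI g i j bg iN Oj).
    - exact: integrable_mul_bounded m01 (integrable_norm ui) (bounded_measurable_cst K).
    - by move=> x _; rewrite normrM ler_wpM2l.
  rewrite RintegralZr//; last exact: integrable_norm ui.
  by rewrite ler_wpM2r.
have vI g j : bounded_measurable g -> Om j -> leb.-integrable `[0, 1] (EFin \o v g j).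
  move=> bg Oj; have [si _] := @Rintegral_sum _ _ 1 N.+1 _ m01 (fun i iN => brI g i j bg iN Oj).
  have := integrable_mul_bounded m01 si (bounded_measurable_cst (p j)).
  by apply: eq_integrable => // x _ /=; rewrite mulrC.
have mv g j : bounded_measurable g -> Om j -> measurable_fun (`[0, 1]%classic : set (measurableTypeR R)) (v g j).
  by move=> bg Oj; have /integrableP[/measurable_EFinP] := vI g j bg Oj.
have sv g : bounded_measurable g ->
    (\esum_(j in Om) \int[leb]_(x in `[0%R, 1%R]) `|(v g j x)%:E| < +oo)%E.
  move=> bg; have [_ [K gK]] := bg; pose B := \sum_(1 <= i < N.+1) (C * K).
  have B0 : 0 <= B.
    apply: sumr_ge0 => i _; rewrite mulr_ge0 ?Rintegral_ge0//.
    exact: le_trans (gK 0).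
  apply: (@le_lt_trans _ _ (\esum_(j in Om) (B%:E * `|p j|%:E))%E); last first.
    by rewrite esumZ// lte_mul_pinfty ?lee_fin//; exact: summable_prob.
  apply: le_esum => j Oj; have vj := integrable_norm (vI g j bg Oj).
  have -> : (\int[leb]_(x in `[0%R, 1%R]) `|(v g j x)%:E|)%E =
      (\int[leb]_(x in `[0, 1]) `|v g j x|)%:E.
    by rewrite /Rintegral fineK//; exact: integrable_fin_num vj.
  have [si se] := @Rintegral_sum _ _ 1 N.+1 _ m01 (fun i iN => integrable_norm (brI g i j bg iN Oj)).
  rewrite -EFinM lee_fin.
  apply: (@le_trans _ _ (\int[leb]_(x in `[0, 1])
      (`|p j| * \sum_(1 <= i < N.+1) `|pf_branch j h i x * g x|))).
    apply: le_Rintegral => //.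
      have := integrable_mul_bounded m01 si (bounded_measurable_cst `|p j|).
      by apply: eq_integrable => // x _ /=; rewrite mulrC.
    by move=> x _; rewrite normrM ler_wpM2l// ler_norm_sum.
  rewrite RintegralZl// mulrC ler_wpM2r// se; apply: ler_sum_nat => i iN.
  exact: brK.
have pfE g x : pf_regular h x * g x = asum Om (fun j => v g j x).
  rewrite mulrC -asumZ; apply: eq_asum => j _.
  by rewrite /v -mulr_suml mulrC mulrA.
have intE g : bounded_measurable g ->
    leb.-integrable `[0, 1] (EFin \o (fun x => pf_regular h x * g x)) /\
    \int[leb]_(x in `[0, 1]) (pf_regular h x * g x) =
    asum Om (fun j => \int[leb]_(x in `[0, 1]) v g j x).
  move=> bg; have mvg j := mv g j bg.
  have := integrable_asum m01 mvg (sv g bg); have := Rintegral_asum m01 mvg (sv g bg).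
  move=> e i; split.
    by apply: eq_integrable i => // x _ /=; rewrite pfE.
  by rewrite -e; apply: eq_Rintegral => x _; rewrite pfE.
split.
  have [+ _] := intE (fun=> 1) (bounded_measurable_cst 1).
  by apply: eq_integrable => // x _ /=; rewrite mulr1.
rewrite (intE f bf).2 integral_koopman//; last exact: integrableS hi.
have [_ [K fK]] := bf.
rewrite -asum_sum.
  apply: eq_asum => j Oj.
  have [si se] := @Rintegral_sum _ _ 1 N.+1 _ m01 (fun i iN => brI f i j bf iN Oj).
  rewrite RintegralZl// se mulr_sumr; apply: eq_big_nat => i iN.
  by have [_ _ _ ->] := pf_branch_pairing hi bf iN Oj.
move=> i; rewrite mem_index_iota ltnS => iN; apply: (asum_prob_bounded (K := C * K) _).1.
move=> j Oj; have [_ _ _ <-] := pf_branch_pairing hi bf iN Oj.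
apply: le_trans (le_normr_Rintegral m01 (brI f i j bf iN Oj)) _.
exact: brK.
Qed.

Let aeF : Filter (almost_everywhere leb) := ae_filter_ringOfSetsType leb.

Lemma eq_ae_eq01 (u v : R -> R) : (forall x, 0 <= x <= 1 -> u x = v x) -> ae_eq01 u v.
Proof. by move=> uv; apply: (@filterE _ _ aeF) => x; exact: uv. Qed.

Lemma ae_eq01_sym (u v : R -> R) : ae_eq01 u v -> ae_eq01 v u.
Proof. by move=> uv; apply: (@filterS _ _ aeF _ _ _ uv) => x uvx x01; rewrite uvx. Qed.

Lemma ae_eq01_trans (v u w : R -> R) : ae_eq01 u v -> ae_eq01 v w -> ae_eq01 u w.
Proof.
move=> uv vw; apply: (@filterS2 _ _ aeF _ _ _ _ uv vw) => x uvx vwx x01.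
by rewrite uvx ?vwx.
Qed.

Lemma ae_eq01P (u v : R -> R) : ae_eq01 u v <-> ae_eq leb `[0, 1]%classic (EFin \o u) (EFin \o v).
Proof.
split=> uv; apply: (@filterS _ _ aeF _ _ _ uv) => x /= uvx.
  by rewrite in_itv/= => x01; rewrite uvx.
by move=> x01; have [] : (u x)%:E = (v x)%:E by apply: uvx; rewrite in_itv.
Qed.

Lemma ae_eq_of_pairing (u v : R -> R) :
  leb.-integrable `[0, 1] (EFin \o u) -> leb.-integrable `[0, 1] (EFin \o v) ->
  (forall f, bounded_measurable f ->
    \int[leb]_(x in `[0, 1]) (u x * f x) = \int[leb]_(x in `[0, 1]) (v x * f x)) ->
  ae_eq01 u v.
Proof.
move=> ui vi uv; have /integrableP[mv _] := vi.
apply/ae_eq01P; apply: integral_ae_eq => // A A01 mA.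
have bA := bounded_measurable_indic mA.
have := uv _ bA; under eq_Rintegral do rewrite mulrC.
under [X in _ = X]eq_Rintegral do rewrite mulrC.
rewrite !Rintegral_indic// /Rintegral => e.
rewrite -[LHS]fineK ?e ?fineK//; first exact: integrable_fin_num (integrableS m01 mA A01 vi).
exact: integrable_fin_num (integrableS m01 mA A01 ui).
Qed.

Lemma pairing_ae_eq (u v f : R -> R) :
  leb.-integrable `[0, 1] (EFin \o u) -> leb.-integrable `[0, 1] (EFin \o v) ->
  bounded_measurable f -> ae_eq01 u v ->
  \int[leb]_(x in `[0, 1]) (u x * f x) = \int[leb]_(x in `[0, 1]) (v x * f x).
Proof.
move=> ui vi bf uv; congr fine; apply: ae_eq_integral => //.
- by have /integrableP[] := integrable_mul_bounded m01 ui bf.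
- by have /integrableP[] := integrable_mul_bounded m01 vi bf.
- by apply/ae_eq01P; apply: (@filterS _ _ aeF _ _ _ uv) => x uvx x01; rewrite uvx.
Qed.

(** [PF S h] and [pf_regular h] agree almost everywhere, the pairing of the latter
    with [f] is that of [h] with [koopman f], and integrable functions are
    determined almost everywhere by their pairings. Here [h] is first replaced by
    its restriction to [0, 1], which [pf_regular] needs as an integrable function on
    the line. *)
Lemma invariantP (h : R -> R) : leb.-integrable `[0, 1] (EFin \o h) ->
  T_invariant S h <->
  koopman_invariant (fun f => \int[leb]_(x in `[0, 1]) (h x * f x)).
Proof.
move=> hi; pose h0 x := \1_(`[0, 1]) x * h x.
have h0E x : 0 <= x <= 1 -> h0 x = h x.
  by move=> x01; rewrite /h0 indicE mem_set ?mul1r//= in_itv.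
have hh0 : ae_eq01 h0 h by exact: eq_ae_eq01.
have h0i : leb.-integrable setT (EFin \o h0).
  have := (@integrable_mkcond _ (measurableTypeR R) R leb _ (EFin \o h) m01).1 hi.
  apply: eq_integrable => // x _; rewrite /= /h0 /patch indicE.
  by case: (_ \in _); rewrite ?mul1r ?mul0r.
have h0i01 : leb.-integrable `[0, 1] (EFin \o h0) by exact: integrableS h0i.
have pairE (f : R -> R) : \int[leb]_(x in `[0, 1]) (h0 x * f x) =
    \int[leb]_(x in `[0, 1]) (h x * f x).
  by apply: eq_Rintegral => x; rewrite inE/= in_itv/= => x01; rewrite h0E.
have pri f bf := (integral_pf_regular (f := f) h0i bf).1.
have prE f bf := (integral_pf_regular (f := f) h0i bf).2.
have PF0 : PF S h = PF S h0.
  apply/funext => x; apply: eq_asum => j _; congr (_ * _); apply: eq_fsbigr => y.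
  by move=> /set_mem[y01 _]; rewrite h0E.
have ri := pri _ (bounded_measurable_cst 0).
have rP : ae_eq01 (PF S h) (pf_regular h0) by rewrite PF0; exact: PF_ae.
split=> [Th f bf|hf].
  rewrite -!pairE -prE//; apply: pairing_ae_eq => //.
  exact: ae_eq01_trans (ae_eq01_sym rP) (ae_eq01_trans Th (ae_eq01_sym hh0)).
have : ae_eq01 (pf_regular h0) h0.
  apply: ae_eq_of_pairing => // f bf.
  by rewrite prE// !pairE; exact: hf.
by move=> rh; exact: ae_eq01_trans rP (ae_eq01_trans rh hh0).
Qed.

(** * Invariant densities *)

Lemma ae_h_gammaP (h : R -> R) gamma : leb.-integrable `[0, 1] (EFin \o h) ->
  ae_eq01 h (h_gamma S gamma) <-> (forall f, bounded_measurable f ->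
    \int[leb]_(x in `[0, 1]) (h x * f x) = kernel_functional (extension gamma) f).
Proof.
move=> hi; have gi := integrable_unit (bounded_measurable_h_gamma gamma).
split=> [hg f bf|hg].
  by rewrite (pairing_ae_eq hi gi bf hg) integral_h_gamma.
by apply: ae_eq_of_pairing => // f bf; rewrite hg// integral_h_gamma.
Qed.

Lemma eq_kernel_functional g g' f : (forall m, (m < N)%N -> g m = g' m) ->
  kernel_functional g f = kernel_functional g' f.
Proof. by move=> gg'; apply: eq_big_nat => m /andP[_ mN]; rewrite gg'. Qed.

Lemma eq_left_kernel g g' : (forall m, (m < N)%N -> g m = g' m) ->
  left_kernel g -> left_kernel g'.
Proof.
move=> gg' gk m' m'N; rewrite -gg'// gk//.
by apply: eq_big_nat => m /andP[_ mN]; rewrite gg'.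
Qed.

Lemma invariant_density_iff (h : R -> R) : leb.-integrable `[0, 1] (EFin \o h) ->
  T_invariant S h <->
  exists2 gamma : 'cV[R]_N.-1, fundamental_matrix S *m gamma = 0 &
    ae_eq01 h (h_gamma S gamma).
Proof.
move=> hi; split=> [/(invariantP hi) inv|[gamma /fundamental_matrix_kernel gk /(ae_h_gammaP _ hi) hg]].
  have cont : primitive_continuous (fun f => \int[leb]_(x in `[0, 1]) (h x * f x)).
    by move=> K eta; exact: integrable_small_primitive.
  have [g gk gE] := representation (linear_functional_pairing hi) inv cont.
  pose gamma : 'cV[R]_N.-1 := \col_m g m.+1.
  have ge m : (m < N)%N -> g m = extension gamma m.
    case: m => [_|m mN]; first by rewrite (left_kernel_head gk).
    have mN' : (m < N.-1)%N by rewrite -ltnS prednK// nint_gt0.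
    by rewrite -[m]/(nat_of_ord (Ordinal mN')) extensionE mxE.
  exists gamma; first exact/fundamental_matrix_kernel/(eq_left_kernel ge).
  by apply/(ae_h_gammaP _ hi) => f bf; rewrite gE// (eq_kernel_functional _ ge).
apply/(invariantP hi) => f bf.
by rewrite !hg ?(kernel_functional_invariant gk)//; exact: bounded_measurable_koopman.
Qed.

End RandomSystem.

Theorem theorem5p3 (R : realType) (S : random_pl R) :
  random_system S ->
  common_linear_partition S ->
  no_common_mean_fixed_point S ->
  boundary_preserving S ->
  nonzero_mean_inv_slope S ->
  expanding S ->
  forall h : R -> R,
    lebesgue_measure.-integrable `[0, 1] (EFin \o h) ->
    (T_invariant S h <->
     exists2 gamma : 'cV[R]_((nint S).-1),
       fundamental_matrix S *m gamma = 0 & ae_eq01 h (h_gamma S gamma)).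
Proof. by move=> hsys hpart _ _ hs hexp h; exact: invariant_density_iff. Qed.
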